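(* Let $r<0$, $K>0$, $\lambda>0$ with $\lambda+r>0$. (1) (Put option.) Suppose that $\sup_{\tau\in\mathcal A}\mathbf E_s[e^{-r\tau}G_p(S_\tau)1_{\{T_N^\lambda<\tau<\infty\}}]\to 0$ as $N\to\infty$ for every $s>0$. Then there exist $$0<L_p^*\le L_{p,\infty}^*\le U_{p,\infty}^*\le U_p^*<K$$ such that $\tau_{[L_p^*,U_p^*]}$ solves the put problem, i.e. $V_p(s)=\mathbf E_s\big[e^{-r\tau_{[L_p^*,U_p^*]}}G_p(S_{\tau_{[L_p^*,U_p^*]}})1_{\{\tau_{[L_p^*,U_p^*]}<\infty\}}\big]$ for all $s>0$. (2) (Call option.) Suppose that $\mathbf E_1[S_1]<\infty$, $\lambda+r-\log\mathbf E_1[S_1]>0$, and $\sup_{\tau\in\mathcal A}\mathbf E_s[e^{-r\tau}G_c(S_\tau)1_{\{T_N^\lambda<\tau<\infty\}}]\to 0$ as $N\to\infty$ for every $s>0$. Then one of the following holds: (i) there exist $$K<L_c^*\le L_{c,\infty}^*\le U_{c,\infty}^*\le U_c^*\le\infty$$ such that $\tau_{[L_c^*,U_c^*]}$ solves the call problem, i.e. $V_c(s)=\mathbf E_s\big[e^{-r\tau_{[L_c^*,U_c^*]}}G_c(S_{\tau_{[L_c^*,U_c^*]}})1_{\{\tau_{[L_c^*,U_c^*]}<\infty\}}\big]$ for all $s>0$; (ii) $\bar V_c(s)>G_c(s)$ for all $s>0$.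
   Context: $X=(X_t)_{t\ge0}$ is a real-valued Lévy process and $S_t=e^{X_t}$. For $s>0$, $\mathbf P_s$ (expectation $\mathbf E_s$) is the law under which $S_0=s$. $\mathcal T^\lambda=(T_1^\lambda,T_2^\lambda,\dots)$ are the jump times of a Poisson process $N^\lambda$ of rate $\lambda>0$ independent of $X$. $\mathbb F$ is the filtration generated by $(X,N^\lambda)$ and $\mathbb T$ the set of $\mathbb F$-stopping times. $\mathcal A=\{\tau\in\mathbb T:\tau\in\mathcal T^\lambda\cup\{\infty\}\text{ a.s.}\}$ and $\bar{\mathcal A}=\{\tau\in\mathbb T:\tau\in\mathcal T^\lambda\cup\{0\}\cup\{\infty\}\text{ a.s.}\}$. Payoffs: $G_p(s)=(K-s)^+$, $G_c(s)=(s-K)^+$, $s>0$, where $K$ is the strike price and $r$ the discount rate. For $i\in\{p,c\}$: $V_i(s)=\sup_{\tau\in\mathcal A}\mathbf E_s[e^{-r\tau}G_i(S_\tau)1_{\{\tau<\infty\}}]$, and $\bar V_i(s)=\sup_{\tau\in\bar{\mathcal A}}\mathbf E_s[e^{-r\tau}G_i(S_\tau)1_{\{\tau<\infty\}}]$ is the value of the auxiliary problem in which immediate stopping is also allowed. $\tau_{[L,U]}=\inf\{\tau\in\mathcal T^\lambda:S_\tau\in[L,U]\}$, with $\tau_{[L,\infty]}=\inf\{\tau\in\mathcal T^\lambda:S_\tau\ge L\}$; $\inf\varnothing=\infty$. Classical (continuous observation) case: $V_{i,\infty}(s)=\sup_{\tau\in\mathbb T}\mathbf E_s[e^{-r\tau}G_i(S_\tau)1_{\{\tau<\infty\}}]$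 is the value function when exercise is allowed at any time, and $\mathcal D_{i,\infty}=\{s>0:V_{i,\infty}(s)=G_i(s)\}$ is its stopping region. When $\mathcal D_{i,\infty}\neq\varnothing$, there exist $0\le L_{p,\infty}^*\le U_{p,\infty}^*<K$ and $K<L_{c,\infty}^*\le U_{c,\infty}^*\le\infty$ such that the closure of $\mathcal D_{i,\infty}$ is $[L_{i,\infty}^*,U_{i,\infty}^*]$; these are the quantities $L_{i,\infty}^*,U_{i,\infty}^*$ appearing in the claim. *)

(* Defs.v *)
From HB Require Import structures.
From mathcomp Require Import all_boot all_order all_algebra.
From mathcomp Require Import all_classical all_reals all_analysis.

Set Implicit Arguments.
Unset Strict Implicit.
Unset Printing Implicit Defensive.

Import Order.TTheory GRing.Theory Num.Theory.
Import numFieldNormedType.Exports.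

Local Open Scope classical_set_scope.
Local Open Scope ring_scope.

(* Time is R; only times t >= 0 are constrained, and the values of a process at
   negative times are never used. *)

Definition cadlag (R : realType) (f : R -> R) : Prop :=
  (forall t, 0 <= t -> f u @[u --> t^'+] --> f t) /\
  (forall t, 0 < t -> cvg (f u @[u --> t^'-])).

Definition sigma_of (R : realType) d d' (Omega : measurableType d)
    (E : measurableType d') (I : set R) (Y : R -> Omega -> E) :
    set (set Omega) :=
  <<s \bigcup_(u in I) preimage_set_system setT (Y u) measurable >>.

Definition independent_systems (R : realType) d (Omega : measurableType d)
    (P : probability Omega R) (F G : set (set Omega)) : Prop :=
  forall A B, F A -> G B -> P (A `&` B) = (P A * P B)%E.

(* Paths are cadlag for every w, not just almost surely: the filtration below
   is not completed, and this makes jump and hitting times stopping times. *)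
Record levy_process (R : realType) d (Omega : measurableType d)
    (P : probability Omega R) (X : R -> Omega -> R) : Prop := {
  levy_measurable : forall t, 0 <= t -> measurable_fun setT (X t);
  levy_cadlag : forall w, cadlag (X ^~ w);
  levy_start : {ae P, forall w, X 0 w = 0};
  levy_stationary : forall s t (B : set R), 0 <= s -> s <= t -> measurable B ->
    P [set w | B (X t w - X s w)] = P [set w | B (X (t - s) w)];
  levy_independent : forall s t, 0 <= s -> s <= t ->
    independent_systems P (sigma_of `[0, s] X)
      (preimage_set_system setT (fun w => X t w - X s w) measurable) }.

(* The increment law is required for s < t only: the library's poisson_pmf is
   not the Dirac mass at 0 when the rate is 0.  The subtraction is on nat and
   is not truncated since paths are nondecreasing. *)
Record poisson_process (R : realType) d (Omega : measurableType d)
    (P : probability Omega R) (lambda : R) (N : R -> Omega -> nat) : Prop := {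
  poisson_measurable : forall t, 0 <= t -> measurable_fun setT (N t);
  poisson_nondecreasing : forall w s t, 0 <= s -> s <= t -> (N s w <= N t w)%N;
  poisson_cadlag : forall w, cadlag (fun t => (N t w)%:R : R);
  poisson_start : {ae P, forall w, N 0 w = 0%N};
  poisson_law : forall s t k, 0 <= s -> s < t ->
    P [set w | (N t w - N s w)%N = k] =
    (poisson_pmf (lambda * (t - s)) k)%:E;
  poisson_independent : forall s t, 0 <= s -> s <= t ->
    independent_systems P (sigma_of `[0, s] N)
      (preimage_set_system setT (fun w => (N t w - N s w)%N) measurable) }.

Definition independent_processes (R : realType) d d1 d2
    (Omega : measurableType d) (E1 : measurableType d1)
    (E2 : measurableType d2) (P : probability Omega R)
    (Y : R -> Omega -> E1) (Z : R -> Omega -> E2) : Prop :=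
  independent_systems P (sigma_of `[0, +oo[ Y) (sigma_of `[0, +oo[ Z).

Definition natural_filtration (R : realType) d (Omega : measurableType d)
    (X : R -> Omega -> R) (N : R -> Omega -> nat) (t : R) : set (set Omega) :=
  <<s sigma_of `[0, t] X `|` sigma_of `[0, t] N >>.

Definition stopping_time (R : realType) d (Omega : measurableType d)
    (X : R -> Omega -> R) (N : R -> Omega -> nat) (tau : Omega -> \bar R) :
    Prop :=
  (forall w, 0 <= tau w)%E /\
  (forall t, 0 <= t -> natural_filtration X N t [set w | (tau w <= t%:E)%E]).

(* The n-th jump time of N; it is 0 for n = 0, and +oo if N stays below n. *)
Definition jump_time (R : realType) (Omega : Type) (N : R -> Omega -> nat)
    (n : nat) (w : Omega) : \bar R :=
  ereal_inf [set t%:E | t in [set t : R | 0 <= t /\ (n <= N t w)%N]].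

Definition poisson_strategy (R : realType) d (Omega : measurableType d)
    (P : probability Omega R) (X : R -> Omega -> R) (N : R -> Omega -> nat)
    (tau : Omega -> \bar R) : Prop :=
  stopping_time X N tau /\
  {ae P, forall w, tau w = +oo%E \/
    exists2 n : nat, (0 < n)%N & tau w = jump_time N n w}.

Definition poisson_strategy0 (R : realType) d (Omega : measurableType d)
    (P : probability Omega R) (X : R -> Omega -> R) (N : R -> Omega -> nat)
    (tau : Omega -> \bar R) : Prop :=
  stopping_time X N tau /\
  {ae P, forall w, [\/ tau w = +oo%E, tau w = 0%E |
    exists2 n : nat, (0 < n)%N & tau w = jump_time N n w]}.

(* X starts at 0 under P, so the law of S under P_s is that of s * exp X_t
   under P; the starting value s is an argument of everything below. *)
Definition price (R : realType) (Omega : Type) (X : R -> Omega -> R) (s t : R)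
    (w : Omega) : R := s * expR (X t w).

Definition put_payoff (R : realType) (K s : R) : R := Num.max (K - s) 0.
Definition call_payoff (R : realType) (K s : R) : R := Num.max (s - K) 0.

Definition discounted_payoff (R : realType) (Omega : Type)
    (X : R -> Omega -> R) (r : R) (g : R -> R) (s : R)
    (tau : Omega -> \bar R) (w : Omega) : R :=
  if tau w is t%:E%E then expR (- r * t) * g (price X s t w) else 0.

Definition poisson_value (R : realType) d (Omega : measurableType d)
    (P : probability Omega R) (X : R -> Omega -> R) (N : R -> Omega -> nat)
    (r : R) (g : R -> R) (s : R) : \bar R :=
  ereal_sup [set 'E_P[discounted_payoff X r g s tau]%E
            | tau in poisson_strategy P X N].

Definition poisson_value0 (R : realType) d (Omega : measurableType d)
    (P : probability Omega R) (X : R -> Omega -> R) (N : R -> Omega -> nat)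
    (r : R) (g : R -> R) (s : R) : \bar R :=
  ereal_sup [set 'E_P[discounted_payoff X r g s tau]%E
            | tau in poisson_strategy0 P X N].

Definition poisson_tail_value (R : realType) d (Omega : measurableType d)
    (P : probability Omega R) (X : R -> Omega -> R) (N : R -> Omega -> nat)
    (r : R) (g : R -> R) (s : R) (n : nat) : \bar R :=
  ereal_sup [set 'E_P[(fun w => discounted_payoff X r g s tau w *
                         \1_[set w' | (jump_time N n w' < tau w')%E] w)%R]%E
            | tau in poisson_strategy P X N].

Definition classical_value (R : realType) d (Omega : measurableType d)
    (P : probability Omega R) (X : R -> Omega -> R) (N : R -> Omega -> nat)
    (r : R) (g : R -> R) (s : R) : \bar R :=
  ereal_sup [set 'E_P[discounted_payoff X r g s tau]%E
            | tau in stopping_time X N].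

Definition classical_stopping_region (R : realType) d
    (Omega : measurableType d) (P : probability Omega R)
    (X : R -> Omega -> R) (N : R -> Omega -> nat) (r : R) (g : R -> R) :
    set R :=
  [set s | 0 < s /\ classical_value P X N r g s = (g s)%:E].

(* The infimum over the jump times n >= 1 at which the price is in [L, U];
   U = +oo leaves only the condition L <= S. *)
Definition hit_time (R : realType) (Omega : Type) (X : R -> Omega -> R)
    (N : R -> Omega -> nat) (L : R) (U : \bar R) (s : R) (w : Omega) :
    \bar R :=
  ereal_inf [set t%:E | t in [set t : R |
    (exists2 n : nat, (0 < n)%N & jump_time N n w = t%:E) /\
    (L%:E <= (price X s t w)%:E <= U)%E]].

(* Main.v *)
(** Let [V] be the value of the problem and [\bar V = max (G, V)].  The price
   observed at successive jump times is a random walk: the pairs (waiting time,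
   increment of [X]) are independent of the past with a common law, so that
   [V = Q \bar V] for the kernel [Q f s = E_s[e^(-r T_1) f(S_(T_1))]], and [V] is
   the increasing limit of the values with finitely many observations.
   Stopping at the first observation with [V <= G] loses nothing before the
   [n]-th one, and what comes after is bounded by the tail, which vanishes.

   [Q] preserves convexity and, by Fatou's lemma, lower semicontinuity, hence
   [V] is convex and lower semicontinuous.  Where [V <= G = 0] the payoff vanishes
   along the whole path, so such a point would lie in the classical stopping
   region, which is contained in [G > 0].  Thus [V <= G] is a closed interval
   inside [G > 0], where [G] is affine, and it contains the classical stopping
   region because [V] is at most the classical value.  For the put, [V(0) > K]
   as [r < 0], which keeps the interval away from [0]. *)

Require Import Defs.
From HB Require Import structures.
From mathcomp Require Import all_boot all_order all_algebra.
From mathcomp Require Import zify ring lra.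
From mathcomp Require Import all_classical all_reals all_analysis.
From mathcomp Require Import measurable_realfun.

Set Implicit Arguments.
Unset Strict Implicit.
Unset Printing Implicit Defensive.

Import Order.TTheory GRing.Theory Num.Theory.
Import numFieldNormedType.Exports.

Local Open Scope classical_set_scope.
Local Open Scope ring_scope.

(** * Grids and sampled paths *)

(** The obstacle is the strong Markov property at the random times [T_n]: the hypotheses concern
    deterministic times, and [X] and [N] are only known to be independent as whole processes. Jump
    times are therefore rounded up to a grid, where they take countably many values and each event
    reduces to increments after a fixed time. The identity found there is exact for every mesh, and
    right-continuity lets the mesh tend to 0. Since increments converge only pointwise, the limit is
    taken against continuous test functions, which then recover boxes and so all Borel sets.

    Adaptedness has to hold on every path because the filtration is not completed, while finiteness
    and strict growth of the jump times hold only almost surely; stopping events are thus defined on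
    all paths and compared off a null set.

    The value may be infinite a priori, so the optimality arguments integrate nonnegative extended
    reals and add remainders instead of subtracting values. It is defined for every real starting
    price: the price 0 is needed as a possible limit of points of the stopping region. *)

Section grid.
Context {R : realType}.
Implicit Types (t : R) (m i : nat).

(** Rounding goes upwards: grid times then approach [t] from the right, the side on which paths are
    continuous. *)
Definition grid_index m t : nat := `|Num.ceil (t * m.+1%:R)|%N.
Definition grid m t : R := (grid_index m t)%:R / m.+1%:R.

Lemma grid_index_le m t i : 0 <= t ->
  (grid_index m t <= i)%N = (t <= i%:R / m.+1%:R).
Proof.
move=> t0; rewrite /grid_index ler_pdivlMr ?ltr0n//.
have c0 : (0 <= Num.ceil (t * m.+1%:R))%R.
  by rewrite ceil_ge0 (lt_le_trans (ltrN10 _))// mulr_ge0.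
by rewrite -lez_nat gez0_abs// ceil_le_int.
Qed.

Lemma le_grid m t : 0 <= t -> t <= grid m t.
Proof. by move=> t0; rewrite /grid -grid_index_le. Qed.

Lemma grid_lt m t : 0 <= t -> grid m t < t + m.+1%:R^-1.
Proof.
move=> t0; rewrite /grid /grid_index.
have c0 : (0 <= Num.ceil (t * m.+1%:R))%R.
  by rewrite ceil_ge0 (lt_le_trans (ltrN10 _))// mulr_ge0.
rewrite natr_absz ger0_norm// ltr_pdivrMr ?ltr0n//.
have /andP[+ _] := ceil_itv (t * m.+1%:R).
by rewrite intrD ltrBlDr mulrDl mulVf.
Qed.

Lemma cvg_grid t : 0 <= t -> grid m t @[m --> \oo] --> t.
Proof.
move=> t0; apply: (@squeeze_cvgr _ _ _ _ (cst t) (fun m => t + m.+1%:R^-1)).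
- by apply: nearW => m; rewrite le_grid//= ltW// grid_lt.
- exact: cvg_cst.
- by rewrite -[X in _ --> X]addr0; apply: cvgD; [exact: cvg_cst|exact: cvg_harmonic].
Qed.

Definition gpoint m i : R := i%:R / m.+1%:R.

Lemma gpoint_ge0 m i : 0 <= gpoint m i. Proof. by rewrite divr_ge0. Qed.

Lemma gpointD m i j : gpoint m (i + j) = gpoint m i + gpoint m j.
Proof. by rewrite /gpoint natrD mulrDl. Qed.

Lemma le_gpoint m i j : (gpoint m i <= gpoint m j) = (i <= j)%N.
Proof. by rewrite ler_pM2r ?invr_gt0// ler_nat. Qed.

Lemma cvg_right_seq (f : R -> R) t (u : R^nat) :
  f x @[x --> t^'+] --> f t -> (forall n, t <= u n) -> u @ \oo --> t ->
  f (u n) @[n --> \oo] --> f t.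
Proof.
move=> ft tu ut; apply/cvgrPdist_lt => e e0.
have /cvgrPdist_lt/(_ e e0)[d/= d0 dP] := ft.
have /cvgrPdist_lt/(_ d d0) := ut.
apply: filterS => n tun.
have [->|untn] := eqVneq (u n) t; first by rewrite subrr normr0.
by apply: dP => //=; rewrite lt_neqAle tu eq_sym untn.
Qed.

End grid.

(** The rounded time takes countably many values, so the event splits over them. The times [u] are
    arbitrary in order to cover capped grids as well. *)
Lemma measurable_grid_sample (R : realType) d (T : measurableType d)
    (X : R -> T -> R) (tau : T -> R) (m : nat) (u : R^nat) :
  (forall i, measurable_fun setT (X (u i))) ->
  measurable_fun setT tau -> (forall w, 0 <= tau w) ->
  measurable_fun setT (fun w => X (u (grid_index m (tau w))) w).
Proof.
move=> mX mtau tau0 _ B mB; rewrite setTI.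
pose A i := (tau @^-1` [set x | grid_index m x = i :> nat]) `&` X (u i) @^-1` B.
rewrite [X in measurable X](_ : _ = \bigcup_i A i); last first.
  apply/seteqP; split=> [w hw|w [i _ [/= <- //]]].
  by exists (grid_index m (tau w)).
apply: bigcupT_measurable => i; apply: measurableI; last first.
  by rewrite -[X in measurable X]setTI; exact: mX.
have mle j : measurable [set w | (grid_index m (tau w) <= j)%N].
  rewrite [X in measurable X](_ : _ = tau @^-1` `]-oo, (j%:R / m.+1%:R)]).
    by rewrite -[X in measurable X]setTI; exact: mtau.
  by apply/seteqP; split => w /=; rewrite in_itv/= grid_index_le.
case: i => [|i].
  rewrite [X in measurable X](_ : _ = [set w | (grid_index m (tau w) <= 0)%N])//.
  by apply/seteqP; split => w /=; [move=> ->|rewrite leqn0 => /eqP].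
rewrite [X in measurable X](_ : _ = [set w | (grid_index m (tau w) <= i.+1)%N]
   `\` [set w | (grid_index m (tau w) <= i)%N]); first exact: measurableD.
apply/seteqP; split => w /=; first by move=> ->; rewrite ltnn.
by move=> [+ /negP]; rewrite -ltnNge => a b; apply/eqP; rewrite eqn_leq a b.
Qed.

(** Capping the grid at [c] keeps all sampled times in [[0, c]], so that for adapted [X] the result
    is measurable with respect to the information at time [c] only. *)
Lemma measurable_sample (R : realType) d (T : measurableType d)
    (X : R -> T -> R) (tau : T -> R) (c : R) :
  (forall u, 0 <= u <= c -> measurable_fun setT (X u)) ->
  measurable_fun setT tau ->
  (forall w, 0 <= tau w <= c) ->
  (forall w t, 0 <= t -> X u w @[u --> t^'+] --> X t w) ->
  measurable_fun setT (fun w => X (tau w) w).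
Proof.
move=> mX mtau tau0c rcX.
pose h m w := X (Order.min c (grid m (tau w))) w.
apply: (@measurable_realfun.measurable_fun_cvg _ _ _ _ h); last first.
  move=> w _; apply: (@cvg_right_seq _ (X ^~ w)).
  - by apply: rcX; case/andP: (tau0c w).
  - move=> n; rewrite le_min; case/andP: (tau0c w) => t0 ->/=.
    exact: le_grid.
  - have /andP[t0 tc] := tau0c w.
    apply: (@squeeze_cvgr _ _ _ _ (cst (tau w)) (grid ^~ (tau w))).
    + apply: nearW => m; rewrite ge_min lexx orbT andbT le_min tc/=.
      exact: le_grid.
    + exact: cvg_cst.
    + exact: cvg_grid.
move=> m; apply: (@measurable_grid_sample _ _ _ X tau m
  (fun i => Order.min c (i%:R / m.+1%:R))) => // [i|w]; last first.
  by case/andP: (tau0c w).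
have c0 : 0 <= c by have /andP[] := tau0c point; exact: le_trans.
by apply: mX; rewrite le_min c0 divr_ge0//= ge_min lexx.
Qed.

Lemma le0_of_le_div_nat (R : realType) (p : \bar R) (c : R) :
  (forall k : nat, (p <= (c / k.+1%:R)%:E)%E) -> (p <= 0)%E.
Proof.
move=> pc; apply: (cvge_to_ge (f := fun k : nat => (c / k.+1%:R)%:E) (a := \oo)); last exact: nearW.
apply: cvg_EFin; first exact: nearW.
rewrite /= -(mulr0 c); apply: cvgM; first exact: cvg_cst.
exact: cvg_harmonic.
Qed.

(** * Jump times of the Poisson process *)

Section jump_times.
Context (R : realType) d (Omega : measurableType d) (P : probability Omega R)
  (N : R -> Omega -> nat) (lambda : R) (hN : poisson_process P lambda N)
  (hlambda : 0 < lambda).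
Implicit Types (n : nat) (w : Omega) (t : R).

(** Right-continuity makes the increase smaller than 1 just after [t], and an integer below 1 is
    0. *)
Lemma poisson_right_constant w t : 0 <= t ->
  exists2 e : R, 0 < e & forall u, t <= u -> u < t + e -> N u w = N t w.
Proof.
move=> t0; have [+ _] := poisson_cadlag hN w.
move=> /(_ t t0)/cvgrPdist_lt/(_ 1 ltr01)[e/= e0 eP]; exists e => // u tu ute.
have [->//|ut] := eqVneq u t.
have /eP : `|t - u| < e by rewrite ler0_norm ?subr_le0// opprB ltrBlDl.
rewrite lt_neqAle eq_sym ut tu => /(_ erefl).
have Ntu := poisson_nondecreasing hN w t0 tu.
rewrite distrC ger0_norm ?subr_ge0 ?ler_nat// ltrBlDr addrC natr1 ltr_nat ltnS.
by move=> uN; apply/eqP; rewrite eqn_leq uN Ntu.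
Qed.

(** The infimum is attained because the path is constant just after each time. This holds on every
    path and turns statements on jump times into statements on [N] at fixed times. *)
Lemma jump_time_le n w t : 0 <= t ->
  (jump_time N n w <= t%:E)%E = (n <= N t w)%N.
Proof.
move=> t0; apply/idP/idP => [|nN]; last first.
  by apply: ge_ereal_inf; exists t%:E => //; exists t.
apply: contraTT; rewrite -ltnNge -ltNge => Nn.
have [e e0 eN] := poisson_right_constant w t0.
apply: (@lt_le_trans _ _ (t + e)%:E); first by rewrite lte_fin ltrDl.
apply/ereal_infP => _ [u [u0 nu] <-]; rewrite lee_fin leNgt; apply/negP => ute.
have [tu|ut] := leP t u.
  by move: nu; rewrite eN// leqNgt Nn.
have := leq_trans nu (poisson_nondecreasing hN w u0 (ltW ut)).
by rewrite leqNgt Nn.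
Qed.

Lemma jump_time_ge0 n w : (0 <= jump_time N n w)%E.
Proof. by apply/ereal_infP => _ [u [u0 _] <-]; rewrite lee_fin. Qed.

Lemma jump_time0 w : jump_time N 0 w = 0%E.
Proof.
by apply/eqP; rewrite eq_le jump_time_ge0 andbT jump_time_le.
Qed.

Lemma jump_time_homo w m n : (m <= n)%N -> (jump_time N m w <= jump_time N n w)%E.
Proof.
move=> mn; apply: ereal_inf_le_tmp => _ [t [t0 nt] <-]; exists t => //.
by split=> //; exact: leq_trans nt.
Qed.

(** The case [s = t] is added by hand, the law of increments being assumed for [s < t] only. *)
Lemma poisson_incr0 s t : 0 <= s -> s <= t ->
  P [set w | (N t w - N s w)%N = 0%N] = (expR (- (lambda * (t - s))))%:E.
Proof.
move=> s0; rewrite le_eqVlt => /predU1P[->|st].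
  rewrite subrr mulr0 oppr0 expR0 -(probability_setT P); congr (P _).
  by apply/seteqP; split => // w _ /=; rewrite subnn.
rewrite (poisson_law hN)// /poisson_pmf mulr_gt0 ?subr_gt0//.
by rewrite expr0 fact0 invr1 !mul1r.
Qed.

Lemma measurable_incr (A : set nat) s t : 0 <= s -> 0 <= t ->
  measurable [set w | A (N t w - N s w)%N].
Proof.
move=> s0 t0; rewrite [X in measurable X](_ : _ = \bigcup_i \bigcup_j
  ([set w | A (j - i)%N] `&` ((N s @^-1` [set i]) `&` (N t @^-1` [set j])))).
  apply: bigcupT_measurable => i; apply: bigcupT_measurable => j.
  apply: measurableI.
    have [Aij|Aij] := pselect (A (j - i)%N).
      by rewrite [X in measurable X](_ : _ = setT)//; apply/seteqP; split.
    by rewrite [X in measurable X](_ : _ = set0)//; apply/seteqP; split.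
  apply: measurableI; rewrite -[X in measurable X]setTI;
    exact: (poisson_measurable hN).
apply/seteqP; split => [w Aw|w [i _ [j _ [/= Aij [Ni Nj]]]]]; last by rewrite /= Ni Nj.
by exists (N s w) => //; exists (N t w).
Qed.

(** With [x] the mean, the probability is 1 - (1 + x) e^(-x), and e^(-x) >= 1 - x bounds it by 1 -
    (1 + x)(1 - x) = x^2. *)
Lemma poisson_incr_ge2 s t : 0 <= s -> s < t ->
  (P [set w | (2 <= N t w - N s w)%N] <= ((lambda * (t - s)) ^+ 2)%:E)%E.
Proof.
move=> s0 st; have t0 : 0 <= t by exact: le_trans (ltW st).
set x := lambda * (t - s); have x0 : 0 < x by rewrite mulr_gt0 ?subr_gt0.
pose A k := [set w | (N t w - N s w)%N = k].
have mA k : measurable (A k) by exact: (@measurable_incr (eq^~ k)).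
rewrite [X in P X](_ : _ = ~` (A 0%N `|` A 1%N)); last first.
  apply/seteqP; split => w; rewrite /A /=.
    by case: (N t w - N s w)%N => [|[|]]// k _ [].
  by case: (N t w - N s w)%N => [|[|]]//; tauto.
rewrite probability_setC; last exact: measurableU.
have pA k : P (A k) = (poisson_pmf x k)%:E by exact: (poisson_law hN).
have -> : P (A 0%N `|` A 1%N) = (P (A 0%N) + P (A 1%N))%E.
  by apply: measureU => //; apply/seteqP; split => // w []; rewrite /A /= => ->.
rewrite !pA /poisson_pmf x0 expr0 expr1 fact0 invr1 !mul1r.
rewrite mulr1 -EFinD lee_fin.
have := expR_ge1Dx (- x); set E := expR _ => Ex.
rewrite lerBlDr -lerBlDl.
apply: (@le_trans _ _ ((1 + x) * (1 - x))).
  by rewrite le_eqVlt; apply/orP; left; apply/eqP; ring.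
by rewrite -{1}(mul1r E) -mulrDl ler_pM2l// addr_gt0.
Qed.

(** If [T_n] is infinite, [N] stays below [n] at every integer time. From x^(j+1) / (j+1)! <= e^x
    each of the [n] Poisson weights at mean [x] is at most n / x, which vanishes as time grows. *)
Lemma jump_time_finite n : {ae P, forall w, (jump_time N n w < +oo)%E}.
Proof.
have mT k : measurable [set w | (N k.+1%:R w < n)%N].
  rewrite -[X in measurable X]setTI.
  exact: (poisson_measurable hN (ler0n R k.+1) measurableT (Y := [set i | (i < n)%N])).
exists (\bigcap_k [set w | (N k.+1%:R w < n)%N]); split.
- exact: bigcapT_measurable.
- apply/eqP; rewrite eq_le measure_ge0 andbT.
  apply: (@le0_of_le_div_nat _ _ (n%:R * (n%:R / lambda))) => k.
  have k0 : 0 < lambda * (k.+1%:R - 0) by rewrite subr0 mulr_gt0.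
  pose A j := [set w | (N k.+1%:R w - N 0 w)%N = j].
  have mA j : measurable (A j) by exact: (@measurable_incr (eq^~ j)).
  apply: (@le_trans _ _ (P (\big[setU/set0]_(j < n) A j))).
    apply: le_measure; rewrite ?inE; [exact: bigcapT_measurable|
      exact: bigsetU_measurable|].
    move=> w /(_ k Logic.I)/= Nn; rewrite -bigcup_mkord.
    by exists (N k.+1%:R w - N 0 w)%N => //=; exact: leq_ltn_trans (leq_subr _ _) Nn.
  apply: (le_trans (Boole_inequality P (fun i (_ : (i < n)%N) => mA i))).
  apply: (@le_trans _ _ (\sum_(j < n) (n%:R / lambda / k.+1%:R)%:E)%E); last first.
    by rewrite sumEFin sumr_const card_ord lee_fin -[X in X <= _]mulr_natl !mulrA.
  have pA j : P (A j) = (poisson_pmf (lambda * (k.+1%:R - 0)) j)%:E.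
    exact: (poisson_law hN).
  apply: lee_sum => j _; 
  apply: (@le_trans _ _ (poisson_pmf (lambda * (k.+1%:R - 0)) j)%:E).
    by rewrite -pA.
  rewrite lee_fin /poisson_pmf k0 subr0.
  rewrite subr0 in k0; set x := lambda * _ in k0 *.
  have Ex : x ^+ j.+1 / j.+1`!%:R <= expR x.
    by apply: le_trans (expR_ge1Dxn j (ltW k0)); rewrite lerDr.
  rewrite expRN ler_pdivrMr ?expR_gt0// -mulrA -invfM -/x mulrAC ler_pdivlMr//.
  rewrite mulrAC -exprSr.
  apply: (@le_trans _ _ (j.+1%:R * expR x)); last first.
    by rewrite ler_wpM2r ?expR_ge0// ler_nat.
  apply: le_trans (_ : j.+1%:R * (x ^+ j.+1 / j.+1`!%:R) <= _); last first.
    by rewrite ler_wpM2l.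
  by rewrite factS natrM invfM mulrCA mulVKf ?pnatr_eq0.
- move=> w /= /negP; rewrite -leNgt leye_eq => /eqP Tn k _ /=.
  by rewrite ltnNge -jump_time_le// Tn.
Qed.

(** A double jump before time [M] puts two jumps in one cell of mesh 1 / (m + 1). There are M (m +
    1) cells, each of probability at most (lambda / (m + 1))^2, hence a total of M lambda^2 / (m +
    1). *)
Lemma jump_time_strict n :
  {ae P, forall w, (jump_time N n w < +oo)%E ->
     (jump_time N n w < jump_time N n.+1 w)%E}.
Proof.
pose A M := [set w | (jump_time N n w <= M%:R%:E)%E /\
                     jump_time N n w = jump_time N n.+1 w].
suff A0 M : P.-negligible (A M).
  apply: (@negligibleS _ _ _ _ (\bigcup_M A M)); last exact: negligible_bigcup.
  move=> w /= /not_implyP[Tn TnS].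
  exists (Num.bound (fine (jump_time N n w))) => //; split.
    rewrite -[leLHS]fineK; last by rewrite ge0_fin_numE// jump_time_ge0.
    by rewrite lee_fin ltW// archi_boundP// fine_ge0// jump_time_ge0.
  apply/eqP; rewrite eq_le jump_time_homo//=; apply/negPn/negP.
  by rewrite -ltNge.
(* Grid cells are open on the left and miss time 0; a jump there is excluded by [N 0 = 0], off the
   null set [Z]. *)
have [Z [mZ PZ Z0]] := poisson_start hN.
pose B m i := [set w | (2 <= N (i.+1%:R / m.+1%:R) w - N (i%:R / m.+1%:R) w)%N].
have mB m i : measurable (B m i).
  by apply: (@measurable_incr [set k | (2 <= k)%N]); rewrite divr_ge0.
pose C m := \big[setU/set0]_(i < (M * m.+1)%N) B m i.
have mC m : measurable (C m) by exact: bigsetU_measurable.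
exists (\bigcap_m (Z `|` C m)); split.
- by apply: bigcapT_measurable => m; exact: measurableU.
- apply/eqP; rewrite eq_le measure_ge0 andbT.
  apply: (@le0_of_le_div_nat _ _ (M%:R * lambda ^+ 2)) => m.
  apply: (@le_trans _ _ (P (Z `|` C m))).
    apply: le_measure; rewrite ?inE; [|exact: measurableU|exact: bigcap_inf].
    by apply: bigcapT_measurable => k; exact: measurableU.
  rewrite setUC measureU0//.
  apply: (le_trans (Boole_inequality P (fun i (_ : (i < M * m.+1)%N) => mB m i))).
  apply: (@le_trans _ _ (\sum_(i < (M * m.+1)%N) ((lambda / m.+1%:R) ^+ 2)%:E)%E).
    apply: lee_sum => i _; apply: le_trans (poisson_incr_ge2 _ _) _.
    + by rewrite divr_ge0.
    + by rewrite ltr_pM2r ?invr_gt0// ltr_nat.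
    + by rewrite -mulrBl -natrB// subSnn mul1r.
  rewrite sumEFin sumr_const card_ord lee_fin -[X in X <= _]mulr_natl natrM.
  rewrite le_eqVlt; apply/orP; left; apply/eqP; field.
  by rewrite addrC natr1 pnatr_eq0.
- move=> w /= [TM TT] m _ /=.
  have [Nw|Nw] := eqVneq (N 0 w) 0%N; last by left; apply: Z0 => /=; apply/eqP.
  right; rewrite /C -bigcup_mkord.
  set T := jump_time N n w in TM TT.
  have T0 : (0 <= T)%E by exact: jump_time_ge0.
  have Tfin : T \is a fin_num by rewrite ge0_fin_numE// (le_lt_trans TM)// ltry.
  pose t := fine T; have t0 : 0 <= t by exact: fine_ge0.
  have tE : T = t%:E by rewrite fineK.
  have nt0 : t != 0.
    apply/eqP => t_0; have : (jump_time N n.+1 w <= 0%:E)%E by rewrite -TT tE t_0.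
    by rewrite jump_time_le// Nw.
  case: (grid_index m t) (fun i => grid_index_le m i t0) => [|i] hi.
    have := hi 0%N; rewrite leqnn mul0r => /esym => tle0.
    by move: nt0; rewrite eq_le tle0 t0.
  exists i => /=.
    rewrite -ltnS; have := hi (M * m.+1)%N; rewrite ltnS => ->.
    by rewrite natrM mulfK ?pnatr_eq0// -lee_fin -tE.
  have : (n.+1 <= N (i.+1%:R / m.+1%:R) w)%N.
    by rewrite -jump_time_le ?divr_ge0// -TT tE lee_fin -hi.
  have : ~~ (n <= N (i%:R / m.+1%:R) w)%N.
    by rewrite -jump_time_le ?divr_ge0// -/T tE lee_fin -hi ltnn.
  by rewrite /B/= -ltnNge => h1 h2; rewrite ltn_subRL addnC; lia.
Qed.

End jump_times.

Lemma measurable_fun_le_real (R : realType) d (T : measurableType d) (f : T -> R) :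
  (forall a, measurable [set x | f x <= a]) -> measurable_fun setT f.
Proof.
move=> mf; apply: (measurability _ (RGenOInfty.measurableE R)) => //.
move=> _ [_ [a ->] <-]; rewrite setTI.
rewrite [X in measurable X](_ : _ = ~` [set x | f x <= a]).
  exact: measurableC.
by apply/seteqP; split => x /=; rewrite in_itv/= andbT ltNge => /negP.
Qed.

Lemma measurable_fun_le_ereal (R : realType) d (T : measurableType d)
    (f : T -> \bar R) :
  (forall a : R, measurable [set x | (f x <= a%:E)%E]) -> measurable_fun setT f.
Proof.
move=> mf; apply: (measurability _ (ErealGenOInfty.measurableE R)) => //.
move=> _ [_ [a ->] <-]; rewrite setTI.
rewrite [X in measurable X](_ : _ = ~` [set x | (f x <= a%:E)%E]).
  exact: measurableC.
by apply/seteqP; split => x /=; rewrite in_itv/= andbT ltNge => /negP.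
Qed.

(** Both sides are finite measures in [A] that agree on the generating pi-system [G], hence on the
    sigma-algebra it generates. *)
Lemma independent_sigma (R : realType) d (T : measurableType d)
    (P : probability T R) (G : set (set T)) (H : set T) :
  setI_closed G -> G setT -> G `<=` measurable -> measurable H ->
  (forall A, G A -> P (A `&` H) = (P A * P H)%E) ->
  forall A, <<s G >> A -> P (A `&` H) = (P A * P H)%E.
Proof.
move=> GI GT mG mH GH A sA.
have pH0 : 0 <= fine (P H) by rewrite fine_ge0.
pose m1 : {measure set T -> \bar R} := mrestr P mH.
pose m2 : {measure set T -> \bar R} := mscale (NngNum pH0) P.
have m2E B : m2 B = (P B * P H)%E.
  transitivity ((fine (P H))%:E * P B)%E => //.
  by rewrite fineK ?fin_num_measure// muleC.
have := @g_sigma_algebra_measure_unique _ _ _ G mG (fun=> setT) (fun=> GT) _ m1 m2 GI.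
rewrite /m1 => /(_ _ _ _ A sA); rewrite m2E; apply.
- by rewrite bigcup_const.
- by move=> B GB; rewrite m2E -GH.
- move=> _; rewrite /= /mrestr setTI; apply: le_lt_trans (ltry 1).
  exact: probability_le1.
Qed.

(** * Stopping times and the filtration *)

Section filtration.
Context (R : realType) d (Omega : measurableType d) (P : probability Omega R)
  (X : R -> Omega -> R) (N : R -> Omega -> nat) (lambda : R)
  (hX : levy_process P X) (hN : poisson_process P lambda N)
  (hXN : independent_processes P X N) (hlambda : 0 < lambda).
Implicit Types (n : nat) (w : Omega) (t : R).

Local Notation F := (natural_filtration X N).
Local Notation T_ := (jump_time N).

Lemma sigma_of_mono d' (E : measurableType d') (Y : R -> Omega -> E) (I J : set R) :
  I `<=` J -> sigma_of I Y `<=` sigma_of J Y.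
Proof.
by move=> IJ; apply: sub_smallest2r; [exact: smallest_sigma_algebra|exact: bigcup_subset].
Qed.

Lemma sigma_of_measurable d' (E : measurableType d') (Y : R -> Omega -> E) (I : set R) :
  (forall t, I t -> measurable_fun setT (Y t)) -> sigma_of I Y `<=` measurable.
Proof.
move=> mY; apply: smallest_sub; first exact: sigma_algebra_measurable.
by move=> _ [t It [B mB <-]]; exact: mY.
Qed.

Lemma filtration_mono s t : s <= t -> F s `<=` F t.
Proof.
move=> st; apply: sub_smallest2r; first exact: smallest_sigma_algebra.
apply: setUSS; apply: sigma_of_mono => u /=; rewrite !in_itv/= => /andP[-> us];
  exact: le_trans st.
Qed.

Lemma filtration_measurable t : F t `<=` measurable.
Proof.
apply: smallest_sub; first exact: sigma_algebra_measurable.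
rewrite subUset; split; apply: sigma_of_measurable => u /=;
  rewrite in_itv/= => /andP[u0 _].
- exact: (levy_measurable hX).
- exact: (poisson_measurable hN).
Qed.

(** The sigma-algebra at time [t] as a measurable type: being known at time [t] becomes ordinary
    measurability on this domain. *)
Local Notation Ft t :=
  (g_sigma_algebraType (sigma_of `[0, t] X `|` sigma_of `[0, t] N)).

Lemma filtration_X s t : 0 <= s <= t -> measurable_fun setT (X s : Ft t -> R).
Proof.
move=> st _ B mB; apply: sub_sigma_algebra; left; apply: sub_sigma_algebra.
by exists s => //=; exists B.
Qed.

Lemma filtration_N s t (A : set nat) : 0 <= s <= t -> F t [set w | A (N s w)].
Proof.
move=> st; apply: sub_sigma_algebra; right; apply: sub_sigma_algebra.
by exists s => //=; exists A => //; rewrite setTI.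
Qed.

Lemma filtrationI t A B : F t A -> F t B -> F t (A `&` B).
Proof. exact: (@measurableI _ (Ft t)). Qed.
Lemma filtrationD t A B : F t A -> F t B -> F t (A `\` B).
Proof. exact: (@measurableD _ (Ft t)). Qed.
Lemma filtrationU t (A : (set Omega)^nat) : (forall i, F t (A i)) -> F t (\bigcup_i A i).
Proof. exact: (@bigcupT_measurable _ (Ft t)). Qed.
Lemma filtration0 t : F t set0.
Proof. exact: (@measurable0 _ (Ft t)). Qed.

Lemma jump_stopping n : stopping_time X N (T_ n).
Proof.
split=> [w|t t0]; first exact: jump_time_ge0.
rewrite (_ : [set w | _] = [set w | (n <= N t w)%N]).
  by apply: (@filtration_N t t [set k | (n <= k)%N]); rewrite t0 lexx.
by apply/seteqP; split => w /=; rewrite (jump_time_le hN).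
Qed.

Lemma stopping_measurable tau : stopping_time X N tau -> measurable_fun setT tau.
Proof.
move=> [tau0 Ftau]; apply: measurable_fun_le_ereal => a.
have [a0|a0] := leP 0 a; first exact: filtration_measurable (Ftau a a0).
rewrite [X in measurable X](_ : _ = set0)//; apply/seteqP; split => // w /= ta.
by have := le_trans (tau0 w) ta; rewrite lee_fin leNgt a0.
Qed.

(** Progressive measurability: where [tau <= t], the pair (tau, X_tau) is known at time [t]. *)
Lemma stopped_pair tau t (B : set (R * R)) : stopping_time X N tau -> 0 <= t -> measurable B ->
  F t ([set w | B (fine (tau w), X (fine (tau w)) w)] `&` [set w | (tau w <= t%:E)%E]).
Proof.
move=> [tau0 Ftau] t0 mB.
(* The truncation min(tau, t) is bounded by [t] and known at time [t], so sampling at it uses no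
   later value of [X]. *)
pose tau' w := fine (Order.min (tau w) t%:E).
have tau'E w : (tau' w)%:E = Order.min (tau w) t%:E.
  by rewrite fineK// fin_numElt lt_min ltNyr (lt_le_trans _ (tau0 w))//=
    gt_min ltry orbT.
rewrite (_ : _ `&` _ = (setT `&` (fun w => (tau' w, X (tau' w) w)) @^-1` B) `&`
    [set w | (tau w <= t%:E)%E]).
  apply: filtrationI; last exact: Ftau.
  have mtau' : measurable_fun setT (tau' : Ft t -> R).
    apply: measurable_fun_le_real => a.
    have -> : [set x : Ft t | tau' x <= a] = [set w | (Order.min (tau w) t%:E <= a%:E)%E].
      by apply/seteqP; split => w /=; rewrite -tau'E lee_fin.
    have [ta|at_] := leP t a.
      rewrite [X in measurable X](_ : _ = setT); first exact: measurableT.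
      by apply/seteqP; split => // w _ /=; rewrite ge_min lee_fin ta orbT.
    have [a0|a0] := leP 0 a.
      rewrite [X in measurable X](_ : _ = [set w | (tau w <= a%:E)%E]).
        exact: (filtration_mono (ltW at_) (Ftau a a0)).
      by apply/seteqP; split => w /=; rewrite ge_min lee_fin (leNgt t) at_ orbF.
    rewrite [X in measurable X](_ : _ = set0); first exact: measurable0.
    apply/seteqP; split => // w /=.
    rewrite ge_min lee_fin (leNgt t) at_ orbF => ta.
    by have := le_trans (tau0 w) ta; rewrite lee_fin leNgt a0.
  have mXtau' : measurable_fun setT ((fun w => X (tau' w) w) : Ft t -> R).
    apply: (@measurable_sample R _ (Ft t) X tau' t) => //.
    + by move=> u; exact: filtration_X.
    + by move=> w; rewrite -!lee_fin tau'E le_min tau0 lee_fin t0/= ge_min lexx orbT.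
    + by move=> w u u0; have [+ _] := levy_cadlag hX w; exact.
  have : measurable_fun setT ((fun w => (tau' w, X (tau' w) w)) : Ft t -> R * R).
    exact: measurable_fun_pair.
  exact.
apply/seteqP; split => w [].
  by move=> /= Bw tw; split => //; split => //; rewrite /tau' (min_idPl tw).
by move=> [_ /= +] tw; rewrite /tau' (min_idPl tw).
Qed.

Lemma stopped_X tau t (B : set R) : stopping_time X N tau -> 0 <= t -> measurable B ->
  F t ([set w | B (X (fine (tau w)) w)] `&` [set w | (tau w <= t%:E)%E]).
Proof.
move=> stau t0 mB; apply: (@stopped_pair tau t [set x | B x.2]) => //.
by rewrite -[X in measurable X]setTI; exact: measurable_snd.
Qed.

Lemma stopped_X_measurable tau : stopping_time X N tau ->
  measurable_fun setT (fun w => X (fine (tau w)) w).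
Proof.
move=> stau _ B mB; rewrite setTI; have [tau0 Ftau] := stau.
(* As [fine] sends an infinite time to 0, the sampled value is [X 0] where [tau] is infinite. *)
rewrite [X in measurable X](_ : _ = (\bigcup_k
    ([set w | B (X (fine (tau w)) w)] `&` [set w | (tau w <= k%:R%:E)%E])) `|`
    ((X 0 @^-1` B) `&` (tau @^-1` [set +oo%E]))).
  apply: measurableU.
    apply: bigcupT_measurable => k.
    exact: filtration_measurable (@stopped_X _ k%:R _ stau (ler0n R k) mB).
  apply: measurableI; rewrite -[X in measurable X]setTI.
    exact: (levy_measurable hX (lexx 0)).
  by apply: stopping_measurable.
apply/seteqP; split => w /=.
  move=> Bw; case tE: (tau w) (tau0 w) => [t||]//; last first.
    by move=> _; right; split => //; move: Bw; rewrite tE.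
  rewrite lee_fin => t0; left; exists (Num.bound t) => //; split => //=.
  by rewrite tE lee_fin ltW// archi_boundP.
by case=> [[k _ [//]]|[+ tw]]; rewrite tw.
Qed.

(** The horizons [a] and [c] differ so that subtracting two instances with the same [c] gives the
    event that the next jump falls in one cell while [X] is read at the end of that cell. *)
Lemma jump_rule u a c (G : set Omega) (B : set R) :
  0 <= u -> 0 <= a -> 0 <= c -> F u G -> measurable B ->
  P (G `&` ([set w | B (X (u + c) w - X u w)] `&`
            [set w | (N (u + a) w - N u w)%N = 0%N])) =
  (P G * (P [set w | B (X c w)] * (expR (- (lambda * a)))%:E))%E.
Proof.
move=> u0 a0 c0 FG mB.
set HX := [set w | B _]; set HN := [set w | _ = _].
have uc : u <= u + c by rewrite lerDl.
have ua : u <= u + a by rewrite lerDl.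
have uc0 : 0 <= u + c by exact: le_trans uc.
have ua0 : 0 <= u + a by exact: le_trans ua.
have mX t : 0 <= t -> measurable_fun setT (X t) by exact: (levy_measurable hX).
have sX : sigma_of `[0, +oo[ X HX.
  pose TX := g_sigma_algebraType (\bigcup_(u in `[0, +oo[%classic)
    preimage_set_system setT (X u) measurable).
  have mTX t : 0 <= t -> measurable_fun setT (X t : TX -> R).
    move=> t0 _ C mC; apply: sub_sigma_algebra; exists t => /=.
      by rewrite in_itv/= t0.
    by exists C.
  have : measurable_fun setT ((fun w => X (u + c) w - X u w) : TX -> R).
    by apply: measurable_funB; exact: mTX.
  by move=> /(_ measurableT B mB); rewrite setTI.
have sN : sigma_of `[0, +oo[ N HN.
  pose TN := g_sigma_algebraType (\bigcup_(u in `[0, +oo[%classic)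
    preimage_set_system setT (N u) measurable).
  have mTN t (A : set nat) : 0 <= t -> @measurable _ TN [set w | A (N t w)].
    move=> t0; apply: sub_sigma_algebra; exists t => /=.
      by rewrite in_itv/= t0.
    by exists A => //; rewrite setTI.
  rewrite (_ : HN = \bigcup_i ([set w | N u w = i] `&`
                               [set w | (N (u + a) w - i)%N = 0%N])).
    apply: (@bigcupT_measurable _ TN) => i; apply: (@measurableI _ TN).
      exact: (@mTN _ (eq^~ i)).
    exact: (@mTN _ (fun k => (k - i)%N = 0%N)).
  apply/seteqP; split => w; first by move=> Hw; exists (N u w).
  by move=> [i _ [/= <-]].
have mXN : sigma_of `[0, +oo[ X `<=` measurable.
  by apply: sigma_of_measurable => t /=; rewrite in_itv/= andbT; exact: mX.
have mNN : sigma_of `[0, +oo[ N `<=` measurable.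
  by apply: sigma_of_measurable => t /=; rewrite in_itv/= andbT;
    exact: (poisson_measurable hN).
have itvS : `[0, u] `<=` `[0, +oo[%classic.
  by move=> t /=; rewrite !in_itv/= andbT => /andP[].
have pX : P HX = P [set w | B (X c w)].
  by rewrite (levy_stationary hX)// addrAC subrr add0r.
have pN : P HN = (expR (- (lambda * a)))%:E.
  by rewrite (poisson_incr0 hN)// addrAC subrr add0r.
have HE : P (HX `&` HN) = (P HX * P HN)%E by exact: hXN.
rewrite -pX -pN -HE.
(* These intersections form a pi-system generating the information at [u]. On them independence of
   [X] and [N] splits the probability, and independence of increments treats each factor. *)
pose Pi := [set A `&` A' | A in sigma_of `[0, u] X & A' in sigma_of `[0, u] N].
have sT (S : set (set Omega)) : <<s S >> setT.
  exact: (@measurableT _ (g_sigma_algebraType S)).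
have sI (S : set (set Omega)) A1 A2 : <<s S >> A1 -> <<s S >> A2 -> <<s S >> (A1 `&` A2).
  exact: (@measurableI _ (g_sigma_algebraType S)).
apply: (@independent_sigma _ _ _ _ Pi).
- move=> _ _ [A sA [A' sA'] <-] [C sC [C' sC'] <-].
  exists (A `&` C); first by exact: sI.
  exists (A' `&` C'); first by exact: sI.
  by rewrite setIACA.
- exists setT; first exact: sT.
  by exists setT; [exact: sT|rewrite setTI].
- move=> _ [A sA [A' sA'] <-]; apply: measurableI.
    exact: mXN (sigma_of_mono itvS sA).
  exact: mNN (sigma_of_mono itvS sA').
- by apply: measurableI; [exact: mXN|exact: mNN].
- move=> _ [A sA [A' sA'] <-]; rewrite setIACA.
  have sA1 := sigma_of_mono itvS sA; have sA1' := sigma_of_mono itvS sA'.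
  rewrite (hXN (A := A `&` HX) (B := A' `&` HN)); [|exact: sI..].
  have -> : P (A `&` HX) = (P A * P HX)%E.
    apply: (levy_independent hX u0 uc) => //.
    by exists B => //; rewrite setTI.
  have -> : P (A' `&` HN) = (P A' * P HN)%E.
    apply: (poisson_independent hN u0 ua) => //.
    by exists [set 0%N] => //; rewrite setTI.
  rewrite HE (hXN sA1 sA1').
  by rewrite muleACA.
- move: G FG; apply: smallest_sub; first exact: smallest_sigma_algebra.
  rewrite subUset; split => A sA; apply: sub_sigma_algebra.
    by exists A => //; exists setT; [exact: sT|rewrite setIT].
  by exists setT; [exact: sT|exists A => //; rewrite setTI].
Qed.

End filtration.

(** * Integrals under laws, product measures and bounded convergence *)

Lemma ge0_integral_mrestr (R : realType) d (T : measurableType d)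
    (mu : {measure set T -> \bar R}) (A : set T) (mA : measurable A)
    (f : T -> \bar R) :
  measurable_fun setT f -> (forall x, 0 <= f x)%E ->
  (\int[mrestr mu mA]_x f x = \int[mu]_(x in A) f x)%E.
Proof.
move=> mf f0; rewrite (@ge0_negligible_integral _ _ _ _ setT (~` A))//.
- rewrite setTD setCK; apply: eq_measure_integral => B mB BA.
  by rewrite /= /mrestr (setIidl BA).
- exact: measurableC.
- by rewrite /= /mrestr setICl measure0.
Qed.

Section transfer.
Context (R : realType) d d' (T : measurableType d) (E : measurableType d')
  (P : probability T R).

(** The restricted image measures agree up to the factor [c]; integrals against them inherit
    this. *)
Lemma ge0_integral_law (Z1 Z2 : T -> E) (A1 A2 : set T) (c : R) (f : E -> \bar R) :
  measurable_fun setT Z1 -> measurable_fun setT Z2 ->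
  measurable A1 -> measurable A2 -> 0 <= c ->
  (forall B, measurable B ->
    P (A1 `&` Z1 @^-1` B) = (c%:E * P (A2 `&` Z2 @^-1` B))%E) ->
  measurable_fun setT f -> (forall x, 0 <= f x)%E ->
  (\int[P]_(w in A1) f (Z1 w) = c%:E * \int[P]_(w in A2) f (Z2 w))%E.
Proof.
move=> mZ1 mZ2 mA1 mA2 c0 h mf f0.
have mfZ1 : measurable_fun setT (f \o Z1) by exact: measurableT_comp.
have mfZ2 : measurable_fun setT (f \o Z2) by exact: measurableT_comp.
rewrite -(ge0_integral_mrestr P mA1 mfZ1 (fun x => f0 (Z1 x))).
rewrite -(ge0_integral_mrestr P mA2 mfZ2 (fun x => f0 (Z2 x))).
pose m1 : {measure set T -> \bar R} := mrestr P mA1.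
pose m2 : {measure set T -> \bar R} := mrestr P mA2.
have -> : (\int[mrestr P mA1]_x (f \o Z1) x = \int[pushforward m1 Z1]_y f y)%E.
  by rewrite ge0_integral_pushforward// preimage_setT.
have -> : (\int[mrestr P mA2]_x (f \o Z2) x = \int[pushforward m2 Z2]_y f y)%E.
  by rewrite ge0_integral_pushforward// preimage_setT.
rewrite -[c]/((NngNum c0)%:num) -ge0_integral_mscale//.
apply: eq_measure_integral => B mB _.
rewrite -[LHS]/(P (Z1 @^-1` B `&` A1)).
rewrite -[RHS]/(c%:E * P (Z2 @^-1` B `&` A2))%E.
by rewrite setIC h// setIC.
Qed.

Lemma cvg_bounded_integral (f : (T -> R)^nat) (g : T -> R) :
  (forall n, measurable_fun setT (f n)) -> measurable_fun setT g ->
  (forall n w, 0 <= f n w <= 1) ->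
  {ae P, forall w, f n w @[n --> \oo] --> g w} ->
  (\int[P]_w (f n w)%:E @[n --> \oo] --> \int[P]_w (g w)%:E)%E.
Proof.
move=> mf mg f01 fg.
have := @dominated_convergence _ T R P setT measurableT
  (fun n w => (f n w)%:E) (fun w => (g w)%:E) (cst 1%E).
case=> //.
- by move=> n; exact/measurable_EFinP.
- exact/measurable_EFinP.
- by apply: filterS fg => w h _; apply: cvg_EFin => //; exact: nearW.
- apply/integrableP; split => //.
  under eq_integral do rewrite /= normr1.
  rewrite integral_cst// mul1e; apply: le_lt_trans (ltry 1).
  exact: (probability_le1 P).
- apply: aeW => w n _; have /andP[f0 f1] := f01 n w.
  by rewrite /= lee_fin ger0_norm.
Qed.

End transfer.

(** On [A] the joint law of (W, Y) is the product of the law of [W] on [A] with the law of [Y0], and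
    Tonelli's theorem applies. *)
Lemma integral_independent (R : realType) d d1 d2 (T : measurableType d)
    (E1 : measurableType d1) (E2 : measurableType d2) (P : probability T R)
    (A : set T) (W : T -> E1) (Y Y0 : T -> E2) (f : E1 * E2 -> \bar R) :
  measurable A -> measurable_fun setT W -> measurable_fun setT Y ->
  measurable_fun setT Y0 ->
  (forall C B, measurable C -> measurable B ->
    P ((A `&` W @^-1` C) `&` Y @^-1` B) = (P (A `&` W @^-1` C) * P (Y0 @^-1` B))%E) ->
  measurable_fun setT f -> (forall x, 0 <= f x)%E ->
  (\int[P]_(w in A) f (W w, Y w) =
   \int[P]_(w in A) \int[P]_w' f (W w, Y0 w'))%E.
Proof.
move=> mA mW mY mY0 h mf f0.
pose m1 : {measure set T -> \bar R} := mrestr P mA.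
have m1T B : measurable B -> (m1 B <= 1)%E.
  move=> mB; apply: (@le_trans _ _ (P (B `&` A))) => //.
  by apply: probability_le1; exact: measurableI.
pose n1_ : {measure set E1 -> \bar R} := pushforward m1 W; pose n1 := n1_ mW.
have n1fin : fin_num_fun n1.
  move=> B mB; rewrite ge0_fin_numE ?measure_ge0//.
  apply: le_lt_trans (ltry 1); apply: m1T.
  by rewrite -[X in measurable X]setTI; exact: (mW measurableT B mB).
(* Both image measures are repackaged as finite ones, as the product measure and its uniqueness
   require. *)
pose H1 := Measure_isFinite.Build _ E1 R (Measure.sort n1) n1fin.
pose nu1 := HB.pack_for (FiniteMeasure.type E1 R) (Measure.sort n1) H1.
pose n2_ : {measure set E2 -> \bar R} := pushforward P Y0; pose n2 := n2_ mY0.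
have n2fin : fin_num_fun n2.
  move=> B mB; rewrite ge0_fin_numE ?measure_ge0//.
  apply: le_lt_trans (ltry 1); apply: probability_le1.
  by rewrite -[X in measurable X]setTI; exact: (mY0 measurableT B mB).
pose K1 := Measure_isFinite.Build _ E2 R (Measure.sort n2) n2fin.
pose nu2 := HB.pack_for (FiniteMeasure.type E2 R) (Measure.sort n2) K1.
have mWY : measurable_fun setT (fun w => (W w, Y w)) by exact: measurable_fun_pair.
pose m12_ : {measure set (E1 * E2) -> \bar R} := pushforward m1 (fun w => (W w, Y w)).
pose m12 := m12_ mWY.
have m12E X : measurable X -> (nu1 \x nu2)%E X = m12 X.
  apply: product_measure_unique => C B mC mB.
  rewrite -[LHS]/(P ((fun w => (W w, Y w)) @^-1` (C `*` B) `&` A)).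
  rewrite -[RHS]/(P (W @^-1` C `&` A) * P (Y0 @^-1` B))%E.
  rewrite [W @^-1` C `&` A]setIC -h//; congr (P _).
  by apply/seteqP; split => w /=; tauto.
transitivity (\int[m12]_z f z)%E.
  rewrite ge0_integral_pushforward// preimage_setT.
  rewrite (ge0_integral_mrestr P mA (f := f \o (fun w => (W w, Y w))))//.
    exact: measurableT_comp.
  by move=> x; exact: f0.
transitivity (\int[(nu1 \x nu2)%E]_z f z)%E.
  by apply: eq_measure_integral => B mB _; apply/esym/m12E.
rewrite fubini_tonelli1//.
have mF := @measurable_fun_fubini_tonelli_F _ _ _ _ _ nu2 f mf f0.
have F0 x : (0 <= fubini_F nu2 f x)%E by apply: integral_ge0.
transitivity (\int[n1]_x fubini_F nu2 f x)%E.
  by apply: eq_measure_integral.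
rewrite ge0_integral_pushforward// preimage_setT.
rewrite (ge0_integral_mrestr P mA (f := fubini_F nu2 f \o W))//; last 2 first.
- exact: measurableT_comp.
- by move=> x; exact: F0.
apply: eq_integral => w _; rewrite /fubini_F /=.
transitivity (\int[n2]_y f (W w, y))%E; first exact: eq_measure_integral.
rewrite ge0_integral_pushforward// ?preimage_setT//.
exact: measurableT_comp.
Qed.

Lemma probability_bigcup (R : realType) d (T : measurableType d)
    (P : probability T R) (F : (set T)^nat) :
  (forall i, measurable (F i)) -> trivIset setT F ->
  P (\bigcup_i F i) = (\sum_(i <oo) P (F i))%E.
Proof.
move=> mF tF; transitivity (\sum_(i <oo | i \in [set: nat]) P (F i))%E.
  exact: measure_bigcup.
by apply: eq_eseriesl => i; rewrite in_setT.
Qed.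

(** * The strong Markov property at jump times *)

Section strong_markov.
Context (R : realType) d (Omega : measurableType d) (P : probability Omega R)
  (X : R -> Omega -> R) (N : R -> Omega -> nat) (lambda : R)
  (hX : levy_process P X) (hN : poisson_process P lambda N)
  (hXN : independent_processes P X N) (hlambda : 0 < lambda).
Implicit Types (n m i l : nat) (w : Omega) (t : R).

Local Notation F := (natural_filtration X N).
Local Notation T_ := (jump_time N).

Local Notation gpoint := (@gpoint R).

(* The sigma-algebra of events known at the [n]-th jump time. *)
Definition before_jump n : set (set Omega) :=
  [set L | measurable L /\
     forall t, 0 <= t -> F t (L `&` [set w | (T_ n w <= t%:E)%E])].

(* [fine] sends an infinite jump time to 0; jump times are almost surely finite. *)
Definition jump n w : R := fine (T_ n w).
Definition jump_X n w : R := X (jump n w) w.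
Definition jump_incr n w : R * R :=
  (jump n.+1 w - jump n w, jump_X n.+1 w - jump_X n w).

Definition grid_incr n m w : R * R :=
  (grid m (jump n.+1 w) - grid m (jump n w),
   X (grid m (jump n.+1 w)) w - X (grid m (jump n w)) w).

(** Strict inequality of the indices: the next jump is then still to come at the end of the cell of
    the current one, so independence of increments applies from that fixed time on. *)
Definition grid_event n m : set Omega :=
  [set w | (T_ n w < +oo)%E] `&` [set w | (T_ n.+1 w < +oo)%E] `&`
  [set w | (grid_index m (jump n w) < grid_index m (jump n.+1 w))%N].

Lemma jump_ge0 n w : 0 <= jump n w.
Proof. by rewrite fine_ge0// jump_time_ge0. Qed.

Lemma jumpE n w : (T_ n w < +oo)%E -> (jump n w)%:E = T_ n w.
Proof. by move=> Tn; rewrite fineK// ge0_fin_numE// jump_time_ge0. Qed.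

Lemma jump_grid_le n m w i : (T_ n w < +oo)%E ->
  (grid_index m (jump n w) <= i)%N = (n <= N (gpoint m i) w)%N.
Proof.
move=> Tn; rewrite grid_index_le ?jump_ge0// -/(gpoint m i) -lee_fin jumpE//.
by rewrite (jump_time_le hN)// gpoint_ge0.
Qed.

Lemma measurable_jump_time n : measurable_fun setT (T_ n).
Proof. exact: (stopping_measurable hX hN (jump_stopping X hN n)). Qed.

Lemma measurable_jump n : measurable_fun setT (jump n).
Proof. by apply: measurableT_comp => //; exact: measurable_jump_time. Qed.

Lemma measurable_jump_X n : measurable_fun setT (jump_X n).
Proof. exact: (stopped_X_measurable hX hN (jump_stopping X hN n)). Qed.

Lemma measurable_jump_incr n : measurable_fun setT (jump_incr n).
Proof.
apply: measurable_fun_pair; apply: measurable_funB;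
  by [exact: measurable_jump|exact: measurable_jump_X].
Qed.

Lemma measurable_grid_index n m (A : set nat) :
  measurable [set w | A (grid_index m (jump n w))].
Proof.
(* Sampling the deterministic process [t] at the integers returns the grid index itself. *)
have := @measurable_grid_sample R _ Omega (fun t _ => t) (jump n) m (fun i => i%:R).
move=> /(_ _ (measurable_jump n) (jump_ge0 n) measurableT
  [set x : R | exists2 i, A i & x = i%:R]) => H.
rewrite [X in measurable X](_ : _ = setT `&`
  (fun w => (grid_index m (jump n w))%:R) @^-1` [set x : R | exists2 i, A i & x = i%:R]).
  apply: H => //.
  rewrite [X in measurable X](_ : _ = \bigcup_(i in A) [set i%:R]).
    by apply: bigcup_measurable => i _; exact: measurable_set1.
  by apply/seteqP; split => [x [i Ai ->]|x [i Ai /= ->]]; exists i.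
apply/seteqP; split => w /=; first by move=> Aw; split => //; exists (grid_index m (jump n w)).
by move=> [_ [i Ai /eqP]]; rewrite eqr_nat => /eqP ->.
Qed.

Lemma measurable_grid n m : measurable_fun setT (fun w => grid m (jump n w)).
Proof.
exact: (@measurable_grid_sample R _ Omega (fun t _ => t) (jump n) m (gpoint m)
  _ (measurable_jump n) (jump_ge0 n)).
Qed.

Lemma measurable_grid_X n m : measurable_fun setT (fun w => X (grid m (jump n w)) w).
Proof.
apply: (@measurable_grid_sample R _ Omega X (jump n) m (gpoint m)
  _ (measurable_jump n) (jump_ge0 n)) => i.
exact: (levy_measurable hX (gpoint_ge0 m i)).
Qed.

Lemma measurable_grid_incr n m : measurable_fun setT (grid_incr n m).
Proof.
apply: measurable_fun_pair; apply: measurable_funB;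
  by [exact: measurable_grid|exact: measurable_grid_X].
Qed.

Lemma measurable_jump_finite n : measurable [set w | (T_ n w < +oo)%E].
Proof.
rewrite [X in measurable X](_ : _ = ~` (T_ n @^-1` [set +oo%E])).
  apply: measurableC; rewrite -[X in measurable X]setTI.
  by apply: (measurable_jump_time n) => //; exact: emeasurable_set1.
by apply/seteqP; split => w /=; rewrite ltey => /eqP.
Qed.

Lemma measurable_grid_event n m : measurable (grid_event n m).
Proof.
apply: measurableI; first by apply: measurableI; exact: measurable_jump_finite.
rewrite [X in measurable X](_ : _ = \bigcup_i
  ([set w | grid_index m (jump n w) = i] `&` [set w | (i < grid_index m (jump n.+1 w))%N])).
  apply: bigcupT_measurable => i; apply: measurableI.
    exact: (@measurable_grid_index _ _ (eq^~ i)).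
  exact: (@measurable_grid_index _ _ [set j | (i < j)%N]).
apply/seteqP; split => w /=; first by move=> lt_w; exists (grid_index m (jump n w)).
by move=> [i _ [/= -> ]].
Qed.

Lemma jump_strict n : {ae P, forall w,
  [/\ (T_ n w < +oo)%E, (T_ n.+1 w < +oo)%E & (T_ n w < T_ n.+1 w)%E]}.
Proof.
have h1 := jump_time_finite hN hlambda n.
have h2 := jump_time_finite hN hlambda n.+1.
have h3 := jump_time_strict hN hlambda n.
by apply: filterS3 h1 h2 h3 => w h1 h2 h3; split => //; exact: h3.
Qed.

(** Up to normalisation, the law of a grid increment: counted in cells the waiting time is
    geometric, with [l] cells free of jumps and a jump in the following one, and [X] runs
    independently until the end of that cell. *)
Definition grid_law m (B : set (R * R)) : \bar R :=
  (\sum_(l <oo)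
    ((expR (- (lambda * gpoint m l)) - expR (- (lambda * gpoint m l.+1)))%:E *
     P [set w | B (gpoint m l.+1, X (gpoint m l.+1) w)]))%E.

Section grid_identity.
Context (n m : nat) (L : set Omega) (hL : before_jump n L).

(** The past at the fixed time [gpoint m i]: the [n]-th jump has just occurred in the cell ending
    there, and the next one has not. *)
Let G i := L `&` [set w | (T_ n w < +oo)%E] `&`
  [set w | grid_index m (jump n w) = i] `&` [set w | (N (gpoint m i) w <= n)%N].

Let FG i : F (gpoint m i) (G i).
Proof.
have gi0 : (0 : R) <= gpoint m i by exact: gpoint_ge0.
have [_ /(_ _ gi0) FL] := hL.
have gii : 0 <= (gpoint m i : R) <= gpoint m i by apply/andP; split.
have FN : F (gpoint m i) [set w | (N (gpoint m i) w <= n)%N].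
  exact: (@filtration_N _ _ _ X N _ _ [set k | (k <= n)%N] gii).
(* Index 0 means [T_n <= 0]; any other index requires removing the event that [T_n] is below the
   previous grid point. *)
case: i => [|i] in gi0 FL gii FN *.
  rewrite (_ : G 0%N = L `&` [set w | (T_ n w <= (gpoint m 0)%:E)%E] `&`
     [set w | (N (gpoint m 0) w <= n)%N]); first exact: filtrationI.
  apply/seteqP; split => w.
    by move=> [[[Lw /= Tn] idx] Nn]; split => //; split => //=;
      rewrite (jump_time_le hN)// -jump_grid_le// idx.
  move=> [[Lw /= Tn] Nn]; have Toy : (T_ n w < +oo)%E by exact: le_lt_trans Tn (ltry _).
  split => //; split => //=; apply/eqP; rewrite -leqn0 jump_grid_le//.
  by rewrite -(jump_time_le hN).
have gi'0 : (0 : R) <= gpoint m i by exact: gpoint_ge0.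
have igi : 0 <= (gpoint m i : R) <= gpoint m i.+1.
  by apply/andP; split; rewrite ?le_gpoint.
have FN' : F (gpoint m i.+1) [set w | (n <= N (gpoint m i) w)%N].
  exact: (@filtration_N _ _ _ X N _ _ [set k | (n <= k)%N] igi).
rewrite (_ : G i.+1 = (L `&` [set w | (T_ n w <= (gpoint m i.+1)%:E)%E] `&`
   [set w | (N (gpoint m i.+1) w <= n)%N]) `\` [set w | (n <= N (gpoint m i) w)%N]).
  by apply: filtrationD => //; exact: filtrationI.
apply/seteqP; split => w.
  move=> [[[Lw /= Tn] idx] Nn]; split; last first.
    by rewrite /= -jump_grid_le// idx ltnn.
  by split => //; split => //=; rewrite (jump_time_le hN)// -jump_grid_le// idx.
move=> [[[Lw /= Tn] Nn] /negP nN].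
have Toy : (T_ n w < +oo)%E by exact: le_lt_trans Tn (ltry _).
split => //; split => //=; apply/eqP; rewrite eqn_leq jump_grid_le//.
by rewrite -(jump_time_le hN)// Tn/= ltnNge jump_grid_le.
Qed.

Let J l (B : set (R * R)) := [set x : R | B (gpoint m l.+1, x)].

Let mJ l B : measurable B -> measurable (J l B).
Proof.
move=> mB; rewrite /J -[X in measurable X]setTI.
have : measurable_fun setT (fun x : R => (gpoint m l.+1, x)) by exact: measurable_fun_pair.
exact.
Qed.

Let q l := expR (- (lambda * gpoint m l)) - expR (- (lambda * gpoint m l.+1)).

Let q_ge0 l : 0 <= q l.
Proof.
by rewrite subr_ge0 ler_expR lerN2 ler_pM2l// le_gpoint.
Qed.

(** The next jump occurs [l + 1] cells later: no jump during the first [l] of them, a jump in the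
    last. *)
Let S B i l := G i `&` ([set w | J l B (X (gpoint m i + gpoint m l.+1) w - X (gpoint m i) w)]
  `&` ([set w | (N (gpoint m i + gpoint m l) w - N (gpoint m i) w)%N = 0%N] `\`
       [set w | (N (gpoint m i + gpoint m l.+1) w - N (gpoint m i) w)%N = 0%N])).

Let gc B := (\sum_(l <oo) ((q l)%:E * P [set w | J l B (X (gpoint m l.+1) w)]))%E.

Let mG i : measurable (G i).
Proof. exact: (filtration_measurable hX hN (@FG i)). Qed.

Let mincr i l (A : set nat) :
  measurable [set w | A (N (gpoint m i + gpoint m l) w - N (gpoint m i) w)%N].
Proof. by apply: (measurable_incr hN); rewrite ?addr_ge0 ?gpoint_ge0. Qed.

Let mXincr B i l : measurable B ->
  measurable [set w | J l B (X (gpoint m i + gpoint m l.+1) w - X (gpoint m i) w)].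
Proof.
move=> mB; rewrite -[X in measurable X]setTI.
have : measurable_fun setT
    (fun w => X (gpoint m i + gpoint m l.+1) w - X (gpoint m i) w).
  by apply: measurable_funB; apply: (levy_measurable hX);
    rewrite ?addr_ge0 ?gpoint_ge0.
by apply => //; exact: mJ.
Qed.

Let mS B i l : measurable B -> measurable (S B i l).
Proof.
move=> mB; apply: measurableI; first exact: mG.
apply: measurableI; first exact: mXincr.
by apply: measurableD; exact: (@mincr i _ (eq^~ 0%N)).
Qed.

(** Having no jump in [l + 1] cells implies having none in [l], so this is the difference of two
    instances of [jump_rule]. *)
Let PS B i l : measurable B ->
  P (S B i l) = (P (G i) * ((q l)%:E * P [set w | J l B (X (gpoint m l.+1) w)]))%E.
Proof.
move=> mB; rewrite /S.
set HX := [set w | J l B _]; set H1 := [set w | (_ - _)%N = 0%N].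
set H2 := [set w | (_ - _)%N = 0%N].
have H21 : H2 `<=` H1.
  move=> w; rewrite /H1 /H2 /= => /eqP; rewrite subn_eq0 => h.
  apply/eqP; rewrite subn_eq0; apply: leq_trans h.
  apply: (poisson_nondecreasing hN); rewrite ?addr_ge0 ?gpoint_ge0//.
  by rewrite lerD2l le_gpoint.
have -> : G i `&` (HX `&` (H1 `\` H2)) = (G i `&` (HX `&` H1)) `\` (G i `&` (HX `&` H2)).
  by apply/seteqP; split => w /=; tauto.
have mH1 : measurable H1 by exact: (@mincr i l (eq^~ 0%N)).
have mH2 : measurable H2 by exact: (@mincr i l.+1 (eq^~ 0%N)).
have mHX : measurable HX by exact: mXincr.
have m1 : measurable (G i `&` (HX `&` H1)).
  by apply: measurableI => //; exact: measurableI.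
have m2 : measurable (G i `&` (HX `&` H2)).
  by apply: measurableI => //; exact: measurableI.
set A1 := G i `&` (HX `&` H1); set A2 := G i `&` (HX `&` H2).
have -> : P (A1 `\` A2) = (P A1 - P A2)%E.
  rewrite measureD//; last by apply: le_lt_trans (ltry 1); exact: (probability_le1 P).
  by rewrite setIidr// /A1 /A2 => w /=; have := @H21 w; tauto.
rewrite /A1 /A2.
rewrite (jump_rule hX hN hXN hlambda (gpoint_ge0 m i) (gpoint_ge0 m l)
  (gpoint_ge0 m l.+1) (@FG i) (mJ l mB)).
rewrite (jump_rule hX hN hXN hlambda (gpoint_ge0 m i) (gpoint_ge0 m l.+1)
  (gpoint_ge0 m l.+1) (@FG i) (mJ l mB)).
have mXl : measurable [set w | J l B (X (gpoint m l.+1) w)].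
  rewrite -[X in measurable X]setTI.
  by apply: (levy_measurable hX) => //; [exact: gpoint_ge0|exact: mJ].
rewrite -[P (G i)]fineK ?fin_num_measure//.
rewrite -[P [set w | J l B _]]fineK ?fin_num_measure//.
by rewrite -!EFinM -EFinB; congr EFin; rewrite /q; ring.
Qed.

Let event_bigcup B : L `&` grid_event n m `&` [set w | B (grid_incr n m w)] =
  \bigcup_i \bigcup_l S B i l.
Proof.
apply/seteqP; split => w.
  move=> [[Lw [[/= Tn Tn1] lt_idx]] Bw].
  set i := grid_index m (jump n w) in lt_idx.
  set j := grid_index m (jump n.+1 w) in lt_idx.
  (* The indices being strictly ordered, the truncated subtraction is exact. *)
  pose l := (j - i.+1)%N; have jE : j = (i + l.+1)%N by rewrite /l; lia.
  have nN : (n <= N (gpoint m i) w)%N by rewrite -jump_grid_le.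
  have Nn : (N (gpoint m i) w <= n)%N by rewrite -ltnS ltnNge -jump_grid_le// -ltnNge.
  have Nl : (N (gpoint m (i + l)) w <= n)%N.
    by rewrite -ltnS ltnNge -jump_grid_le// -/j -ltnNge jE addnS.
  have Nl1 : (n.+1 <= N (gpoint m (i + l.+1)) w)%N by rewrite -jump_grid_le// -/j jE.
  exists i => //; exists l => //; split; first by split.
  split.
    move: Bw; rewrite /= /grid_incr /J /=.
    have -> : grid m (jump n w) = gpoint m i by [].
    have -> : grid m (jump n.+1 w) = gpoint m j by [].
    by rewrite jE gpointD addrAC subrr add0r.
  by rewrite /= -!gpointD; split; lia.
move=> [i _ [l _ [[[[Lw /= Tn] idx] Nn] [Jw []]]]] /=.
rewrite -!gpointD => N1 N2.
have nN : (n <= N (gpoint m i) w)%N by rewrite -jump_grid_le// idx.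
have Nl : (N (gpoint m (i + l)) w <= n)%N by lia.
have Nl1 : (n.+1 <= N (gpoint m (i + l.+1)) w)%N by lia.
have Tn1 : (T_ n.+1 w < +oo)%E.
  by apply: (le_lt_trans _ (ltry (gpoint m (i + l.+1))));
    rewrite (jump_time_le hN)// gpoint_ge0.
have jE : grid_index m (jump n.+1 w) = (i + l.+1)%N.
  apply/eqP; rewrite eqn_leq jump_grid_le// Nl1/= addnS ltnNge jump_grid_le//.
  by rewrite -ltnNge ltnS.
split; first by split => //; split => //=; rewrite idx jE; lia.
move: Jw; rewrite /= /grid_incr /J /=.
have -> : grid m (jump n w) = gpoint m i by rewrite /grid idx.
have -> : grid m (jump n.+1 w) = gpoint m (i + l.+1) by rewrite /grid jE.
by rewrite gpointD addrAC subrr add0r.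
Qed.

Let tS B i : trivIset setT (S B i).
Proof.
apply/trivIsetP => l l' _ _ ll'; apply/seteqP; split => // w.
wlog lt_ll : l l' ll' / (l < l')%N.
  move=> H; have [lt|gt|eq] := ltngtP l l'; [exact: H|rewrite setIC|by rewrite eq eqxx in ll'].
  by apply: H; rewrite // eq_sym.
move=> [[_ [_ [_ /= h1]]] [_ [_ [/= h2 _]]]].
apply: h1; apply/eqP; rewrite subn_eq0; move/eqP: h2; rewrite subn_eq0; apply: leq_trans.
apply: (poisson_nondecreasing hN); rewrite ?addr_ge0 ?gpoint_ge0//.
by rewrite lerD2l le_gpoint.
Qed.

Let tG : trivIset setT G.
Proof.
apply/trivIsetP => i j _ _ ij; apply/seteqP; split => // w.
by move=> [[[_ /= Gi] _] [[_ /= Gj] _]]; move: ij; rewrite -Gi -Gj eqxx.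
Qed.

(** Only the fact that [p] does not depend on [B] matters: [grid_identity] eliminates it by
    comparing with [B = setT] and with [n = 0]. *)
Lemma grid_identity_aux : exists p, forall B : set (R * R), measurable B ->
  P (L `&` grid_event n m `&` [set w | B (grid_incr n m w)]) =
  (p * grid_law m B)%E.
Proof.
exists (P (\bigcup_i G i)) => B mB; rewrite -[grid_law m B]/(gc B) event_bigcup.

have mSi i : measurable (\bigcup_l S B i l).
  by apply: bigcupT_measurable => l; exact: mS.
have tSS : trivIset setT (fun i => \bigcup_l S B i l).
  apply/trivIsetP => i j _ _ ij; apply/seteqP; split => // w [[l _ [Gi _]] [k _ [Gj _]]].
  by move/trivIsetP : tG => /(_ i j Logic.I Logic.I ij) <-; split; eassumption.
have gc0 : (0 <= gc B)%E.
  by apply: nneseries_ge0 => l _ _; rewrite mule_ge0// lee_fin q_ge0.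
have PSi i : P (\bigcup_l S B i l) = (P (G i) * gc B)%E.
  rewrite probability_bigcup//; last by move=> l; exact: mS.
  under eq_eseriesr do rewrite PS//.
  rewrite -[P (G i)]fineK ?fin_num_measure// nneseriesZl//.
  by move=> l _; rewrite mule_ge0// lee_fin q_ge0.
rewrite probability_bigcup// probability_bigcup//.
under eq_eseriesr do rewrite PSi muleC.
(* The weights [q l] telescope to at most 1, so [gc B] is finite and can be taken out of the series
   over [i]. *)
have gc1 : (gc B <= 1)%E.
  apply: lime_le.
    by apply: is_cvg_nneseries => l _ _; rewrite mule_ge0// lee_fin q_ge0.
  apply: nearW => k; apply: (@le_trans _ _ (\sum_(0 <= l < k) (q l)%:E)%E).
    apply: lee_sum => l _; rewrite -[leRHS]mule1 lee_wpmul2l ?lee_fin ?q_ge0//.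
    by apply: probability_le1; rewrite -[X in measurable X]setTI;
      apply: (levy_measurable hX) => //; [exact: gpoint_ge0|exact: mJ].
  rewrite sumEFin lee_fin.
  have -> : \sum_(0 <= l < k) q l = 1 - expR (- (lambda * gpoint m k)).
    elim: k => [|k IHk].
      by rewrite big_nil /gpoint mul0r mulr0 oppr0 expR0 subrr.
    by rewrite big_nat_recr//= IHk /q addrA subrK.
  by rewrite lerBlDr lerDl expR_ge0.
rewrite -[gc B]fineK; last by rewrite ge0_fin_numE// (le_lt_trans gc1)// ltry.
by rewrite nneseriesZl// muleC.
Qed.

End grid_identity.

Lemma before_jumpT n : before_jump n setT.
Proof.
split => // t t0; rewrite setTI; exact: (jump_stopping X hN n).2.
Qed.

Lemma ae_full A : measurable A -> {ae P, forall w, A w} -> P A = 1%E.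
Proof.
move=> mA [Z [mZ PZ ZA]].
have : P (~` A) = 0%E.
  apply/eqP; rewrite eq_le measure_ge0 andbT -PZ; apply: le_measure; rewrite ?inE//.
  exact: measurableC.
rewrite probability_setC// => /eqP.
rewrite -[P A]fineK ?fin_num_measure// -EFinB eqe subr_eq0 => /eqP <-.
by [].
Qed.

(** At [n = 0] the current cell is reduced to time 0, and the first jump almost surely comes later.
    This makes the first increment a normalised reference law for every mesh. *)
Lemma grid_event0 m : P (grid_event 0 m) = 1%E.
Proof.
apply: ae_full; first exact: measurable_grid_event.
have h := poisson_start hN; have h' := jump_strict 0.
apply: filterS2 h h' => w N0 [T0 T1 T01]; split => //=.
have -> : grid_index m (jump 0 w) = 0%N.
  by apply/eqP; rewrite -leqn0 jump_grid_le.
rewrite ltnNge jump_grid_le// /gpoint mul0r N0.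
by [].
Qed.

(* Strong Markov property on the grid of mesh [1 / (m + 1)], exact for every [m]
   as long as the [n]-th and the next jump fall in different cells; letting [m]
   grow gives [jump_incr_independent]. *)
Lemma grid_identity n m L (B : set (R * R)) : before_jump n L -> measurable B ->
  P (L `&` grid_event n m `&` [set w | B (grid_incr n m w)]) =
  (P (L `&` grid_event n m) * P (grid_event 0 m `&` [set w | B (grid_incr 0 m w)]))%E.
Proof.
move=> hL mB.
have [p hp] := grid_identity_aux m hL.
have [p0 hp0] := grid_identity_aux m (before_jumpT 0).
have h1 : P (L `&` grid_event n m) = (p * grid_law m setT)%E.
  by rewrite -hp// (_ : [set w | _] = setT) ?setIT.
have h2 := hp0 _ mB; rewrite setTI in h2.
have h3 := hp0 _ measurableT; rewrite setTI in h3.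
rewrite (_ : [set w | _] = setT) // setIT grid_event0 in h3.
(* By [h3], the product of [p0] and the total mass of [grid_law m] is 1, which cancels the two extra
   factors. *)
rewrite h2 h1 hp// -muleA (muleA _ p0) (muleC _ p0) -h3.
by rewrite mul1e.
Qed.

End strong_markov.

(** * Letting the mesh of the grid tend to zero *)

Lemma integral_indic_mul (R : realType) d (T : measurableType d)
    (P : probability T R) (A : set T) (f : T -> R) :
  (\int[P]_(w in A) (f w)%:E = \int[P]_w (\1_A w * f w)%:E)%E.
Proof.
rewrite integral_mkcond; apply: eq_integral => w _.
by rewrite /patch indicE; case: ifP; rewrite ?mul1r ?mul0r.
Qed.

(** Closed quadrants: a generating pi-system whose members are zero sets of explicit continuous
    functions. *)
Definition ray_box (R : realType) (a b : R) : set (R * R) :=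
  [set x | x.1 <= a /\ x.2 <= b].

Lemma measurable_ray_box (R : realType) (a b : R) : measurable (ray_box a b).
Proof.
have -> : ray_box a b = [set x | x.1 <= a] `&` [set x | x.2 <= b] by [].
by apply: measurableI; rewrite -[X in measurable X]setTI;
  apply: measurable_fun_ler.
Qed.

Section limit.
Context (R : realType) d (Omega : measurableType d) (P : probability Omega R)
  (X : R -> Omega -> R) (N : R -> Omega -> nat) (lambda : R)
  (hX : levy_process P X) (hN : poisson_process P lambda N)
  (hXN : independent_processes P X N) (hlambda : 0 < lambda).
Implicit Types (n m i l : nat) (w : Omega) (t : R).

Local Notation T_ := (jump_time N).
Local Notation jump := (jump N).
Local Notation jump_incr := (jump_incr X N).
Local Notation grid_incr := (grid_incr X N).
Local Notation grid_event := (grid_event N).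
Local Notation before_jump := (before_jump X N).

(** The rounded [n]-th jump decreases towards a time strictly before the next jump, so the two cells
    are eventually different. *)
Lemma grid_event_near n : {ae P, forall w, \forall m \near \oo, grid_event n m w}.
Proof.
apply: filterS (jump_strict hN hlambda n) => w [Tn Tn1].
rewrite -jumpE// -(jumpE Tn1) lte_fin => lt_jump.
have : \forall m \near \oo, grid m (jump n w) < jump n.+1 w.
  by apply: (cvgr_lt _ (cvg_grid (jump_ge0 N n w))).
apply: filterS => m gm; split => //=.
rewrite ltnNge; apply/negP => idx.
have : grid m (jump n.+1 w) <= grid m (jump n w).
  by rewrite /grid ler_pM2r ?invr_gt0// ler_nat.
move=> /(le_lt_trans)/(_ gm); apply/negP; rewrite -leNgt.
by apply: le_grid; exact: jump_ge0.
Qed.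

Lemma cvg_grid_X n w : X (grid m (jump n w)) w @[m --> \oo] --> jump_X X N n w.
Proof.
apply: (@cvg_right_seq _ (X ^~ w)).
- by have [+ _] := levy_cadlag hX w; apply; exact: jump_ge0.
- by move=> m; apply: le_grid; exact: jump_ge0.
- exact: cvg_grid (jump_ge0 N n w).
Qed.

Lemma cvg_grid_incr n w : grid_incr n m w @[m --> \oo] --> jump_incr n w.
Proof.
have h1 : grid m (jump n.+1 w) - grid m (jump n w) @[m --> \oo] -->
    jump n.+1 w - jump n w.
  by apply: cvgB; apply: cvg_grid; exact: jump_ge0.
have h2 : X (grid m (jump n.+1 w)) w - X (grid m (jump n w)) w @[m --> \oo] -->
    jump_X X N n.+1 w - jump_X X N n w.
  by apply: cvgB; exact: cvg_grid_X.
exact: (cvg_pair h1 h2).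
Qed.

Section test_function.
Context (psi : R * R -> R).
Hypotheses (cpsi : continuous psi) (mpsi : measurable_fun setT psi)
  (psi01 : forall x, 0 <= psi x <= 1).

(** Continuity of [psi] uses the pointwise convergence of the increments, and its bound by 1 gives
    domination. *)
Lemma cvg_grid_integral n L : measurable L ->
  (\int[P]_(w in L `&` grid_event n m) (psi (grid_incr n m w))%:E @[m --> \oo] -->
   \int[P]_(w in L) (psi (jump_incr n w))%:E)%E.
Proof.
move=> mL; rewrite integral_indic_mul.
under eq_fun do rewrite integral_indic_mul.
apply: cvg_bounded_integral.
- move=> m; apply: measurable_funM; last first.
    by apply: measurableT_comp => //; exact: (measurable_grid_incr hX hN).
  apply: measurable_indic; apply: measurableI => //.
  exact: (measurable_grid_event hX hN).
- apply: measurable_funM; last first.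
    by apply: measurableT_comp => //; exact: (measurable_jump_incr hX hN).
  exact: measurable_indic.
- move=> m w; rewrite indicE; have /andP[p0 p1] := psi01 (grid_incr n m w).
  by case: (w \in _); rewrite ?mul1r ?mul0r ?p0 ?p1 ?lexx ?ler01.
- apply: filterS (grid_event_near n) => w Ew.
  apply: cvgM; last first.
    by apply: continuous_cvg; [exact: cpsi|exact: cvg_grid_incr].
  apply: cvg_near_cst; apply: filterS Ew => m Ew.
  by rewrite /= !indicE in_setI (mem_set Ew) andbT.
Qed.

End test_function.

Lemma cvg_grid_event n L : measurable L ->
  (P (L `&` grid_event n m) @[m --> \oo] --> P L)%E.
Proof.
move=> mL.
have iE A (f : Omega -> R * R) : measurable A ->
    (\int[P]_(w in A) ((cst 1 : R * R -> R) (f w))%:E = P A)%E.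
  move=> mA; rewrite (eq_integral (cst 1%E))//.
  by rewrite integral_cst// mul1e.
have := @cvg_grid_integral (cst 1) (@cst_continuous _ _ _) (measurable_cst _) _ n L mL.
rewrite iE//; under eq_fun => m.
  rewrite iE; last first.
    by apply: measurableI => //; exact: (measurable_grid_event hX hN).
  over.
by apply => x; rewrite ler01 lexx.
Qed.

(** Both sides are limits of the corresponding grid integrals, which agree for each mesh by
    [grid_identity]. *)
Lemma jump_incr_test (psi : R * R -> R) n L : continuous psi -> measurable_fun setT psi ->
  (forall x, 0 <= psi x <= 1) -> before_jump n L ->
  (\int[P]_(w in L) (psi (jump_incr n w))%:E =
   P L * \int[P]_w (psi (jump_incr 0 w))%:E)%E.
Proof.
move=> cpsi mpsi psi01 hL; have [mL _] := hL.
have h1 := cvg_grid_integral cpsi mpsi psi01 (n := n) mL.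
have h0 := cvg_grid_integral cpsi mpsi psi01 (n := 0) measurableT.
have hP := cvg_grid_event n mL.
have E m : (\int[P]_(w in L `&` grid_event n m) (psi (grid_incr n m w))%:E =
  P (L `&` grid_event n m) *
  \int[P]_(w in setT `&` grid_event 0 m) (psi (grid_incr 0 m w))%:E)%E.
  have mE k : measurable (grid_event k m) by exact: (measurable_grid_event hX hN).
  have mLE : measurable (L `&` grid_event n m) by exact: measurableI.
  rewrite setTI -[P (L `&` _)]fineK ?fin_num_measure//.
  apply: (@ge0_integral_law _ _ _ _ _ P (grid_incr n m) (grid_incr 0 m) _ _ _
    (EFin \o psi)) => //.
  - exact: (measurable_grid_incr hX hN).
  - exact: (measurable_grid_incr hX hN).
  - by rewrite fine_ge0.
  - move=> B mB; rewrite fineK ?fin_num_measure//.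
    exact: (grid_identity hX hN hXN hlambda).
  - exact/measurable_EFinP.
  - by move=> x; rewrite lee_fin; case/andP: (psi01 x).
rewrite (_ : (fun m => _) = (fun m => P (L `&` grid_event n m) *
    \int[P]_(w in setT `&` grid_event 0 m) (psi (grid_incr 0 m w))%:E)%E) in h1; last first.
  by apply/funext => m; rewrite E.
have i01 : (0 <= \int[P]_w (psi (jump_incr 0 w))%:E <= 1)%E.
  apply/andP; split.
    by apply: integral_ge0 => w _; rewrite lee_fin; case/andP: (psi01 (jump_incr 0 w)).
  rewrite -(probability_setT P) -[leRHS]mul1e -integral_cst//.
  apply: ge0_le_integral => //.
  - by move=> w _; rewrite lee_fin; case/andP: (psi01 (jump_incr 0 w)).
  - apply/measurable_EFinP; apply: measurableT_comp => //.
    exact: (measurable_jump_incr hX hN).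
  - by move=> w _; rewrite lee_fin; case/andP: (psi01 (jump_incr 0 w)).
have ifin : (\int[P]_w (psi (jump_incr 0 w))%:E \is a fin_num)%E.
  by case/andP: i01 => i0 i1; rewrite ge0_fin_numE//; exact: le_lt_trans i1 (ltry 1).
have def : (P L *? \int[P]_w (psi (jump_incr 0 w))%:E)%E.
  by apply: mule_def_fin => //; exact: fin_num_measure.
exact: (cvg_unique _ h1 (cvgeM def hP h0)).
Qed.

(** Continuous, nonnegative and zero exactly on the box, so that the powers of exp(- gap) decrease
    to the indicator of the box. *)
Definition box_gap (a b : R) (x : R * R) : R :=
  Num.max 0 (x.1 - a) + Num.max 0 (x.2 - b).

Lemma box_gap_ge0 a b x : 0 <= box_gap a b x.
Proof. by rewrite addr_ge0// le_max lexx. Qed.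

Lemma box_gapP a b x : ray_box a b x <-> box_gap a b x = 0.
Proof.
rewrite /ray_box /box_gap /=; split.
  by move=> [xa xb]; rewrite !max_l ?subr_le0// addr0.
move=> /eqP; rewrite paddr_eq0 ?le_max ?lexx// => /andP[/eqP ma /eqP mb].
split; rewrite -subr_le0.
  by rewrite -ma le_max lexx orbT.
by rewrite -mb le_max lexx orbT.
Qed.

Lemma continuous_box_gap a b : continuous (box_gap a b).
Proof.
move=> x.
have h1 : {for x, continuous ((fun=> 0) \max (fun x : R * R => x.1 - a) : R * R -> R^o)}.
  apply: continuous_max; first exact: cst_continuous.
  by apply: cvgB; [exact: cvg_fst|exact: cvg_cst].
have h2 : {for x, continuous ((fun=> 0) \max (fun x : R * R => x.2 - b) : R * R -> R^o)}.
  apply: continuous_max; first exact: cst_continuous.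
  by apply: cvgB; [exact: cvg_snd|exact: cvg_cst].
exact: (cvgD h1 h2).
Qed.

Lemma measurable_box_gap a b : measurable_fun setT (box_gap a b).
Proof.
apply: measurable_funD; apply: measurable_maxr => //; apply: measurable_funB => //.
Qed.

Lemma jump_incr_box a b n L : before_jump n L ->
  P (L `&` jump_incr n @^-1` ray_box a b) =
  (P L * P (jump_incr 0 @^-1` ray_box a b))%E.
Proof.
move=> hL; have [mL _] := hL.
pose psi k x := expR (- box_gap a b x) ^+ k.
have psi01 k x : 0 <= psi k x <= 1.
  rewrite exprn_ge0 ?expR_ge0//= exprn_ile1// ?expR_ge0//.
  by rewrite -expR0 ler_expR lerNl oppr0 box_gap_ge0.
have cpsi k : continuous (psi k).
  move=> x; apply: (@continuous_comp _ _ _ (fun x => expR (- box_gap a b x))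
    (fun y => y ^+ k)); last exact: exprn_continuous.
  apply: (@continuous_comp _ _ _ (fun x => - box_gap a b x) expR); last first.
    exact: continuous_expR.
  by apply: continuousN; exact: continuous_box_gap.
have mpsi k : measurable_fun setT (psi k).
  apply: measurable_funX; apply: measurableT_comp => //.
  by apply: measurableT_comp => //; exact: measurable_box_gap.
have mbox := measurable_ray_box a b.
have lim j A : measurable A ->
    (\int[P]_(w in A) (psi k (jump_incr j w))%:E @[k --> \oo] -->
      P (A `&` jump_incr j @^-1` ray_box a b))%E.
  move=> mA.
  have mY := measurable_jump_incr hX hN j.
  have mI : measurable (A `&` jump_incr j @^-1` ray_box a b).
    by apply: measurableI => //; rewrite -[X in measurable X]setTI; exact: mY.
  rewrite -[X in _ --> X]mul1e -integral_cst// integral_indic_mul.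
  under eq_fun do rewrite integral_indic_mul.
  apply: cvg_bounded_integral.
  - move=> k; apply: measurable_funM; first exact: measurable_indic.
    exact: measurableT_comp.
  - by apply: measurable_funM => //; exact: measurable_indic.
  - move=> k w; rewrite indicE; have /andP[p0 p1] := psi01 k (jump_incr j w).
    by case: (w \in _); rewrite ?mul1r ?mul0r ?p0 ?p1 ?lexx ?ler01.
  - apply: aeW => w; rewrite mulr1 !indicE in_setI.
    case: (w \in A); last first.
      by rewrite /=; under eq_fun do rewrite mul0r; exact: cvg_cst.
    rewrite /=; under eq_fun do rewrite mul1r.
    rewrite /psi; have [box|box] := pselect (ray_box a b (jump_incr j w)).
      rewrite mem_set//.
      have /box_gapP -> := box; rewrite oppr0 expR0.
      by under eq_fun do rewrite expr1n; exact: cvg_cst.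
    rewrite memNset//; apply: cvg_expr.
    rewrite ger0_norm ?expR_ge0// -expR0 ltr_expR ltrNl oppr0 lt_neqAle.
    by rewrite box_gap_ge0 andbT eq_sym; apply/eqP => /box_gapP.
have h1 := lim n _ mL; have h2 := lim 0%N _ measurableT.
have E k : (\int[P]_(w in L) (psi k (jump_incr n w))%:E =
    P L * \int[P]_w (psi k (jump_incr 0 w))%:E)%E.
  exact: jump_incr_test.
rewrite setTI in h2.
rewrite (_ : (fun k => _) = (fun k => P L * \int[P]_w (psi k (jump_incr 0 w))%:E)%E)
  in h1; last by apply/funext => k; exact: E.
have PL : P L \is a fin_num by exact: fin_num_measure.
exact: (cvg_unique _ h1 (cvgeZl PL h2)).
Qed.

End limit.

Section ray_box_generation.
Context {R : realType}.

(** Half-planes are countable unions of boxes, so both projections are measurable for the generated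
    sigma-algebra. *)
Lemma ray_box_generated :
  @measurable _ (R * R)%type = <<s [set B | exists a b, B = @ray_box R a b] >>.
Proof.
set G := [set B | _].
apply/seteqP; split; last first.
  apply: smallest_sub; first exact: sigma_algebra_measurable.
  by move=> _ [a [b ->]]; exact: measurable_ray_box.
rewrite measurable_prod_measurableType; apply: smallest_sub.
  exact: smallest_sigma_algebra.
move=> _ [A mA [B mB <-]].
pose T := g_sigma_algebraType G.
have fst_meas : measurable_fun setT (fst : T -> R).
  apply: measurable_fun_le_real => a.
  rewrite [X in measurable X](_ : _ = \bigcup_n (ray_box a n%:R : set T)).
    apply: bigcupT_measurable => n; apply: sub_sigma_algebra.
    by exists a, n%:R.
  apply/seteqP; split => x /=; last by move=> [n _ []].
  move=> xa; exists (Num.bound `|x.2|) => //; split => //=.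
  by rewrite (le_trans (ler_norm _))// ltW// archi_boundP.
have snd_meas : measurable_fun setT (snd : T -> R).
  apply: measurable_fun_le_real => a.
  rewrite [X in measurable X](_ : _ = \bigcup_n (ray_box n%:R a : set T)).
    apply: bigcupT_measurable => n; apply: sub_sigma_algebra.
    by exists n%:R, a.
  apply/seteqP; split => x /=; last by move=> [n _ []].
  move=> xa; exists (Num.bound `|x.1|) => //; split => //=.
  by rewrite (le_trans (ler_norm _))// ltW// archi_boundP.
have -> : A `*` B = (setT `&` fst @^-1` A) `&` (setT `&` snd @^-1` B).
  by apply/seteqP; split => x /=; tauto.
by apply: (@measurableI _ T); [exact: fst_meas|exact: snd_meas].
Qed.

Lemma ray_box_unique (m1 m2 : {measure set (R * R) -> \bar R}) :
  (forall a b, m1 (ray_box a b) = m2 (ray_box a b)) ->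
  (forall B, measurable B -> (m1 B < +oo)%E) ->
  forall B, measurable B -> m1 B = m2 B.
Proof.
move=> h fin; apply: (measure_unique _ (fun n => ray_box n%:R n%:R) ray_box_generated).
- move=> _ _ [a [b ->]] [a' [b' ->]]; exists (Num.min a a'), (Num.min b b').
  apply/seteqP; split => x; rewrite /ray_box /= !le_min.
    by move=> [[-> ->] [-> ->]].
  by move=> [/andP[-> ->] /andP[-> ->]].
- by move=> n; exists n%:R, n%:R.
- apply/seteqP; split => // x _; exists (Num.bound (Num.max `|x.1| `|x.2|)) => //.
  have h0 : 0 <= Num.max `|x.1| `|x.2| by rewrite le_max normr_ge0.
  have hb := ltW (archi_boundP h0).
  by split; rewrite (le_trans (ler_norm _))// (le_trans _ hb)// le_max lexx ?orbT.
- by move=> _ [a [b ->]].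
- by move=> k; apply: fin; exact: measurable_ray_box.
Qed.

End ray_box_generation.

(** * Strong Markov property for Borel sets and the one-step equation *)

Section jump_independent.
Context (R : realType) d (Omega : measurableType d) (P : probability Omega R)
  (X : R -> Omega -> R) (N : R -> Omega -> nat) (lambda : R)
  (hX : levy_process P X) (hN : poisson_process P lambda N)
  (hXN : independent_processes P X N) (hlambda : 0 < lambda).
Implicit Types (n m i l : nat) (w : Omega) (t : R).

Local Notation F := (natural_filtration X N).
Local Notation T_ := (jump_time N).
Local Notation jump := (jump N).
Local Notation jump_X := (jump_X X N).
Local Notation jump_incr := (jump_incr X N).
Local Notation before_jump := (before_jump X N).

(** Both sides are finite measures in [B] that agree on boxes. *)
Lemma jump_incr_independent n L B : before_jump n L -> measurable B ->
  P (L `&` jump_incr n @^-1` B) = (P L * P (jump_incr 0 @^-1` B))%E.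
Proof.
move=> hL mB; have [mL _] := hL.
have mY := measurable_jump_incr hX hN n; have mY0 := measurable_jump_incr hX hN 0.
have PL0 : 0 <= fine (P L) by rewrite fine_ge0.
pose m1 : {measure set Omega -> \bar R} := mrestr P mL.
pose n1_ : {measure set (R * R) -> \bar R} := pushforward m1 (jump_incr n).
pose n1 := n1_ mY.
pose n2_ : {measure set (R * R) -> \bar R} := pushforward P (jump_incr 0).
pose n2 : {measure set (R * R) -> \bar R} := mscale (NngNum PL0) (n2_ mY0).
have n1E C : n1 C = P (L `&` jump_incr n @^-1` C).
  by rewrite setIC.
have n2E C : n2 C = (P L * P (jump_incr 0 @^-1` C))%E.
  rewrite -[P L]fineK ?fin_num_measure//.
rewrite -n1E -n2E; apply: ray_box_unique => //.
  by move=> a b; rewrite n1E n2E; exact: (jump_incr_box hX hN hXN hlambda).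
move=> C mC; rewrite n1E; apply: le_lt_trans (ltry 1); apply: probability_le1.
by apply: measurableI => //; rewrite -[X in measurable X]setTI; exact: (mY measurableT C mC).
Qed.

(** Since the time and position at the jump may be added to the past event, the increment is
    independent of them jointly with [L]. *)
Lemma before_jumpI n L C : before_jump n L -> measurable C ->
  before_jump n (L `&` [set w | C (jump n w, jump_X n w)]).
Proof.
move=> [mL FL] mC; split.
  apply: measurableI => //.
  have : measurable_fun setT (fun w => (jump n w, jump_X n w)).
    by apply: measurable_fun_pair; [exact: (measurable_jump hX hN)|
      exact: (measurable_jump_X hX hN)].
  by move=> /(_ measurableT C mC); rewrite setTI.
move=> t t0; rewrite (_ : L `&` _ `&` _ = (L `&` [set w | (T_ n w <= t%:E)%E]) `&`
  ([set w | C (jump n w, jump_X n w)] `&` [set w | (T_ n w <= t%:E)%E])).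
  apply: (@filtrationI _ _ _ X N t _ _ (FL t t0)).
  exact: (stopped_pair hX (jump_stopping X hN n)).
by apply/seteqP; split => w /=; tauto.
Qed.

Lemma jump0 w : jump 0 w = 0.
Proof. by rewrite /jump (jump_time0 hN). Qed.

Lemma jump_X0 : {ae P, forall w, jump_X 0 w = 0}.
Proof. by apply: filterS (levy_start hX) => w; rewrite /jump_X jump0. Qed.

Context (r : R).

Definition jump_discount n w : R := expR (- r * jump n w).

(* [E_s[e^(-r T_1) f(S_(T_1))]], using that [X_0 = 0] almost surely. *)
Definition jump_operator (f : R -> \bar R) (s : R) : \bar R :=
  (\int[P]_w ((jump_discount 1 w)%:E * f (s * expR (jump_X 1 w))%R))%E.

Lemma measurable_jump_discount n : measurable_fun setT (jump_discount n).
Proof.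
apply: measurableT_comp => //; apply: measurable_funM => //.
exact: (measurable_jump hX hN).
Qed.

Lemma measurable_price n s : measurable_fun setT (fun w => s * expR (jump_X n w)).
Proof.
apply: measurable_funM => //; apply: measurableT_comp => //.
exact: (measurable_jump_X hX hN).
Qed.

Lemma measurable_discounted n s (f : R -> \bar R) : measurable_fun setT f ->
  measurable_fun setT (fun w => (jump_discount n w)%:E * f (s * expR (jump_X n w))%R)%E.
Proof.
move=> mf; apply: emeasurable_funM.
  by apply/measurable_EFinP; exact: measurable_jump_discount.
apply: measurableT_comp => //; exact: measurable_price.
Qed.

(** Discount and price at the next jump are functions of the pair known at [T_n] and of an
    independent increment; integrating out the increment leaves the discount at [T_n] times the
    operator. *)
Lemma dynamic_programming n L s (f : R -> \bar R) :
  before_jump n L -> measurable_fun setT f -> (forall x, 0 <= f x)%E ->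
  (\int[P]_(w in L) ((jump_discount n.+1 w)%:E * f (s * expR (jump_X n.+1 w))%R) =
   \int[P]_(w in L) ((jump_discount n w)%:E *
      jump_operator f (s * expR (jump_X n w))%R))%E.
Proof.
move=> hL mf f0; have [mL _] := hL.
pose W w := (jump n w, jump_X n w).
pose h (z : (R * R) * (R * R)) : \bar R :=
  ((expR (- r * (z.1.1 + z.2.1)))%:E * f (s * expR (z.1.2 + z.2.2))%R)%E.
have mW : measurable_fun setT W.
  by apply: measurable_fun_pair; [exact: (measurable_jump hX hN)|
    exact: (measurable_jump_X hX hN)].
have mh : measurable_fun setT h.
  apply: emeasurable_funM.
    apply/measurable_EFinP; apply: measurableT_comp => //.
    apply: measurable_funM => //; apply: measurable_funD.
      exact: (measurableT_comp measurable_fst measurable_fst).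
    exact: (measurableT_comp measurable_fst measurable_snd).
  apply: measurableT_comp => //; apply: measurable_funM => //.
  apply: measurableT_comp => //; apply: measurable_funD.
    exact: (measurableT_comp measurable_snd measurable_fst).
  exact: (measurableT_comp measurable_snd measurable_snd).
transitivity (\int[P]_(w in L) h (W w, jump_incr n w))%E.
  apply: eq_integral => w _; rewrite /h /W /jump_incr /=.
  by rewrite /jump_discount (addrC (jump n w)) subrK (addrC (jump_X n w)) subrK.
have mY k := measurable_jump_incr hX hN k.
rewrite (@integral_independent _ _ _ _ _ _ _ P L W (jump_incr n) (jump_incr 0) h)//.
- apply: eq_integral => w _; rewrite /jump_operator.
  rewrite -ge0_integralZl//.
  + apply: ge0_ae_eq_integral => //.
    * by apply: (measurableT_comp mh); exact: measurable_fun_pair.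
    * apply: emeasurable_funM => //; exact: measurable_discounted.
    * by move=> x _; rewrite mule_ge0// lee_fin expR_ge0.
    * by move=> x _; rewrite !mule_ge0// lee_fin expR_ge0.
    (* Here the first increment is almost surely the pair (T_1, X at T_1) itself. *)
    * apply: filterS jump_X0 => w' X0 _; rewrite /h /W /jump_incr /= jump0 X0 !subr0.
      by rewrite muleA -EFinM /jump_discount -!expRD -mulrDr -mulrA -expRD.
  + exact: measurable_discounted.
  + by move=> x _; rewrite mule_ge0// lee_fin expR_ge0.
  + by rewrite lee_fin expR_ge0.
- move=> C B mC mB; apply: jump_incr_independent => //; exact: before_jumpI.
- by move=> x; rewrite mule_ge0// lee_fin expR_ge0.
Qed.

Lemma measurable_jump_operator (f : R -> \bar R) :
  measurable_fun setT f -> (forall x, 0 <= f x)%E ->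
  measurable_fun setT (jump_operator f).
Proof.
move=> mf f0.
have := @measurable_fun_fubini_tonelli_F _ _ R Omega R P
  (fun z => (jump_discount 1 z.2)%:E * f (z.1 * expR (jump_X 1 z.2))%R)%E.
apply.
  apply: emeasurable_funM.
    apply/measurable_EFinP.
    exact: (measurableT_comp (measurable_jump_discount 1) measurable_snd).
  apply: measurableT_comp => //; apply: measurable_funM => //.
  apply: measurableT_comp => //.
  exact: (measurableT_comp (measurable_jump_X hX hN 1) measurable_snd).
by move=> x; rewrite mule_ge0// lee_fin expR_ge0.
Qed.

End jump_independent.

Lemma ge0_integral_ae_eq_set (R : realType) d (T : measurableType d)
    (mu : {measure set T -> \bar R}) (A B : set T) (f : T -> \bar R) :
  measurable A -> measurable B -> measurable_fun setT f -> (forall x, 0 <= f x)%E ->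
  {ae mu, forall x, A x <-> B x} ->
  (\int[mu]_(x in A) f x = \int[mu]_(x in B) f x)%E.
Proof.
move=> mA mB mf f0 AB; rewrite integral_mkcond [RHS]integral_mkcond.
apply: ge0_ae_eq_integral => //.
- by apply/(measurable_restrictT _ mA); exact: measurable_funTS.
- by apply/(measurable_restrictT _ mB); exact: measurable_funTS.
- by move=> x _; rewrite /patch; case: ifP.
- by move=> x _; rewrite /patch; case: ifP.
- apply: filterS AB => x [AB BA] _; rewrite /patch.
  by congr (if _ then _ else _); apply/idP/idP; rewrite !inE.
Qed.

(** * Strategies and dynamic programming *)

Section strategies.
Context (R : realType) d (Omega : measurableType d) (P : probability Omega R)
  (X : R -> Omega -> R) (N : R -> Omega -> nat) (lambda : R)
  (hX : levy_process P X) (hN : poisson_process P lambda N)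
  (hXN : independent_processes P X N) (hlambda : 0 < lambda) (r : R).
Implicit Types (n m i l : nat) (w : Omega) (t : R) (tau : Omega -> \bar R).

Local Notation F := (natural_filtration X N).
Local Notation T_ := (jump_time N).
Local Notation jump := (jump N).
Local Notation jump_X := (jump_X X N).
Local Notation before_jump := (before_jump X N).
Local Notation D := (jump_discount N r).
Local Notation Q := (jump_operator P X N r).

(** On such a path a stopping value determines the index of the jump at which it occurs. *)
Definition regular_path w := forall n, (T_ n w < +oo)%E /\ (T_ n w < T_ n.+1 w)%E.

Lemma ae_regular_path : {ae P, forall w, regular_path w}.
Proof.
apply: ae_foralln => n.
by apply: filterS (jump_strict hN hlambda n) => w [? _ ?].
Qed.

Lemma regular_lt w i j : regular_path w -> (T_ i w < T_ j w)%E = (i < j)%N.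
Proof.
move=> reg; apply/idP/idP; last first.
  move=> ij; apply: (@lt_le_trans _ _ (T_ i.+1 w)); first by have [] := reg i.
  exact: jump_time_homo.
by rewrite ltnNge; apply: contraTN => ji; rewrite -leNgt; exact: jump_time_homo.
Qed.

Lemma regular_inj w i j : regular_path w -> T_ i w = T_ j w -> i = j.
Proof.
move=> reg Tij; apply/eqP; rewrite eqn_leq; apply/andP.
by split; rewrite leqNgt -(regular_lt _ _ reg) Tij ltxx.
Qed.

(** Given [T_n <= t], either [tau > t], or a rational [q <= t] separates [T_n] from [tau]; both
    cases are decided by time [t]. *)
Lemma before_jump_gt tau n : stopping_time X N tau ->
  before_jump n [set w | (T_ n w < tau w)%E].
Proof.
move=> stau; have [tau0 Ftau] := stau.
have mtau := stopping_measurable hX hN stau.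
have mT := measurable_jump_time hX hN n.
split.
  by rewrite -[X in measurable X]setTI; apply: measurable_lte.
move=> t t0; have [_ FT] := jump_stopping X hN n.
(* Rationals are clamped to [[0, t]], where the events belong to the information at [t]. *)
pose rs (q : rat) : R := Num.min t (Num.max 0 (ratr q)).
have rs0 q : 0 <= rs q <= t.
  by rewrite /rs le_min t0 le_max lexx /= ge_min lexx.
rewrite (_ : _ `&` _ = ([set w | (T_ n w <= t%:E)%E] `\` [set w | (tau w <= t%:E)%E]) `|`
  \bigcup_q (([set w | (T_ n w <= (rs q)%:E)%E] `\` [set w | (tau w <= (rs q)%:E)%E])
     `&` [set w | (T_ n w <= t%:E)%E])).
  apply: (@measurableU _ (g_sigma_algebraType _)).
    by apply: filtrationD; [exact: FT|exact: Ftau].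
  apply: (@bigcupT_measurable_rat _ (g_sigma_algebraType _)) => q.
  have /andP[rq0 rqt] := rs0 q.
  apply: (@filtrationI _ _ _ X N t); last exact: FT.
  by apply: filtrationD; apply: (filtration_mono rqt); [exact: FT|exact: Ftau].
apply/seteqP; split => w /=.
  move=> [Ttau Tt].
  have [taut|taut] := leP (tau w) t%:E; last first.
    by left; split => //; apply/negP; rewrite -ltNge.
  right.
  have T0 := jump_time_ge0 N n w.
  have Tfin : T_ n w \is a fin_num by rewrite ge0_fin_numE// (le_lt_trans Tt) ?ltry.
  have taufin : tau w \is a fin_num by rewrite ge0_fin_numE// (le_lt_trans taut) ?ltry.
  have : fine (T_ n w) < fine (tau w) by rewrite -lte_fin !fineK.
  move=> /rat_in_itvoo[q /itvP qP].
  have Tq : fine (T_ n w) < ratr q by rewrite qP.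
  have qt : ratr q < fine (tau w) by rewrite qP.
  have q0 : 0 <= ratr q :> R by apply: le_trans (ltW Tq); rewrite fine_ge0.
  have qlet : ratr q <= t by rewrite (le_trans (ltW qt))// -lee_fin fineK.
  exists q => //; rewrite /rs (max_r q0) (min_r qlet); split => //; split => /=.
    by rewrite -[X in (X <= _)%E]fineK// lee_fin ltW.
  by apply/negP; rewrite -ltNge -[X in (_ < X)%E]fineK// lte_fin.
move=> [[Tt /negP]|[q _ [[Tq /negP tq] Tt]]].
  by rewrite -ltNge => ttau; split => //; exact: le_lt_trans ttau.
by split => //; apply: le_lt_trans Tq _; rewrite ltNge.
Qed.

(* The first condition makes these events disjoint on every path, not just on
   those where the jump times increase strictly. *)
Definition stop_event tau n : set Omega :=
  [set w | [/\ (T_ n w < tau w)%E, tau w = T_ n.+1 w & (T_ n.+1 w < +oo)%E]].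

Lemma measurable_stop_event tau n : stopping_time X N tau ->
  measurable (stop_event tau n).
Proof.
move=> stau; have mtau := stopping_measurable hX hN stau.
have mT k := measurable_jump_time hX hN k.
rewrite [X in measurable X](_ : _ = [set w | (T_ n w < tau w)%E] `&`
  [set w | tau w = T_ n.+1 w] `&` [set w | (T_ n.+1 w < +oo)%E]).
  apply: measurableI; last exact: (measurable_jump_finite hX hN).
  apply: measurableI; first by have [] := before_jump_gt n stau.
  rewrite -[X in measurable X]setTI; exact: measurable_eqe.
by apply/seteqP; split => w; [move=> []|move=> [[]]].
Qed.

Lemma trivIset_stop_event tau : trivIset setT (stop_event tau).
Proof.
apply/trivIsetP => i j _ _ ij; apply/seteqP; split => // w.
wlog lt_ij : i j ij / (i < j)%N.
  move=> H; have [lt|gt|eq] := ltngtP i j; [exact: H|rewrite setIC|by rewrite eq eqxx in ij].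
  by apply: H; rewrite // eq_sym.
move=> [[_ tauE _] [lt_tau _ _]].
have := jump_time_homo N w lt_ij; rewrite -tauE => /(lt_le_trans lt_tau).
by rewrite ltxx.
Qed.

Definition discounted f s n w : \bar R := ((D n w)%:E * f (s * expR (jump_X n w))%R)%E.

Lemma discounted_ge0 (f : R -> \bar R) s n w : (forall x, 0 <= f x)%E ->
  (0 <= discounted f s n w)%E.
Proof. by move=> f0; rewrite mule_ge0// lee_fin expR_ge0. Qed.

Lemma measurable_discounted_jump (f : R -> \bar R) s n : measurable_fun setT f ->
  measurable_fun setT (discounted f s n).
Proof. exact: (measurable_discounted hX hN). Qed.

(** A strategy still running after [T_n] almost surely either stops at the next jump or goes on
    beyond it. *)
Lemma one_step tau n s (f : R -> \bar R) : poisson_strategy P X N tau ->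
  measurable_fun setT f -> (forall x, 0 <= f x)%E ->
  (\int[P]_(w in [set w | (T_ n w < tau w)%E]) discounted (Q f) s n w =
   \int[P]_(w in stop_event tau n) discounted f s n.+1 w +
   \int[P]_(w in [set w | (T_ n.+1 w < tau w)%E]) discounted f s n.+1 w)%E.
Proof.
move=> [stau tauT] mf f0.
have mgt k : measurable [set w | (T_ k w < tau w)%E] by have [] := before_jump_gt k stau.
have mst := measurable_stop_event n stau.
rewrite -(dynamic_programming hX hN hXN hlambda r s (before_jump_gt n stau) mf f0).
rewrite -ge0_integral_setU//.
- apply: ge0_integral_ae_eq_set => //.
  + exact: measurableU.
  + exact: measurable_discounted_jump.
  + by move=> w; exact: discounted_ge0.
  + apply: filterS2 ae_regular_path tauT => w reg tauw; split => /=; last first.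
      move=> [[//]|]; apply: le_lt_trans; exact: jump_time_homo.
    move=> Ttau; have [reg1 _] := reg n.+1.
    case: tauw => [->|[k k0 tauk]]; first by right.
    move: Ttau; rewrite tauk regular_lt// leq_eqVlt => /predU1P[kn|nk].
      by left; split; rewrite ?tauk -?kn// regular_lt.
    by right; rewrite regular_lt.
- by apply: measurable_funTS; exact: measurable_discounted_jump.
- by move=> w _; exact: discounted_ge0.
- apply/disj_setPS => w [[_ tauE _]] /=; by rewrite tauE ltxx.
Qed.

Lemma measurable_discounted_payoff tau (g : R -> R) s : stopping_time X N tau ->
  measurable_fun setT g -> measurable_fun setT (discounted_payoff X r g s tau).
Proof.
move=> stau mg; have mtau := stopping_measurable hX hN stau.
have mXtau := stopped_X_measurable hX hN stau.
have [tau0 _] := stau.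
rewrite (_ : discounted_payoff X r g s tau = fun w =>
  if (tau w < +oo)%E then expR (- r * fine (tau w)) *
    g (s * expR (X (fine (tau w)) w)) else 0); last first.
  apply/funext => w; rewrite /discounted_payoff /price.
  by case: (tau w) (tau0 w) => [t|//|//]; rewrite ltry.
apply: measurable_fun_ifT => //.
- exact: measurable_fun_lte.
- apply: measurable_funM.
    apply: measurableT_comp => //; apply: measurable_funM => //.
    exact: measurableT_comp.
  apply: measurableT_comp => //; apply: measurable_funM => //.
  exact: measurableT_comp.
Qed.

(** Almost surely the strategy stops at exactly one jump, or never and earns 0. Stopping at
    [T_(n+1)] carries index [n]. *)
Lemma payoff_sum tau (g : R -> R) s : poisson_strategy P X N tau ->
  measurable_fun setT g -> (forall x, 0 <= g x) ->
  ('E_P[discounted_payoff X r g s tau] =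
   \sum_(n <oo) \int[P]_(w in stop_event tau n) discounted (EFin \o g) s n.+1 w)%E.
Proof.
move=> [stau tauT] mg g0; have [tau0 _] := stau.
have mst n := measurable_stop_event n stau.
have mpay := measurable_discounted_payoff s stau mg.
have pay0 w : 0 <= discounted_payoff X r g s tau w.
  by rewrite /discounted_payoff; case: (tau w) => // t; rewrite mulr_ge0 ?expR_ge0.
have mU : measurable (\bigcup_n stop_event tau n) by exact: bigcupT_measurable.
rewrite unlock.
transitivity (\int[P]_(w in \bigcup_n stop_event tau n) (discounted_payoff X r g s tau w)%:E)%E.
  rewrite [RHS]integral_mkcond; apply: ge0_ae_eq_integral => //.
  - exact/measurable_EFinP.
  - apply/(measurable_restrictT _ mU).
    by apply: measurable_funTS; exact/measurable_EFinP.
  - by move=> x _; rewrite lee_fin.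
  - by move=> x _; rewrite /patch; case: ifP => // _; rewrite lee_fin.
  - apply: filterS2 ae_regular_path tauT => w reg tauw _; rewrite /patch.
    case: ifPn => //; rewrite notin_setE => nst.
    case: tauw => [tauE|[[//|k] _ tauk]]; first by rewrite /discounted_payoff tauE.
    exfalso; apply: nst; exists k => //; have [? ?] := reg k; have [? ?] := reg k.+1.
    by split => //; rewrite tauk.
rewrite ge0_integral_bigcup//.
- apply: eq_eseriesr => n _; apply: eq_integral => w; rewrite inE => -[_ tauE Tn].
  rewrite /discounted_payoff /discounted /= tauE.
  rewrite -(jumpE Tn) /=.
  by rewrite EFinM.
- by apply: measurable_funTS; exact/measurable_EFinP.
- by move=> x _; rewrite lee_fin.
- exact: trivIset_stop_event.
Qed.

End strategies.

(** * Rules stopping at the first suitable observation *)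

Section first_jump.
Context (R : realType) d (Omega : measurableType d) (P : probability Omega R)
  (X : R -> Omega -> R) (N : R -> Omega -> nat) (lambda : R)
  (hX : levy_process P X) (hN : poisson_process P lambda N)
  (hXN : independent_processes P X N) (hlambda : 0 < lambda) (r : R).
Implicit Types (n m i l : nat) (w : Omega) (t : R) (tau : Omega -> \bar R).

Local Notation F := (natural_filtration X N).
Local Notation T_ := (jump_time N).
Local Notation jump_X := (jump_X X N).
Local Notation before_jump := (before_jump X N).
Local Notation Q := (jump_operator P X N r).
Local Notation discounted := (discounted X N r).
Local Notation stop_event := (stop_event N).

(** The offset [n0] yields rules that ignore the first [n0] observations, the ones by which the tail
    value bounds what is left after them. *)
Definition first_jump n0 (B : nat -> set Omega) w : \bar R :=
  ereal_inf [set T_ n w | n in [set n | (n0 < n)%N /\ B n w]].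

Lemma first_jumpP n0 B w :
  (first_jump n0 B w = +oo%E /\ (forall n, (n0 < n)%N -> ~ B n w)) \/
  exists n, [/\ (n0 < n)%N, B n w, first_jump n0 B w = T_ n w &
    forall i, (n0 < i < n)%N -> ~ B i w].
Proof.
have [[n [nn0 Bn]]|nB] := pselect (exists n, (n0 < n)%N /\ B n w); last first.
  have nB' n : (n0 < n)%N -> ~ B n w by move=> ? ?; apply: nB; exists n.
  left; split => //; rewrite /first_jump.
  rewrite (_ : [set _ | _ in _] = set0) ?ereal_inf0//.
  by apply/seteqP; split => // y [n [nn0 Bn] _]; case: (nB' n nn0).
right; pose p n := (n0 < n)%N && `[< B n w >].
have ep : exists n, p n by exists n; rewrite /p nn0; apply/asboolP.
have [k pk kmin] := ex_minnP ep.
move: (pk) => /andP[k0 /asboolP Bk]; exists k; split => //.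
  apply/eqP; rewrite eq_le; apply/andP; split.
    by apply: ereal_inf_lbound; exists k.
  apply/ereal_infP => _ [j [j0 Bj] <-]; apply: jump_time_homo.
  by apply: kmin; rewrite /p j0; apply/asboolP.
move=> i /andP[i0 ik] Bi; have : (k <= i)%N by apply: kmin; rewrite /p i0; apply/asboolP.
by rewrite leqNgt ik.
Qed.

Lemma first_jump_stopping n0 B :
  (forall n t, 0 <= t -> F t (B n `&` [set w | (T_ n w <= t%:E)%E])) ->
  stopping_time X N (first_jump n0 B).
Proof.
move=> FB; split.
  by move=> w; apply/ereal_infP => _ [n _ <-]; exact: jump_time_ge0.
move=> t t0; rewrite (_ : [set w | _] = \bigcup_i
   (if (n0 < i)%N then B i `&` [set w | (T_ i w <= t%:E)%E] else set0)).
  apply: filtrationU => i; case: ifP => _; [exact: FB|exact: filtration0].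
apply/seteqP; split => w /=.
  case: (first_jumpP n0 B w) => [[-> _]//|[n [nn0 Bn -> _]] Tt].
  by exists n => //; rewrite nn0.
move=> [i _]; case: ifP => // i0 [Bi Ti]; apply: le_trans Ti.
by apply: ereal_inf_lbound; exists i.
Qed.

Lemma first_jump_strategy n0 B :
  (forall n t, 0 <= t -> F t (B n `&` [set w | (T_ n w <= t%:E)%E])) ->
  poisson_strategy P X N (first_jump n0 B).
Proof.
move=> FB; split; first exact: first_jump_stopping.
apply: aeW => w; case: (first_jumpP n0 B w) => [[-> _]|[n [nn0 Bn -> _]]]; first by left.
by right; exists n => //; exact: leq_ltn_trans nn0.
Qed.

Lemma first_jump_gt n0 B : {ae P, forall w, (T_ n0 w < first_jump n0 B w)%E}.
Proof.
apply: filterS (ae_regular_path hN hlambda) => w reg.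
case: (first_jumpP n0 B w) => [[-> _]|[n [nn0 _ -> _]]]; first by have [] := reg n0.
by rewrite regular_lt.
Qed.

Lemma first_jump_unstopped n0 B n w : (n0 < n)%N ->
  (T_ n w < first_jump n0 B w)%E -> ~ B n w.
Proof.
move=> nn0 Tn Bn; move: Tn; apply/negP; rewrite -leNgt.
by apply: ereal_inf_lbound; exists n.
Qed.

Lemma first_jump_stopped n0 B n w : regular_path N w ->
  stop_event (first_jump n0 B) n w -> B n.+1 w.
Proof.
move=> reg [_ tauE Tfin].
case: (first_jumpP n0 B w) => [[too _]|[k [_ Bk tk _]]].
  by move: Tfin; rewrite -tauE too ltxx.
have Tkn : T_ k w = T_ n.+1 w by rewrite -tk.
  by rewrite -(regular_inj reg Tkn).
Qed.

Lemma stop_setF (C : set R) s n t : 0 <= t -> measurable C ->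
  F t ([set w | C (s * expR (jump_X n w))] `&` [set w | (T_ n w <= t%:E)%E]).
Proof.
move=> t0 mC.
have [] := @before_jumpI _ _ _ _ _ _ _ hX hN n setT [set x | C (s * expR x.2)]
  (before_jumpT X hN n).
  rewrite -[X in measurable X]setTI.
  have : measurable_fun setT (fun x : R * R => s * expR x.2).
    by apply: measurable_funM => //; apply: measurableT_comp.
  exact.
by rewrite setTI => _ /(_ t t0).
Qed.

Context (g : R -> R) (mg : measurable_fun setT g) (g0 : forall x, 0 <= g x).
Local Notation G := (EFin \o g).
Local Notation payoff s tau := (discounted_payoff X r g s tau).

(** The threshold may depend on the index: with a finite horizon the continuation value depends on
    the number of observations left, while for the full problem it is constant in [n]. *)
Definition stop_below (f : nat -> R -> \bar R) n0 s : Omega -> \bar R :=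
  first_jump n0 (fun n =>
    [set w | (f n (s * expR (jump_X n w))%R <= (g (s * expR (jump_X n w))%R)%:E)%E]).

Lemma measurable_stop_set (f : R -> \bar R) : measurable_fun setT f ->
  measurable [set x | (f x <= (g x)%:E)%E].
Proof.
move=> mf; rewrite -[X in measurable X]setTI; apply: measurable_lee => //.
exact/measurable_EFinP.
Qed.

Lemma stop_below_strategy f n0 s : (forall n, measurable_fun setT (f n)) ->
  poisson_strategy P X N (stop_below f n0 s).
Proof.
move=> mf; apply: first_jump_strategy => n t t0.
exact: (stop_setF s n t0 (measurable_stop_set (mf n))).
Qed.

(** The hypotheses say that [f n] is the payoff where the rule stops and [Q (f n.+1)] where it
    continues, so [one_step] can be iterated [M] times. What has been collected is then bounded by
    the whole expected payoff. *)
Lemma payoff_telescope f n0 s M :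
  (forall n, measurable_fun setT (f n)) -> (forall n x, 0 <= f n x)%E ->
  (forall n x, (n0 < n)%N -> (f n x <= (g x)%:E)%E -> f n x = (g x)%:E) ->
  (forall n x, (n0 < n)%N -> ((g x)%:E < f n x)%E -> f n x = Q (f n.+1) x) ->
  (\int[P]_w discounted (Q (f n0.+1)) s n0 w <=
   'E_P[payoff s (stop_below f n0 s)] +
   \int[P]_(w in [set w | (T_ (n0 + M) w < stop_below f n0 s w)%E])
     discounted (Q (f (n0 + M).+1)) s (n0 + M) w)%E.
Proof.
move=> mf f0 fg fQ; set tau := stop_below f n0 s.
have htau : poisson_strategy P X N tau by exact: stop_below_strategy.
have [stau _] := htau.
have mgt k : measurable [set w | (T_ k w < tau w)%E].
  by have [] := before_jump_gt hX hN k stau.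
have mst k : measurable (stop_event tau k) by exact: (measurable_stop_event hX hN).
have mQ k : measurable_fun setT (Q (f k)) by exact: (measurable_jump_operator hX hN).
have Q0 k x : (0 <= Q (f k) x)%E.
  by apply: integral_ge0 => w _; rewrite mule_ge0// lee_fin expR_ge0.
pose p i := (\int[P]_(w in stop_event tau i) discounted G s i.+1 w)%E.
have p0 i : (0 <= p i)%E.
  by apply: integral_ge0 => w _; apply: discounted_ge0 => x; rewrite lee_fin.
have pE : ('E_P[payoff s tau] = \sum_(i <oo) p i)%E by exact: (payoff_sum hX hN hlambda).
suff H : (\int[P]_w discounted (Q (f n0.+1)) s n0 w <= \sum_(0 <= i < n0 + M) p i +
   \int[P]_(w in [set w | (T_ (n0 + M) w < tau w)%E])
     discounted (Q (f (n0 + M).+1)) s (n0 + M) w)%E.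
  apply: (le_trans H); rewrite leeD2r// pE.
  by apply: nneseries_lim_ge => i _ _; exact: p0.
elim: M => [|M IH].
  (* The rule cannot stop up to index [n0], so the restriction to [T_n0 < tau] is almost surely
     void. *)
  rewrite addn0; set I := (X in (_ <= _ + X)%E).
  have -> : (\int[P]_w discounted (Q (f n0.+1)) s n0 w = I)%E.
    apply: ge0_integral_ae_eq_set => //.
    - exact: (measurable_discounted_jump hX hN).
    - by move=> w; exact: discounted_ge0.
    - by apply: filterS (first_jump_gt n0 _) => w h; split => // _; exact: h.
  by apply: leeDr; apply: sume_ge0 => i _; exact: p0.
apply: (le_trans IH).
rewrite addnS.
rewrite (big_nat_recr _ _ _ (leq0n (n0 + M))).
rewrite -[X in (_ <= X)%E]addeA; apply: leeD2l.
rewrite (one_step hX hN hXN hlambda r (n0 + M) s htau (mf (n0 + M).+1) (f0 (n0 + M).+1)) le_eqVlt.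
have lt0 : (n0 < (n0 + M).+1)%N by rewrite ltnS leq_addr.
apply/orP; left; apply/eqP; congr (_ + _)%E.
- apply: ge0_ae_eq_integral => //.
  + by apply: measurable_funTS; exact: (measurable_discounted_jump hX hN).
  + apply: measurable_funTS; apply: (measurable_discounted_jump hX hN).
    exact/measurable_EFinP.
  + by move=> w _; exact: discounted_ge0.
  + by move=> w _; apply: discounted_ge0 => x; rewrite lee_fin.
  + apply: filterS (ae_regular_path hN hlambda) => w reg st.
    by rewrite /discounted fg//; exact: (first_jump_stopped reg st).
- apply: eq_integral => w; rewrite inE /= => lt_tau.
  rewrite /discounted [in LHS]fQ//.
  by rewrite ltNge; apply/negP; exact: (first_jump_unstopped lt0 lt_tau).
Qed.

End first_jump.

Lemma cvg_maxe_nondecreasing (R : realType) (a l : \bar R) (u : (\bar R)^nat) :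
  u @ \oo --> l -> (forall n, u n <= l)%E ->
  maxe a (u n) @[n --> \oo] --> maxe a l.
Proof.
move=> ul ule; have [la|al] := leP l a.
  under eq_fun => n do rewrite (max_l (le_trans (ule n) la)).
  exact: cvg_cst.
have au : \forall n \near \oo, (a < u n)%E.
  have nl : nbhs l [set x | (a < x)%E].
    by apply: open_nbhs_nbhs; split => //; exact: open_ereal_gt_ereal.
  exact: (ul _ nl).
apply: cvg_trans ul; apply: near_eq_cvg.
by apply: filterS au => n /= an; rewrite max_r// ltW.
Qed.

(** * Value iteration *)

Section value_iteration.
Context (R : realType) d (Omega : measurableType d) (P : probability Omega R)
  (X : R -> Omega -> R) (N : R -> Omega -> nat) (lambda : R)
  (hX : levy_process P X) (hN : poisson_process P lambda N)
  (hXN : independent_processes P X N) (hlambda : 0 < lambda) (r : R)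
  (g : R -> R) (mg : measurable_fun setT g) (g0 : forall x, 0 <= g x).
Implicit Types (n m i l k : nat) (w : Omega) (t s : R) (tau : Omega -> \bar R).

Local Notation T_ := (jump_time N).
Local Notation jump_X := (jump_X X N).
Local Notation Q := (jump_operator P X N r).
Local Notation discounted := (discounted X N r).
Local Notation stop_event := (stop_event N).
Local Notation G := (EFin \o g).
Local Notation payoff s tau := (discounted_payoff X r g s tau).

Let mQ (f : R -> \bar R) : measurable_fun setT f -> (forall x, 0 <= f x)%E ->
  measurable_fun setT (Q f).
Proof. exact: (measurable_jump_operator hX hN). Qed.

Lemma jump_operator_ge0 (f : R -> \bar R) s : (forall x, 0 <= f x)%E -> (0 <= Q f s)%E.
Proof.
by move=> f0; apply: integral_ge0 => w _; rewrite mule_ge0// lee_fin expR_ge0.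
Qed.

Lemma le_jump_operator (f1 f2 : R -> \bar R) s :
  measurable_fun setT f1 -> measurable_fun setT f2 ->
  (forall x, 0 <= f1 x)%E -> (forall x, f1 x <= f2 x)%E -> (Q f1 s <= Q f2 s)%E.
Proof.
move=> mf1 mf2 f10 f12.
have f20 x : (0 <= f2 x)%E by exact: le_trans (f12 x).
apply: ge0_le_integral => //.
- by move=> w _; exact: (@discounted_ge0 _ _ Omega X N r f1 s 1 w f10).
- exact: (measurable_discounted hX hN).
- exact: (measurable_discounted hX hN).
- by move=> w _; rewrite lee_wpmul2l ?lee_fin ?expR_ge0.
Qed.

Lemma discounted_cvg (f : nat -> R -> \bar R) (h : R -> \bar R) s n :
  (forall k, measurable_fun setT (f k)) -> (forall k x, 0 <= f k x)%E ->
  (forall x, {homo f^~ x : i j / (i <= j)%N >-> (i <= j)%E}) ->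
  (forall x, f k x @[k --> \oo] --> h x) ->
  (\int[P]_w discounted (f k) s n w @[k --> \oo] --> \int[P]_w discounted h s n w)%E.
Proof.
move=> mf f0 nf fh.
have -> : (\int[P]_w discounted h s n w =
    \int[P]_w limn (fun k => discounted (f k) s n w))%E.
  apply: eq_integral => w _; apply/esym/cvg_lim => //.
  by apply: cvgeZl => //; exact: fh.
apply: cvg_monotone_convergence => //.
- by move=> k; exact: (measurable_discounted_jump hX hN).
- by move=> k w _; exact: discounted_ge0.
- by move=> w _ i j ij; rewrite lee_wpmul2l ?lee_fin ?expR_ge0//; exact: nf.
Qed.

Lemma integral_discounted0 (f : R -> \bar R) s :
  measurable_fun setT f -> (forall x, 0 <= f x)%E ->
  (\int[P]_w discounted f s 0 w = f s)%E.
Proof.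
move=> mf f0; transitivity (\int[P]_w (cst (f s)) w)%E.
  apply: ge0_ae_eq_integral => //.
  - exact: (measurable_discounted_jump hX hN).
  - by move=> w _; exact: discounted_ge0.
  - by move=> w _; exact: f0.
  - apply: filterS (jump_X0 hX hN) => w X0 _.
    by rewrite /discounted /jump_discount (jump0 hN) X0 mulr0 expR0 mul1e mulr1.
have PT : P setT = 1%E by exact: probability_setT.
by rewrite integral_cst//; transitivity (f s * P setT)%E; rewrite // PT mule1.
Qed.

(* Value with at most [k] further observations when stopping at once is allowed;
   [value] and [value0] below are [V] and [\bar V]. *)
Fixpoint iterate k : R -> \bar R :=
  if k is k'.+1 then fun s => maxe (G s) (Q (iterate k') s) else G.

Lemma iterate_ge k s : (G s <= iterate k s)%E.
Proof. by case: k => //= k; rewrite le_max lexx. Qed.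

Lemma iterate_ge0 k s : (0 <= iterate k s)%E.
Proof. by apply: le_trans (iterate_ge k s); rewrite lee_fin. Qed.

Lemma measurable_iterate k : measurable_fun setT (iterate k).
Proof.
elim: k => [|k IH]; first exact/measurable_EFinP.
apply: measurable_maxe; first exact/measurable_EFinP.
by apply: mQ => // x; exact: iterate_ge0.
Qed.

Lemma iterate_leS k s : (iterate k s <= iterate k.+1 s)%E.
Proof.
elim: k s => [|k IH] s; first exact: (iterate_ge 1).
rewrite /= ge_max le_max lexx/= le_max; apply/orP; right.
by apply: le_jump_operator => //; [exact: measurable_iterate|
  exact: (measurable_iterate k.+1)|exact: iterate_ge0].
Qed.

Lemma iterate_homo s : {homo iterate^~ s : i j / (i <= j)%N >-> (i <= j)%E}.
Proof. by apply: homo_leq => [x|y x z|k]; [exact: lexx|exact: le_trans|exact: iterate_leS]. Qed.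

Lemma Qiterate_homo s : {homo (fun k => Q (iterate k) s) : i j / (i <= j)%N >-> (i <= j)%E}.
Proof.
move=> i j ij; apply: le_jump_operator; [exact: measurable_iterate..| |].
- exact: iterate_ge0.
- by move=> x; exact: iterate_homo.
Qed.

Definition value s : \bar R := limn (fun k => Q (iterate k) s).

Lemma cvg_value s : Q (iterate k) s @[k --> \oo] --> value s.
Proof. by apply: ereal_nondecreasing_is_cvgn => i j ij; exact: Qiterate_homo. Qed.

Lemma Qiterate_le_value k s : (Q (iterate k) s <= value s)%E.
Proof.
apply: lime_ge; first exact: cvg_value.
by near=> j; apply: Qiterate_homo; near: j; exact: nbhs_infty_ge.
Unshelve. all: by end_near. Qed.

Lemma value_ge0 s : (0 <= value s)%E.
Proof.
by apply: le_trans (Qiterate_le_value 0 s); apply: jump_operator_ge0 => x; exact: iterate_ge0.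
Qed.

Lemma measurable_value : measurable_fun setT value.
Proof.
apply: (emeasurable_fun_cvg (fun k => Q (iterate k))).
- by move=> k; apply: mQ; [exact: measurable_iterate|exact: iterate_ge0].
- by move=> x _; exact: cvg_value.
Qed.

Definition value0 s : \bar R := maxe (G s) (value s).

Lemma measurable_value0 : measurable_fun setT value0.
Proof. by apply: measurable_maxe; [exact/measurable_EFinP|exact: measurable_value]. Qed.

Lemma value0_ge0 s : (0 <= value0 s)%E.
Proof. by rewrite le_max value_ge0 orbT. Qed.

Lemma cvg_value0 s : iterate k.+1 s @[k --> \oo] --> value0 s.
Proof.
apply: cvg_maxe_nondecreasing; first exact: cvg_value.
by move=> k; exact: Qiterate_le_value.
Qed.

(** By monotone convergence the operator commutes with the increasing limit; the same sequence, with
    its index shifted, tends to [value]. *)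
Lemma jump_operator_value0 s : Q value0 s = value s.
Proof.
have h : Q (iterate k.+1) s @[k --> \oo] --> Q value0 s.
  apply: (@discounted_cvg (fun k => iterate k.+1) value0 s 1%N).
  - by move=> k; exact: measurable_iterate.
  - by move=> k x; exact: iterate_ge0.
  - by move=> x i j ij; exact: iterate_homo.
  - exact: cvg_value0.
have h' : Q (iterate k.+1) s @[k --> \oo] --> value s.
  by have hs := @cvg_value s; rewrite -cvg_shiftS in hs.
exact: (cvg_unique _ h h').
Qed.

(** Supermartingale property: the payoff collected so far plus the discounted value on the event of
    still running never increases with [n]. *)
Lemma payoff_le_value tau s : poisson_strategy P X N tau ->
  ('E_P[payoff s tau] <= value s)%E.
Proof.
move=> htau; have [stau _] := htau.
have mgt k : measurable [set w | (T_ k w < tau w)%E].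
  by have [] := before_jump_gt hX hN k stau.
have mst k : measurable (stop_event tau k) by exact: (measurable_stop_event hX hN).
have mv := measurable_value; have mv0 := measurable_value0.
pose a n := (\int[P]_(w in [set w | (T_ n w < tau w)%E]) discounted value s n w)%E.
pose p i := (\int[P]_(w in stop_event tau i) discounted G s i.+1 w)%E.
have a_ge0 n : (0 <= a n)%E.
  by apply: integral_ge0 => w _; apply: discounted_ge0 => x; exact: value_ge0.
have p0 i : (0 <= p i)%E.
  by apply: integral_ge0 => w _; apply: discounted_ge0 => x; rewrite lee_fin.
have step n : (p n + a n.+1 <= a n)%E.
  rewrite /a -(_ : Q value0 = value); last by apply/funext => x; exact: jump_operator_value0.
  rewrite (one_step hX hN hXN hlambda r n s htau mv0 value0_ge0).
  apply: leeD; apply: ge0_le_integral => //.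
  - by move=> w _; apply: discounted_ge0 => x; rewrite lee_fin.
  - apply: measurable_funTS; apply: (measurable_discounted_jump hX hN).
    exact/measurable_EFinP.
  - by apply: measurable_funTS; exact: (measurable_discounted_jump hX hN).
  - by move=> w _; rewrite lee_wpmul2l ?lee_fin ?expR_ge0// le_max lexx.
  - by move=> w _; apply: discounted_ge0 => x; apply: jump_operator_ge0; exact: value0_ge0.
  - apply: measurable_funTS; apply: (measurable_discounted_jump hX hN).
    by apply: mQ => //; exact: value0_ge0.
  - by apply: measurable_funTS; exact: (measurable_discounted_jump hX hN).
  - move=> w _; rewrite lee_wpmul2l ?lee_fin ?expR_ge0//.
    by rewrite jump_operator_value0 le_max lexx orbT.
have sum_le M : (\sum_(0 <= i < M) p i + a M <= a 0%N)%E.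
  elim: M => [|M IH]; first by rewrite big_nil add0e.
  rewrite (big_nat_recr _ _ _ (leq0n M)); apply: le_trans IH.
  by rewrite -[X in (X <= _)%E]addeA; apply: leeD2l.
rewrite (payoff_sum hX hN hlambda r s htau mg g0).
have a0 : (a 0%N <= value s)%E.
  rewrite -(integral_discounted0 s mv value_ge0); apply: ge0_subset_integral => //.
  - exact: (measurable_discounted_jump hX hN).
  - by move=> w _; apply: discounted_ge0 => x; exact: value_ge0.
apply: le_trans a0; apply: lime_le; first by apply: is_cvg_nneseries => i _ _; exact: p0.
by apply: nearW => M; apply: le_trans (sum_le M); apply: leeDl.
Qed.

(** Backward induction: [f i] is the value with n + k + 1 - i observations left. At index n + k + 1
    none is left and the rule must stop, so the remainder of the telescoped sum is an integral over
    the empty set. *)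
Lemma iterate_attained k n s : exists tau, [/\ poisson_strategy P X N tau,
  {ae P, forall w, (T_ n w < tau w)%E} &
  (\int[P]_w discounted (Q (iterate k)) s n w <= 'E_P[payoff s tau])%E].
Proof.
pose f i := iterate (n + k.+1 - i).
exists (stop_below X N g f n s); split.
- by apply: (stop_below_strategy hX hN) => // i; exact: measurable_iterate.
- exact: (first_jump_gt hN hlambda).
have := @payoff_telescope _ _ _ _ _ _ _ hX hN hXN hlambda r g mg g0 f n s k.+1.
move=> /(_ _ _ _ _)/le_trans.
rewrite /f (_ : n + k.+1 - n.+1 = k)%N; last by lia.
set I := (X in (_ + X)%E); suff -> : I = 0%E.
  rewrite adde0; apply.
  - by move=> i; exact: measurable_iterate.
  - by move=> i x; exact: iterate_ge0.
  - by move=> i x _ fg; apply/eqP; rewrite eq_le fg iterate_ge.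
  - move=> i x ni; case E : (n + k.+1 - i)%N => [|j]; first by rewrite ltxx.
    rewrite /= lt_max ltxx/= => /ltW/max_r ->.
    by congr (Q (iterate _) x); lia.
  - exact: lexx.
rewrite /I [X in (\int[P]_(_ in X) _)%E](_ : _ = set0) ?integral_set0//.
apply/seteqP; split => // w /= lt_tau.
have lt_n : (n < n + k.+1)%N by rewrite addnS ltnS leq_addr.
apply: (first_jump_unstopped lt_n lt_tau) => /=.
by rewrite subnn.
Qed.

Lemma value_le_poisson_value s : (value s <= poisson_value P X N r g s)%E.
Proof.
apply: lime_le; first exact: cvg_value.
apply: nearW => k; have [tau [stau _ h]] := iterate_attained k 0 s.
apply: (@le_trans _ _ ('E_P[payoff s tau])%E); last first.
  by apply: ereal_sup_ubound; exists tau.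
rewrite -(integral_discounted0 (f := Q (iterate k)))//.
  by apply: mQ; [exact: measurable_iterate|exact: iterate_ge0].
by move=> x; apply: jump_operator_ge0; exact: iterate_ge0.
Qed.

Lemma poisson_valueE s : poisson_value P X N r g s = value s.
Proof.
apply/eqP; rewrite eq_le value_le_poisson_value andbT.
by apply: ge_ereal_sup => _ [tau stau <-]; exact: payoff_le_value.
Qed.

(** The strategies attaining the iterates after [T_n] stop strictly later than [T_n], so the
    indicator in the tail value leaves their payoff unchanged. *)
Lemma discounted_value_le_tail n s :
  (\int[P]_w discounted value s n w <= poisson_tail_value P X N r g s n)%E.
Proof.
have h : (\int[P]_w discounted (Q (iterate k)) s n w @[k --> \oo] -->
          \int[P]_w discounted value s n w)%E.
  apply: discounted_cvg.
  - by move=> k; apply: mQ; [exact: measurable_iterate|exact: iterate_ge0].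
  - by move=> k x; apply: jump_operator_ge0; exact: iterate_ge0.
  - by move=> x; exact: Qiterate_homo.
  - exact: cvg_value.
apply: (cvge_to_le h); apply: nearW => k.
have [tau [stau gt_tau le_tau]] := iterate_attained k n s.
apply: (le_trans le_tau).
apply: (@le_trans _ _ ('E_P[(fun w => payoff s tau w *
    \1_[set w' | (T_ n w' < tau w')%E] w)%R])%E); last first.
  by apply: ereal_sup_ubound; exists tau.
have mpay := measurable_discounted_payoff hX hN r s stau.1 mg.
have mgt : measurable [set w | (T_ n w < tau w)%E].
  by have [] := before_jump_gt hX hN n stau.1.
have pay0 w : 0 <= payoff s tau w.
  by rewrite /discounted_payoff; case: (tau w) => // t; rewrite mulr_ge0 ?expR_ge0.
rewrite unlock le_eqVlt; apply/orP; left; apply/eqP.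
apply: ge0_ae_eq_integral => //.
- exact/measurable_EFinP.
- by apply/measurable_EFinP; apply: measurable_funM => //; exact: measurable_indic.
- by move=> w _; rewrite lee_fin.
- by move=> w _; rewrite lee_fin mulr_ge0.
- by apply: filterS gt_tau => w gw _; rewrite indicE mem_set ?mulr1.
Qed.

(* The stopping rule "first observation at which exercising is at least as good
   as continuing" loses nothing before the n-th observation, and the rest is
   controlled by the tail. *)
Lemma optimal_stopping s :
  poisson_tail_value P X N r g s n @[n --> \oo] --> 0%E ->
  poisson_value P X N r g s =
  'E_P[payoff s (stop_below X N g (fun=> value0) 0 s)]%E.
Proof.
move=> tail0; rewrite poisson_valueE; set tau := stop_below _ _ _ _ _ _.
have htau : poisson_strategy P X N tau.
  by apply: (stop_below_strategy hX hN) => // _; exact: measurable_value0.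
apply/eqP; rewrite eq_le payoff_le_value// andbT.
have mv := measurable_value.
have le_n n : (value s <= 'E_P[payoff s tau] + poisson_tail_value P X N r g s n)%E.
  have := @payoff_telescope _ _ _ _ _ _ _ hX hN hXN hlambda r g mg g0 (fun=> value0) 0 s n.
  rewrite -/tau add0n (_ : Q value0 = value); last first.
    by apply/funext => x; exact: jump_operator_value0.
  rewrite (integral_discounted0 s mv value_ge0) => h.
  apply: le_trans (h _ _ _ _) _ => {h}.
  - by move=> _; exact: measurable_value0.
  - by move=> _; exact: value0_ge0.
  - by move=> _ x _ h; apply/eqP; rewrite eq_le h le_max lexx.
  - by move=> _ x _; rewrite /value0 lt_max ltxx/= => /ltW/max_r.
  - apply: leeD2l; apply: le_trans (discounted_value_le_tail n s).
    have [mgt _] := before_jump_gt hX hN n htau.1.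
    apply: ge0_subset_integral => //.
    + exact: (measurable_discounted_jump hX hN).
    + by move=> w _; apply: discounted_ge0 => x; exact: value_ge0.
(* The limit 0 of the tail is finite, so the sum makes sense even if the expected payoff is
   infinite. *)
have h : ('E_P[payoff s tau] + poisson_tail_value P X N r g s n @[n --> \oo] -->
    'E_P[payoff s tau] + 0)%E.
  apply: cvgeD => //; last exact: cvg_cst.
  by rewrite fin_num_adde_defl.
rewrite adde0 in h; apply: (cvge_to_ge h); exact: nearW.
Qed.

End value_iteration.

(** * Convexity and lower semicontinuity *)

Section ereal_functions.
Context {R : realType}.
Local Open Scope ereal_scope.

Lemma le_limn_einf (u v : (\bar R)^nat) : (forall n, u n <= v n) ->
  limn_einf u <= limn_einf v.
Proof.
move=> uv; rewrite !limn_einf_lim; apply: lee_lim; [exact: is_cvg_einfs..|].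
apply: nearW => n; apply: le_ereal_inf_tmp => _ [m /= nm <-].
by apply: le_trans (uv m); apply: ereal_inf_lbound; exists m.
Qed.

Lemma limn_einf_scale (c : R) (u : (\bar R)^nat) : (0 <= c)%R ->
  c%:E * limn_einf u <= limn_einf (fun n => c%:E * u n).
Proof.
move=> c0; rewrite !limn_einf_lim.
have h : c%:E * einfs u n @[n --> \oo] --> c%:E * limn (einfs u).
  by apply: cvgeZl => //; exact: is_cvg_einfs.
rewrite -(cvg_lim _ h)//; apply: lee_lim; [by apply/cvg_ex; eexists; exact: h|
  exact: is_cvg_einfs|].
apply: nearW => n; apply: le_ereal_inf_tmp => _ [m /= nm <-].
by rewrite lee_wpmul2l ?lee_fin//; apply: ereal_inf_lbound; exists m.
Qed.

Definition convex_ereal (f : R -> \bar R) := forall (t a b : R), (0 <= t <= 1)%R ->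
  f (t * a + (1 - t) * b)%R <= t%:E * f a + (1 - t)%:E * f b.

(** The sequential form is what Fatou's lemma gives and what limits of points of the stopping region
    need. *)
Definition seq_lsc (f : R -> \bar R) := forall (u : R^nat) (x : R),
  u @ \oo --> x -> f x <= limn_einf (f \o u).

Lemma convex_maxe f h : convex_ereal f -> convex_ereal h ->
  (forall x, 0 <= f x) -> (forall x, 0 <= h x) ->
  convex_ereal (fun x => maxe (f x) (h x)).
Proof.
move=> cf ch f0 h0 t a b t01; have /andP[t0 t1] := t01.
have t1' : (0 <= 1 - t)%R by rewrite subr_ge0.
rewrite ge_max; apply/andP; split.
  apply: (le_trans (cf t a b t01)).
  by apply: leeD; rewrite lee_wpmul2l ?lee_fin// le_max lexx.
apply: (le_trans (ch t a b t01)).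
by apply: leeD; rewrite lee_wpmul2l ?lee_fin// le_max lexx orbT.
Qed.

Lemma seq_lsc_maxe f h : seq_lsc f -> seq_lsc h ->
  seq_lsc (fun x => maxe (f x) (h x)).
Proof.
move=> lf lh u x ux; rewrite ge_max; apply/andP; split.
  by apply: (le_trans (lf u x ux)); apply: le_limn_einf => n /=; rewrite le_max lexx.
by apply: (le_trans (lh u x ux)); apply: le_limn_einf => n /=; rewrite le_max lexx orbT.
Qed.

Lemma seq_lsc_continuous (g : R -> R) : continuous g -> seq_lsc (EFin \o g).
Proof.
move=> cg u x ux.
have h : (EFin \o g \o u) n @[n --> \oo] --> (g x)%:E.
  apply: cvg_EFin; first exact: nearW.
  by apply: continuous_cvg => //; exact: cg.
by rewrite (cvg_limn_einf_sup h).1.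
Qed.

End ereal_functions.

Section value_regularity.
Context (R : realType) d (Omega : measurableType d) (P : probability Omega R)
  (X : R -> Omega -> R) (N : R -> Omega -> nat) (lambda : R)
  (hX : levy_process P X) (hN : poisson_process P lambda N)
  (hXN : independent_processes P X N) (hlambda : 0 < lambda) (r : R)
  (g : R -> R) (mg : measurable_fun setT g) (g0 : forall x, 0 <= g x).
Implicit Types (n m i l k : nat) (w : Omega) (t s : R) (tau : Omega -> \bar R).

Local Notation T_ := (jump_time N).
Local Notation Q := (jump_operator P X N r).
Local Notation G := (EFin \o g).
Local Notation iterate := (iterate P X N r g).
Local Notation value := (value P X N r g).

(** On each path the price is linear in its starting value, so convexity holds under the
    integral. *)
Lemma jump_operator_convex (f : R -> \bar R) : measurable_fun setT f ->
  (forall x, 0 <= f x)%E -> convex_ereal f -> convex_ereal (Q f).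
Proof.
move=> mf f0 cf t a b t01; have /andP[t0 t1] := t01.
have t1' : (0 <= 1 - t)%R by rewrite subr_ge0.
have md s := measurable_discounted hX hN r 1 s mf.
have d0 s w : (0 <= (jump_discount N r 1 w)%:E * f (s * expR (jump_X X N 1 w))%R)%E.
  by rewrite mule_ge0// lee_fin expR_ge0.
rewrite /jump_operator -!ge0_integralZl//.
rewrite -ge0_integralD//.
- apply: ge0_le_integral => //.
  * by apply: emeasurable_funD; apply: emeasurable_funM => //.
  * move=> w _; rewrite !(muleCA _ (jump_discount _ _ _ _)%:E) -ge0_muleDr.
    rewrite lee_wpmul2l ?lee_fin ?expR_ge0//.
    + by rewrite mulrDl -!mulrA; exact: cf.
    + by rewrite mule_ge0// lee_fin.
    + by rewrite mule_ge0// lee_fin.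
- by move=> w _; rewrite mule_ge0// lee_fin.
- exact: emeasurable_funM.
- by move=> w _; rewrite mule_ge0// lee_fin.
- exact: emeasurable_funM.
Qed.

Lemma jump_operator_lsc (f : R -> \bar R) : measurable_fun setT f ->
  (forall x, 0 <= f x)%E -> seq_lsc f -> seq_lsc (Q f).
Proof.
move=> mf f0 lf u x ux.
have md s := measurable_discounted hX hN r 1 s mf.
have d0 s w : (0 <= (jump_discount N r 1 w)%:E * f (s * expR (jump_X X N 1 w))%R)%E.
  by rewrite mule_ge0// lee_fin expR_ge0.
pose h n w := ((jump_discount N r 1 w)%:E * f (u n * expR (jump_X X N 1 w))%R)%E.
apply: (@le_trans _ _ (\int[P]_w limn_einf (h^~ w))%E); last first.
  by apply: (fatou P measurableT (f := h)) => n w; [exact: md|move=> _; exact: d0].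
apply: ge0_le_integral => //.
(* A lower limit is minus the upper limit of the negated sequence, whose measurability is known. *)
- apply: (measurableT_comp (f := -%E)) => //.
  apply: measurable_fun_limn_esup => n.
  by apply: (measurableT_comp (f := -%E)) => //; exact: md.
- move=> w _; apply: le_trans (limn_einf_scale _ (expR_ge0 _)).
  rewrite lee_wpmul2l ?lee_fin ?expR_ge0//.
  apply: (lf (fun n => u n * expR (jump_X X N 1 w))).
  by apply: cvgM => //; exact: cvg_cst.
Qed.

Lemma value_convex : convex_ereal G -> convex_ereal value.
Proof.
move=> cg.
have ci k : convex_ereal (iterate k).
  elim: k => // k IH; apply: convex_maxe => //.
  - apply: jump_operator_convex => //; [exact: (measurable_iterate hX hN)|exact: iterate_ge0].
  - by move=> x; apply: jump_operator_ge0; exact: iterate_ge0.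
move=> t a b t01; have /andP[t0 t1] := t01.
have t1' : (0 <= 1 - t)%R by rewrite subr_ge0.
apply: lime_le; first exact: (cvg_value hX hN mg g0).
apply: nearW => k; apply: (@le_trans _ _ (t%:E * Q (iterate k) a + (1 - t)%:E * Q (iterate k) b)%E).
  apply: jump_operator_convex => //; [exact: (measurable_iterate hX hN)|exact: iterate_ge0].
by apply: leeD; rewrite lee_wpmul2l ?lee_fin//; exact: (Qiterate_le_value hX hN).
Qed.

(** An increasing limit of lower semicontinuous functions is lower semicontinuous. *)
Lemma value_lsc : continuous g -> seq_lsc value.
Proof.
move=> cg; have lg := seq_lsc_continuous cg.
have lQ k : seq_lsc (Q (iterate k)).
  elim: k => [|k IH]; apply: jump_operator_lsc => //.
  - exact/measurable_EFinP.
  - exact: (measurable_iterate hX hN r mg g0 k.+1).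
  - exact: (iterate_ge0 P X N r g0 k.+1).
  - exact: seq_lsc_maxe.
move=> u x ux; apply: lime_le; first exact: (cvg_value hX hN mg g0).
apply: nearW => k; apply: (le_trans (lQ k u x ux)).
by apply: le_limn_einf => n; exact: (Qiterate_le_value hX hN).
Qed.

Lemma stop_region_closed (u : R^nat) x : continuous g ->
  (forall n, (value (u n) <= (g (u n))%:E)%E) -> u @ \oo --> x ->
  (value x <= (g x)%:E)%E.
Proof.
move=> cg ug ux; apply: (le_trans (value_lsc cg ux)).
have h : (g (u n))%:E @[n --> \oo] --> (g x)%:E.
  apply: cvg_EFin; first exact: nearW.
  by apply: continuous_cvg => //; exact: cg.
by rewrite -(cvg_limn_einf_sup h).1; exact: le_limn_einf.
Qed.

End value_regularity.

(** * The stopping region *)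

Section zero_value.
Context (R : realType) d (Omega : measurableType d) (P : probability Omega R)
  (X : R -> Omega -> R) (N : R -> Omega -> nat) (lambda : R)
  (hX : levy_process P X) (hN : poisson_process P lambda N)
  (hXN : independent_processes P X N) (hlambda : 0 < lambda) (r : R)
  (g : R -> R) (mg : measurable_fun setT g) (g0 : forall x, 0 <= g x)
  (cg : continuous g).
Implicit Types (n m i j l k : nat) (w : Omega) (t s : R).

Local Notation T_ := (jump_time N).
Local Notation jump := (jump N).
Local Notation gpoint := (@gpoint R).
Local Notation value := (value P X N r g).

Lemma cvg_price s w t (u : R^nat) : 0 <= t -> (forall n, t <= u n) ->
  u @ \oo --> t -> g (price X s (u n) w) @[n --> \oo] --> g (price X s t w).
Proof.
move=> t0 tu ut; apply: continuous_cvg; first exact: cg.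
apply: cvgM; first exact: cvg_cst.
apply: continuous_cvg; first exact: continuous_expR.
apply: (@cvg_right_seq _ (X ^~ w)) => //.
by have [+ _] := levy_cadlag hX w; exact.
Qed.

(** Always stopping at the first jump earns at most [value s], so a nonnegative integrand has
    integral 0. *)
Lemma value0_at_jump s : (value s <= 0)%E ->
  {ae P, forall w, g (price X s (jump 1 w) w) = 0}.
Proof.
move=> v0.
pose f w := discounted X N r (EFin \o g) s 1 w.
have mf : measurable_fun setT f.
  by apply: (measurable_discounted_jump hX hN); exact/measurable_EFinP.
have f0 w : (0 <= f w)%E by apply: discounted_ge0 => x; rewrite lee_fin.
have : (\int[P]_(w in setT) `|f w| = 0)%E.
  under eq_integral => w _ do rewrite gee0_abs ?f0//.
  apply/eqP; rewrite eq_le integral_ge0// andbT.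
  apply: le_trans v0; have := Qiterate_le_value hX hN r mg g0 0 s; exact.
move=> /(ae_eq_integral_abs P measurableT mf); apply: filterS => w /(_ Logic.I).
rewrite /f /discounted /= => /eqP.
rewrite -EFinM eqe mulf_eq0 => /orP[|/eqP//].
by rewrite gt_eqF// expR_gt0.
Qed.

(** Only grid points, of all meshes, are tested: the intersection is countable, hence measurable,
    and right-continuity extends the bound to all times of the window. *)
Definition price_window s k i m : set Omega := \bigcap_k' \bigcap_j
  (if (gpoint k i <= gpoint k' j <= gpoint k i.+1)
   then [set w | m.+1%:R^-1 <= g (price X s (gpoint k' j) w)] else setT).

Section window.
Context (s : R) (hs : {ae P, forall w, g (price X s (jump 1 w) w) = 0})
  (k i m : nat).

Let p : R := gpoint k i.
Let q : R := gpoint k i.+1.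

Let H := price_window s k i m.

Let window_ge w t : H w -> p <= t <= q -> m.+1%:R^-1 <= g (price X s t w).
Proof.
move=> Hw /andP[pt tq].
have t0 : 0 <= t by apply: le_trans pt; exact: gpoint_ge0.
have Hg k' j : p <= gpoint k' j <= q -> m.+1%:R^-1 <= g (price X s (gpoint k' j) w).
  by move=> pq; have := Hw k' Logic.I j Logic.I; rewrite pq.
(* The right end [q] has no later grid point in the window, but is one itself. *)
move: tq; rewrite le_eqVlt => /predU1P[->|tq].
  by apply: Hg; rewrite lexx andbT /p /q le_gpoint leqnSn.
have h := @cvg_price s w t (fun n => grid n t) t0 (fun n => le_grid n t0) (cvg_grid t0).
apply: (cvgr_to_ge h).
have : \forall n \near \oo, grid n t < q by apply: (cvgr_lt _ (cvg_grid t0)).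
apply: filterS => n nq; apply: (Hg n (grid_index n t)).
by rewrite (le_trans pt (le_grid n t0)) ltW.
Qed.

Let sH : sigma_of `[0, +oo[ X H.
Proof.
pose TX := g_sigma_algebraType (\bigcup_(u in `[0, +oo[%classic)
  preimage_set_system setT (X u) measurable).
apply: (@bigcapT_measurable _ TX) => k'; apply: (@bigcapT_measurable _ TX) => j.
case: ifP => _; last exact: (@measurableT _ TX).
have mX : measurable_fun setT (X (gpoint k' j) : TX -> R).
  move=> _ C mC; apply: sub_sigma_algebra; exists (gpoint k' j) => /=.
    by rewrite in_itv/= gpoint_ge0.
  by exists C.
have mp : measurable_fun setT ((fun w => g (price X s (gpoint k' j) w)) : TX -> R).
  apply: measurableT_comp => //; apply: measurable_funM => //.
  exact: measurableT_comp.
have := mp measurableT _ (measurable_itv `[m.+1%:R^-1, +oo[).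
rewrite setTI; congr (measurable _); apply/seteqP; split => w /=;
  by rewrite in_itv/= andbT.
Qed.

Let J t : set Omega := [set w | (N t w - N 0 w)%N = 0%N].

Let sJ t : 0 <= t -> sigma_of `[0, +oo[ N (J t).
Proof.
move=> t0.
pose TN := g_sigma_algebraType (\bigcup_(u in `[0, +oo[%classic)
  preimage_set_system setT (N u) measurable).
have mTN u (A : set nat) : 0 <= u -> @measurable _ TN [set w | A (N u w)].
  move=> u0; apply: sub_sigma_algebra; exists u => /=; first by rewrite in_itv/= u0.
  by exists A => //; rewrite setTI.
rewrite (_ : J t = \bigcup_l ([set w | N 0 w = l] `&` [set w | (N t w - l)%N = 0%N])).
  apply: (@bigcupT_measurable _ TN) => l; apply: (@measurableI _ TN).
    exact: (@mTN _ (eq^~ l)).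
  exact: (@mTN _ (fun e => (e - l)%N = 0%N)).
apply/seteqP; split => w; first by move=> Hw; exists (N 0 w).
by move=> [l _ [/= <-]].
Qed.

(** The window event depends on [X] only and is independent of the first jump falling in []p, q]],
    which has positive probability. Together they contradict the zero payoff at that jump. *)
Lemma window_negligible : P.-negligible (price_window s k i m).
Proof.
have p0 : 0 <= p by exact: gpoint_ge0.
have q0 : 0 <= q by exact: gpoint_ge0.
have pq : p < q by rewrite /p /q ltr_pM2r ?invr_gt0// ltr_nat.
have mH : measurable H.
  have : sigma_of `[0, +oo[ X `<=` measurable.
    apply: sigma_of_measurable => t /=; rewrite in_itv/= andbT.
    exact: (levy_measurable hX).
  by apply; exact: sH.
have mJ t : 0 <= t -> measurable (J t).
  by move=> t0; exact: (@measurable_incr _ _ _ _ _ _ hN (eq^~ 0%N) 0 t).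
have sJJ : sigma_of `[0, +oo[ N (J p `\` J q).
  apply: (@measurableD _ (g_sigma_algebraType (\bigcup_(u in `[0, +oo[%classic)
    preimage_set_system setT (N u) measurable))); exact: sJ.
have PJ t : 0 <= t -> P (J t) = (expR (- (lambda * t)))%:E.
  by move=> t0; rewrite (poisson_incr0 hN)// subr0.
have Jqp : J q `<=` J p.
  move=> w; rewrite /J /= => /eqP; rewrite subn_eq0 => h.
  apply/eqP; rewrite subn_eq0; apply: leq_trans h.
  by apply: (poisson_nondecreasing hN) => //; exact: ltW.
have PJJ : P (J p `\` J q) = (expR (- (lambda * p)) - expR (- (lambda * q)))%:E.
  have -> : P (J p `\` J q) = (P (J p) - P (J q))%E.
    rewrite measureD//; [|exact: mJ|exact: mJ|]; last first.
      by apply: le_lt_trans (ltry 1); apply: (probability_le1 P); exact: mJ.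
    by rewrite (setIidr Jqp).
  by rewrite !PJ.
have HJ0 : P (H `&` (J p `\` J q)) = 0%E.
  apply: measure_negligible.
    by apply: measurableI => //; apply: measurableD; exact: mJ.
  apply: negligibleS (_ : P.-negligible (~` [set w | [/\ N 0 w = 0%N,
    (T_ 1 w < +oo)%E & g (price X s (jump 1 w) w) = 0]])); last first.
    have h1 := poisson_start hN; have h2 := jump_time_finite hN hlambda 1.
    by apply: filterS3 h1 h2 hs => w ? ? ?; split.
  move=> w [Hw [Jp Jq]] [N0 T1 gw]; move: Jp Jq; rewrite /J /= N0 !subn0 => Jp Jq.
  have /(window_ge Hw) : p <= jump 1 w <= q.
    rewrite -!lee_fin jumpE// (jump_time_le hN)// lt0n; apply/andP; split; last first.
      by apply/eqP.
    by rewrite ltW// ltNge (jump_time_le hN)// Jp.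
  by rewrite gw leNgt invr_gt0 ltr0Sn.
exists H; split => //.
have : (P H * P (J p `\` J q) = 0)%E by rewrite -hXN.
rewrite PJJ => /eqP; rewrite mule_eq0 => /orP[/eqP//|].
by rewrite eqe subr_eq0 gt_eqF// ltr_expR ltrN2 ltr_pM2l.
Qed.

End window.
End zero_value.

Lemma inf_sequence (R : realType) (E : set R) : has_inf E ->
  exists2 u : R^nat, (forall n, E (u n)) & u @ \oo --> inf E.
Proof.
move=> hE.
have h n : exists e, E e /\ e < inf E + n.+1%:R^-1.
  by have [|e Ee lte] := @inf_adherent R E (n.+1%:R^-1) _ hE; [rewrite invr_gt0|exists e].
have [u hu] := choice h; exists u; first by move=> n; case: (hu n).
apply: (@squeeze_cvgr _ _ _ _ (cst (inf E)) (fun n => inf E + n.+1%:R^-1)).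
- apply: nearW => n; case: (hu n) => Eu ltu; rewrite (ltW ltu) andbT.
  by apply: ge_inf => //; case: hE.
- exact: cvg_cst.
- by rewrite -[X in _ --> X]addr0; apply: cvgD; [exact: cvg_cst|exact: cvg_harmonic].
Qed.

Lemma sup_sequence (R : realType) (E : set R) : has_sup E ->
  exists2 u : R^nat, (forall n, E (u n)) & u @ \oo --> sup E.
Proof.
move=> hE.
have h n : exists e, E e /\ sup E - n.+1%:R^-1 < e.
  by have [|e Ee lte] := @sup_adherent R E (n.+1%:R^-1) _ hE; [rewrite invr_gt0|exists e].
have [u hu] := choice h; exists u; first by move=> n; case: (hu n).
apply: (@squeeze_cvgr _ _ _ _ (fun n => sup E - n.+1%:R^-1) (cst (sup E))).
- apply: nearW => n; case: (hu n) => Eu ltu; rewrite (ltW ltu)/=.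
  by apply: ub_le_sup => //; case: hE.
- by rewrite -[X in _ --> X]subr0; apply: cvgB; [exact: cvg_cst|exact: cvg_harmonic].
- exact: cvg_cst.
Qed.

Section stopping_region.
Context (R : realType) d (Omega : measurableType d) (P : probability Omega R)
  (X : R -> Omega -> R) (N : R -> Omega -> nat) (lambda : R)
  (hX : levy_process P X) (hN : poisson_process P lambda N)
  (hXN : independent_processes P X N) (hlambda : 0 < lambda) (r : R)
  (g : R -> R) (mg : measurable_fun setT g) (g0 : forall x, 0 <= g x)
  (cg : continuous g).
Implicit Types (n m i j l k : nat) (w : Omega) (t s : R).

Local Notation T_ := (jump_time N).
Local Notation gpoint := (@gpoint R).
Local Notation value := (value P X N r g).
Local Notation value0 := (value0 P X N r g).
Local Notation D := (classical_stopping_region P X N r g).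

Lemma classical_value_ge0 s : (0 <= classical_value P X N r g s)%E.
Proof.
apply: (@le_trans _ _ ('E_P[discounted_payoff X r g s (T_ 0)])%E).
  apply: expectation_ge0 => w; rewrite /discounted_payoff.
  by case: (T_ 0 w) => // t; rewrite mulr_ge0 ?expR_ge0.
by apply: ereal_sup_ubound; exists (T_ 0) => //; exact: (jump_stopping X hN 0).
Qed.

(* If observing only at the jump times earns nothing, the payoff vanishes along
   the whole path: a visit to [g > 0] lasts, by right continuity, over a time
   window that the first jump hits with positive probability. *)
Lemma classical_value_eq0 s : (value s <= 0)%E ->
  classical_value P X N r g s = 0%E.
Proof.
move=> v0; have hs := value0_at_jump hX hN mg g0 v0.
have price0 : {ae P, forall w, forall t, 0 <= t -> g (price X s t w) = 0}.
  apply: (@negligibleS _ _ _ _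
    (\bigcup_k \bigcup_i \bigcup_m price_window X g s k i m)); last first.
    apply: negligible_bigcup => k; apply: negligible_bigcup => i.
    apply: negligible_bigcup => m.
    exact: (window_negligible hX hN hXN hlambda mg cg hs).
  move=> w /= /existsNP[t /not_implyP[t0 /eqP gt]].
  have {}gt : 0 < g (price X s t w) by rewrite lt_neqAle eq_sym gt g0.
  have [m gm] : exists m, m.+1%:R^-1 < g (price X s t w).
    exists (Num.bound (g (price X s t w))^-1).
    rewrite invf_plt ?posrE//; apply: lt_trans (archi_boundP _) _.
      by rewrite invr_ge0 ltW.
    by rewrite ltr_nat.
  have hrc : g (price X s u w) @[u --> t^'+] --> g (price X s t w).
    apply: continuous_cvg; first exact: cg.
    apply: cvgM; first exact: cvg_cst.
    apply: continuous_cvg; first exact: continuous_expR.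
    by have [+ _] := levy_cadlag hX w; exact.
  have /(cvgr_gt _ hrc)[e /= e0 eP] := gm.
  (* The window starts one cell after the rounded time, hence strictly after [t] where the right
     limit applies, and ends one cell further, before t + 3 / (k + 1). *)
  have [k ke] : exists k, 3 / k.+1%:R < e.
    exists (Num.bound (3 / e)).
    rewrite ltr_pdivrMr// mulrC -ltr_pdivrMr//.
    apply: lt_trans (archi_boundP _) _; first by rewrite divr_ge0// ltW.
    by rewrite ltr_nat.
  exists k => //; exists (grid_index k t).+1 => //; exists m => //.
  move=> k' _ j _; case: ifP => // /andP[lo hi] /=; apply/ltW/eP.
    have t_lt : t < gpoint k' j.
      apply: lt_le_trans lo; apply: (le_lt_trans (le_grid k t0)).
      by rewrite /gpoint ltr_pM2r ?invr_gt0// ltr_nat.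
    rewrite /ball /= ltr0_norm ?subr_lt0// opprB ltrBlDl.
    apply: (le_lt_trans hi); apply: lt_trans (_ : t + 3 / k.+1%:R < _); last first.
      by rewrite ltrD2l.
    have := grid_lt k t0; rewrite /gpoint /grid -addn2 natrD mulrDl => h.
    by rewrite (_ : 3 = 1 + 2) ?mulrDl ?mul1r ?addrA ?ltrD2r//; ring.
  apply: lt_le_trans lo; apply: (le_lt_trans (le_grid k t0)).
  by rewrite /gpoint ltr_pM2r ?invr_gt0// ltr_nat.
apply/eqP; rewrite eq_le classical_value_ge0 andbT.
apply: ge_ereal_sup => _ [tau stau <-].
have mpay := measurable_discounted_payoff hX hN r s stau mg.
rewrite unlock le_eqVlt; apply/orP; left; apply/eqP.
rewrite -(integral0 P setT); apply: ge0_ae_eq_integral => //.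
- exact/measurable_EFinP.
- move=> w _; rewrite lee_fin /discounted_payoff.
  by case: (tau w) => // t; rewrite mulr_ge0 ?expR_ge0.
- apply: filterS price0 => w gw _; rewrite /discounted_payoff.
  have [tau0 _] := stau.
  case: (tau w) (tau0 w) => // t; rewrite lee_fin => t0.
  by rewrite gw// mulr0.
Qed.

Definition poisson_region : set R := [set s | 0 < s /\ (value s <= (g s)%:E)%E].
Local Notation A := poisson_region.

Lemma classical_region_sub : D `<=` A.
Proof.
move=> s [s0 Vs]; split => //; rewrite -(poisson_valueE hX hN hXN hlambda r mg g0) -Vs.
by apply: ge_ereal_sup => _ [tau [stau _] <-]; apply: ereal_sup_ubound; exists tau.
Qed.

Lemma poisson_region_gt0 s :
  (D !=set0 -> forall x, closure D x -> 0 < g x) -> A s -> 0 < g s.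
Proof.
move=> hD [s0 vs]; rewrite lt_neqAle g0 andbT eq_sym; apply/eqP => gs.
have Ds : D s.
  by rewrite gs in vs; split => //; rewrite gs classical_value_eq0.
have : 0 < g s by apply: hD; [exists s|exact: subset_closure].
by rewrite gs ltxx.
Qed.

Lemma poisson_region_closed (u : R^nat) x : (forall n, A (u n)) -> u @ \oo --> x ->
  (value x <= (g x)%:E)%E.
Proof.
by move=> uA ux; apply: (stop_region_closed hX hN mg g0 cg _ ux) => n; case: (uA n).
Qed.

Lemma poisson_region_interval a b x : convex_ereal (EFin \o g) ->
  (forall t, 0 <= t <= 1 -> g (t * a + (1 - t) * b) = t * g a + (1 - t) * g b) ->
  A a -> A b -> a <= x <= b -> A x.
Proof.
move=> cvx aff [a0 va] [b0 vb] /andP[ax xb].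
have x0 : 0 < x by exact: lt_le_trans ax.
(* The point [x = b] is set apart because the weight [t] divides by [b - a]. *)
split => //; have := xb; rewrite le_eqVlt => /predU1P[->//|xltb].
have ab : 0 < b - a by rewrite subr_gt0 (le_lt_trans ax).
pose t := (b - x) / (b - a).
have t01 : 0 <= t <= 1.
  apply/andP; split; first by rewrite divr_ge0 ?(ltW ab)// subr_ge0.
  by rewrite ler_pdivrMr// mul1r lerD2l lerN2.
have /andP[t0 t1] := t01; have t1' : 0 <= 1 - t by rewrite subr_ge0.
have xE : x = t * a + (1 - t) * b.
  by rewrite /t; field; rewrite gt_eqF.
rewrite xE aff// EFinD (EFinM t) (EFinM (1 - t)).
apply: (le_trans (value_convex hX hN r mg g0 cvx a b t01)).
by apply: leeD; rewrite lee_wpmul2l ?lee_fin.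
Qed.

Lemma hit_time_stop_below (L : R) (U : \bar R) s : 0 < s ->
  (forall x, 0 < x -> A x <-> (L%:E <= x%:E <= U)%E) ->
  hit_time X N L U s = stop_below X N g (fun=> value0) 0 s.
Proof.
move=> s0 hA; apply/funext => w; rewrite /hit_time /stop_below /first_jump.
have h t : (value0 (price X s t w) <= (g (price X s t w))%:E)%E <->
    (L%:E <= (price X s t w)%:E <= U)%E.
  have p0 : 0 < price X s t w by rewrite mulr_gt0 ?expR_gt0.
  rewrite -(hA _ p0) /value0 ge_max lexx /=; split=> [v|[]//].
  by split.
apply/eqP; rewrite eq_le; apply/andP; split.
- apply/ereal_infP => _ [n [n0 /= vn] <-].
  (* [hit_time] ranges over finite times only; infinite jump times do not change the infimum. *)
  have [Tn|] := ltP (T_ n w) +oo%E; last by rewrite leye_eq => /eqP ->; exact: leey.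
  apply: ereal_inf_lbound; exists (jump N n w); last exact: jumpE.
  split; first by exists n => //; rewrite jumpE.
  exact/h.
- apply/ereal_infP => _ [t [[n n0 Tn] Lt] <-].
  apply: ereal_inf_lbound; exists n => //; split => //=.
  rewrite /jump_X /jump Tn /=; exact/h.
Qed.

(** If the region were empty, the optimal rule would never stop and earn 0; the value would then be
    at most the payoff, so [s] would lie in the region. *)
Lemma poisson_region_nonempty s : 0 < s ->
  poisson_tail_value P X N r g s n @[n --> \oo] --> 0%E -> A !=set0.
Proof.
move=> s0 tail0; apply: contrapT => nA.
have A0 x : ~ A x by move=> Ax; apply: nA; exists x.
apply: (A0 s); split => //; rewrite -(poisson_valueE hX hN hXN hlambda r mg g0).
rewrite (optimal_stopping hX hN hXN hlambda mg g0 tail0).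
rewrite (_ : discounted_payoff _ _ _ _ _ = cst 0); first by rewrite expectation_cst lee_fin.
apply/funext => w; rewrite /discounted_payoff /stop_below.
set B := (X in first_jump _ _ X).
case: (first_jumpP N 0 B w) => [[-> _]//|[n [_ vn _ _]]]; exfalso.
apply: (A0 (s * expR (jump_X X N n w))).
split; first by rewrite mulr_gt0 ?expR_gt0.
by apply: le_trans vn; rewrite le_max lexx orbT.
Qed.

End stopping_region.

(** * The put and call payoffs *)

Section payoffs.
Context (R : realType) (K : R).

Lemma continuous_put_payoff : continuous (put_payoff K).
Proof.
move=> x; apply: (@continuous_max _ _ (fun s : R => K - s) (cst 0)); last exact: cst_continuous.
by apply: cvgB; [exact: cvg_cst|exact: cvg_id].
Qed.

Lemma continuous_call_payoff : continuous (call_payoff K).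
Proof.
move=> x; apply: (@continuous_max _ _ (fun s : R => s - K) (cst 0)); last exact: cst_continuous.
by apply: cvgB; [exact: cvg_id|exact: cvg_cst].
Qed.

Lemma put_payoff_ge0 x : 0 <= put_payoff K x.
Proof. by rewrite le_max lexx orbT. Qed.

Lemma call_payoff_ge0 x : 0 <= call_payoff K x.
Proof. by rewrite le_max lexx orbT. Qed.

Lemma put_payoff_gt0 x : (0 < put_payoff K x) = (x < K).
Proof. by rewrite lt_max ltxx orbF subr_gt0. Qed.

Lemma call_payoff_gt0 x : (0 < call_payoff K x) = (K < x).
Proof. by rewrite lt_max ltxx orbF subr_gt0. Qed.

Lemma put_payoffE x : x <= K -> put_payoff K x = K - x.
Proof. by move=> xK; rewrite /put_payoff max_l// subr_ge0. Qed.

Lemma call_payoffE x : K <= x -> call_payoff K x = x - K.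
Proof. by move=> xK; rewrite /call_payoff max_l// subr_ge0. Qed.

Lemma convex_put_payoff : convex_ereal (EFin \o put_payoff K).
Proof.
move=> t a b /andP[t0 t1]; rewrite /= -!EFinM -EFinD lee_fin ge_max.
have t1' : 0 <= 1 - t by rewrite subr_ge0.
have pa := put_payoff_ge0 a; have pb := put_payoff_ge0 b.
rewrite addr_ge0 ?mulr_ge0// andbT.
apply: (@le_trans _ _ (t * (K - a) + (1 - t) * (K - b))).
  by rewrite le_eqVlt; apply/orP; left; apply/eqP; ring.
by apply: lerD; apply: ler_wpM2l => //; rewrite le_max lexx.
Qed.

Lemma convex_call_payoff : convex_ereal (EFin \o call_payoff K).
Proof.
move=> t a b /andP[t0 t1]; rewrite /= -!EFinM -EFinD lee_fin ge_max.
have t1' : 0 <= 1 - t by rewrite subr_ge0.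
have pa := call_payoff_ge0 a; have pb := call_payoff_ge0 b.
rewrite addr_ge0 ?mulr_ge0// andbT.
apply: (@le_trans _ _ (t * (a - K) + (1 - t) * (b - K))).
  by rewrite le_eqVlt; apply/orP; left; apply/eqP; ring.
by apply: lerD; apply: ler_wpM2l => //; rewrite le_max lexx.
Qed.

End payoffs.

Lemma closure_ge (R : realType) (E : set R) (a x : R) :
  (forall y, E y -> a <= y) -> closure E x -> a <= x.
Proof.
move=> h; have : closure E `<=` closure [set y | a <= y] by exact: closure_subset.
by move=> /(_ x) hx /hx; rewrite -((closure_id _).1 (@closed_ge _ a)).
Qed.

Lemma closure_le (R : realType) (E : set R) (a x : R) :
  (forall y, E y -> y <= a) -> closure E x -> x <= a.
Proof.
move=> h; have : closure E `<=` closure [set y | y <= a] by exact: closure_subset.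
by move=> /(_ x) hx /hx; rewrite -((closure_id _).1 (@closed_le _ a)).
Qed.

(* At price 0 the put pays K for sure, and with r < 0 waiting for the first jump
   increases its discounted value strictly. *)
Lemma put_value_at0 (R : realType) d (Omega : measurableType d) (P : probability Omega R)
    (X : R -> Omega -> R) (N : R -> Omega -> nat) (lambda r K : R)
    (hX : levy_process P X) (hN : poisson_process P lambda N)
    (hlambda : 0 < lambda) (hr : r < 0) (hK : 0 < K) :
  ((put_payoff K 0)%:E < value P X N r (put_payoff K) 0)%E.
Proof.
have g0 := put_payoff_ge0 K.
have mg : measurable_fun setT (put_payoff K).
  exact: continuous_measurable_fun (@continuous_put_payoff _ K).
have gK : put_payoff K 0 = K by rewrite put_payoffE ?subr0// ltW.
apply: lt_le_trans (Qiterate_le_value hX hN r mg g0 0 0).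
rewrite /jump_operator /= ltNge; apply/negP.
under eq_integral do rewrite mul0r gK -EFinM.
rewrite gK => hle.
pose f w := (jump_discount N r 1 w - 1) * K.
have mD := measurable_jump_discount hX hN r 1.
have f0 w : 0 <= f w.
  rewrite mulr_ge0 ?(ltW hK)// subr_ge0 -expR0 ler_expR mulr_ge0 ?jump_ge0//.
  by rewrite oppr_ge0 ltW.
have mf : measurable_fun setT f.
  by apply: measurable_funM => //; apply: measurable_funB.
have PT : P setT = 1%E by exact: probability_setT.
have : (\int[P]_w `|(f w)%:E| = 0)%E.
  under eq_integral => w _ do rewrite gee0_abs ?lee_fin ?f0//.
  apply/eqP; rewrite eq_le; apply/andP; split; last first.
    by apply: integral_ge0 => w _; rewrite lee_fin.
  have KE : (\int[P]_(w in setT) (cst K%:E) w = K%:E)%E.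
    by rewrite integral_cst//; transitivity (K%:E * P setT)%E; rewrite // PT mule1.
  have sumE : (\int[P]_w (jump_discount N r 1 w * K)%:E =
      K%:E + \int[P]_w (f w)%:E)%E.
    rewrite -[in RHS]KE -ge0_integralD//.
    - by apply: eq_integral => w _; rewrite -EFinD; congr EFin; rewrite /f /=; ring.
    - by move=> w _; rewrite lee_fin ltW.
    - by move=> w _; rewrite lee_fin.
    - exact/measurable_EFinP.
  move: hle; rewrite sumE -[leRHS]adde0 leeD2lE//.
move=> /(ae_eq_integral_abs P measurableT (proj2 (measurable_EFinP _ _) mf)) hf.
(* Equality would force [T_1 = 0], against the strict growth of jump times; two almost sure
   statements in conflict give the empty event full probability. *)
have : P set0 = 1%E.
  apply: ae_full => //; apply: filterS2 hf (jump_strict hN hlambda 0) => w /(_ Logic.I) fw.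
  move=> [_ T1 T01]; move: fw => /= /eqP; rewrite eqe mulf_eq0 (gt_eqF hK) orbF subr_eq0.
  rewrite -expR0 => /eqP/expR_inj/eqP; rewrite mulf_eq0 oppr_eq0 (lt_eqF hr)/= => /eqP j0.
  by move: T01; rewrite (jump_time0 hN) -(jumpE T1) j0 ltxx.
by rewrite measure0 => /eqP; rewrite eqe eq_sym oner_eq0.
Qed.

Theorem theorem2p1 (R : realType) (d : measure_display)
    (Omega : measurableType d) (P : probability Omega R)
    (X : R -> Omega -> R) (N : R -> Omega -> nat) (lambda r K : R)
    (hX : levy_process P X) (hN : poisson_process P lambda N)
    (hXN : independent_processes P X N)
    (hr : r < 0) (hK : 0 < K) (hlambda : 0 < lambda) (hlr : 0 < lambda + r) :
  (forall (Linf Uinf : R),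
     let D := classical_stopping_region P X N r (put_payoff K) in
     (D !=set0 -> [/\ 0 <= Linf, Linf <= Uinf, Uinf < K &
                      closure D = [set s | Linf <= s <= Uinf]]) ->
     (forall s, 0 < s ->
        poisson_tail_value P X N r (put_payoff K) s n @[n --> \oo] --> 0%E) ->
     exists L U : R,
       [/\ 0 < L, L <= U, U < K,
           (D !=set0 -> L <= Linf /\ Uinf <= U) &
           forall s, 0 < s ->
             poisson_value P X N r (put_payoff K) s =
             'E_P[discounted_payoff X r (put_payoff K) s
                    (hit_time X N L U%:E s)]%E]) /\
  (forall (Linf : R) (Uinf : \bar R),
     let D := classical_stopping_region P X N r (call_payoff K) in
     (D !=set0 -> [/\ K < Linf, (Linf%:E <= Uinf)%E &
                      closure D = [set s | (Linf%:E <= s%:E <= Uinf)%E]]) ->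
     ('E_P[price X 1 1] < +oo)%E ->
     0 < lambda + r - ln (fine 'E_P[price X 1 1]%E) ->
     (forall s, 0 < s ->
        poisson_tail_value P X N r (call_payoff K) s n @[n --> \oo] --> 0%E) ->
     (exists (L : R) (U : \bar R),
       [/\ K < L, (L%:E <= U)%E,
           (D !=set0 -> L <= Linf /\ (Uinf <= U)%E) &
           forall s, 0 < s ->
             poisson_value P X N r (call_payoff K) s =
             'E_P[discounted_payoff X r (call_payoff K) s
                    (hit_time X N L U s)]%E])
     \/
     (forall s, 0 < s ->
        ((call_payoff K s)%:E < poisson_value0 P X N r (call_payoff K) s)%E)).
Proof.
split.
- move=> Linf Uinf D hD tail0.
  set g := put_payoff K.
  have g0 : forall x, 0 <= g x := put_payoff_ge0 K.
  have cg : continuous g := @continuous_put_payoff _ K.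
  have mg : measurable_fun setT g by exact: continuous_measurable_fun.
  pose A := poisson_region P X N r g.
  have DA : D `<=` A by exact: (classical_region_sub hX hN hXN hlambda mg g0).
  have AK s : A s -> s < K.
    move=> As; rewrite -put_payoff_gt0.
    apply: (poisson_region_gt0 hX hN hXN hlambda mg g0 cg _ As) => D0 x.
    by have [_ _ UK ->] := hD D0; move=> /andP[_ xU]; rewrite put_payoff_gt0 (le_lt_trans xU).
  have [a Aa] : A !=set0.
    exact: (poisson_region_nonempty hX hN hXN hlambda mg g0 hK (tail0 K hK)).
  have infA : has_inf A by split; [exists a|exists 0 => x [/ltW]].
  have supA : has_sup A by split; [exists a|exists K => x /AK/ltW].
  have AL : A (inf A).
    have [u uA uL] := inf_sequence infA.
    have vL := poisson_region_closed hX hN mg g0 cg uA uL.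
    split => //; rewrite lt_neqAle eq_sym; apply/andP; split.
      (* Were the infimum 0, lower semicontinuity would carry [value <= g] to the price 0. *)
      apply/eqP => L0; move: vL; rewrite L0; apply/negP; rewrite -ltNge.
      exact: (put_value_at0 hX hN hlambda hr hK).
    by apply: lb_le_inf; [exists a|move=> x [/ltW]].
  have LA x : A x -> inf A <= x by move=> Ax; apply: ge_inf => //; case: infA.
  have AU x : A x -> x <= sup A by move=> Ax; apply: ub_le_sup => //; case: supA.
  have AsupA : A (sup A).
    have [u uA uU] := sup_sequence supA.
    split; last exact: (poisson_region_closed hX hN mg g0 cg uA uU).
    by have [L0 _] := AL; exact: lt_le_trans L0 (AU _ AL).
  have hA x : 0 < x -> A x <-> ((inf A)%:E <= x%:E <= (sup A)%:E)%E.
    move=> x0; rewrite !lee_fin; split; first by move=> Ax; rewrite LA// AU.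
    apply: (poisson_region_interval hX hN mg g0 (@convex_put_payoff _ K) _ AL AsupA).
    move=> t /andP[t0 t1].
    have LK := ltW (AK _ AL); have UK := ltW (AK _ AsupA).
    rewrite /g !put_payoffE//; first by ring.
    by nra.
  exists (inf A), (sup A); split.
  + by case: AL.
  + exact: LA.
  + exact: AK.
  + move=> D0; have [L0 LU UK clD] := hD D0; split.
      apply: (closure_ge (E := D)); first by move=> y /DA/LA.
      by rewrite clD /= lexx.
    apply: (closure_le (E := D)); first by move=> y /DA/AU.
    by rewrite clD /= lexx andbT.
  + move=> s s0; rewrite (optimal_stopping hX hN hXN hlambda mg g0 (tail0 s s0)).
    by rewrite (hit_time_stop_below s0 hA).
- move=> Linf Uinf D hD _ _ tail0.
  set g := call_payoff K.
  have g0 : forall x, 0 <= g x := call_payoff_ge0 K.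
  have cg : continuous g := @continuous_call_payoff _ K.
  have mg : measurable_fun setT g by exact: continuous_measurable_fun.
  pose A := poisson_region P X N r g.
  have DA : D `<=` A by exact: (classical_region_sub hX hN hXN hlambda mg g0).
  have AK s : A s -> K < s.
    move=> As; rewrite -call_payoff_gt0.
    apply: (poisson_region_gt0 hX hN hXN hlambda mg g0 cg _ As) => D0 x.
    have [LK _ ->] := hD D0; move=> /andP[Lx _]; rewrite call_payoff_gt0 (lt_le_trans LK)//.
  have [ii|nii] := pselect (forall s, 0 < s ->
      ((g s)%:E < poisson_value0 P X N r g s)%E); [by right|left].
  have [a Aa] : A !=set0.
    (* Where alternative (ii) fails, V <= \bar V <= G, so the region is nonempty. *)
    move/existsNP: nii => [a /not_implyP[a0 /negP]]; rewrite -leNgt => va.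
    exists a; split => //; apply: le_trans va.
    rewrite -(poisson_valueE hX hN hXN hlambda r mg g0).
    apply: ge_ereal_sup => _ [tau [stau taue] <-]; apply: ereal_sup_ubound; exists tau => //.
    split => //; apply: filterS taue => w [->|h]; first exact: Or31.
    exact: Or33.
  have infA : has_inf A by split; [exists a|exists 0 => x [/ltW]].
  have AL : A (inf A).
    have [u uA uL] := inf_sequence infA.
    split; last exact: (poisson_region_closed hX hN mg g0 cg uA uL).
    by apply: (lt_le_trans hK); apply: lb_le_inf; [exists a|move=> x /AK/ltW].
  have LA x : A x -> inf A <= x by move=> Ax; apply: ge_inf => //; case: infA.
  have itv x b : A b -> inf A <= x <= b -> A x.
    move=> Ab; apply: (poisson_region_interval hX hN mg g0 (@convex_call_payoff _ K) _ AL Ab).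
    move=> t /andP[t0 t1].
    have LK := ltW (AK _ AL); have UK := ltW (AK _ Ab).
    rewrite /g !call_payoffE//; first by ring.
    by nra.
  (* The end [U] is the supremum of the region if it is bounded and [+oo] otherwise. The bound is
     asked for [closure D] because the data on [Uinf] concern the closure. *)
  suff [U [LU DU hA]] : exists U : \bar R, [/\ ((inf A)%:E <= U)%E,
      (forall x, closure D x -> x%:E <= U)%E &
      forall x, 0 < x -> A x <-> ((inf A)%:E <= x%:E <= U)%E].
    exists (inf A), U; split => //.
    + exact: AK.
    + move=> D0; have [LK LU' clD] := hD D0; split.
        apply: (closure_ge (E := D)); first by move=> y /DA/LA.
        by rewrite clD /= lexx.
      rewrite clD in DU; case: Uinf hD clD LU' DU => [u||]//= _ _ LU' DU.
        by apply: DU; rewrite LU' lexx.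
      case: U LU hA DU => [c||]//= _ _ DU.
      (* If [Uinf] is infinite, this point of [closure D] exceeds any finite candidate [c] for
         [U]. *)
      have := DU (Num.max Linf (c + 1)); rewrite !lee_fin leey andbT le_max lexx.
      by move=> /(_ isT); rewrite ge_max => /andP[_]; rewrite gerDl ler10.
    + move=> s s0; rewrite (optimal_stopping hX hN hXN hlambda mg g0 (tail0 s s0)).
      by rewrite (hit_time_stop_below s0 hA).
  have [ubA|nubA] := pselect (has_ubound A).
    have supA : has_sup A by split; [exists a|].
    have AU x : A x -> x <= sup A by move=> Ax; apply: ub_le_sup.
    have AsupA : A (sup A).
      have [u uA uU] := sup_sequence supA.
      split; last exact: (poisson_region_closed hX hN mg g0 cg uA uU).
      by have [L0 _] := AL; exact: lt_le_trans L0 (AU _ AL).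
    exists (sup A)%:E; split.
    + by rewrite lee_fin AU.
    + by move=> x; rewrite lee_fin; apply: closure_le => y /DA/AU.
    + move=> x x0; rewrite !lee_fin; split; first by move=> Ax; rewrite LA// AU.
      exact: itv.
  exists +oo%E; split; [exact: leey|by move=> x _; exact: leey|].
  move=> x x0; rewrite leey andbT lee_fin; split; first exact: LA.
  move=> Lx; have [b [Ab xb]] : exists b, A b /\ x <= b.
    apply: contrapT => nb; apply: nubA; exists x => y Ay.
    by rewrite leNgt; apply/negP => xy; apply: nb; exists y; rewrite ltW.
  by apply: (itv x b Ab); rewrite Lx.
Qed.
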